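(* Let $f:\mathbb B\to\mathbb B$ be a slice regular function on the open quaternionic unit ball, $n>0$ an integer and $p,p_1,\dots,p_n\in\mathbb B$. If $f$ is not a regular Blaschke product of degree $\le n$, then $$\left|(\mathcal M_{f^{\{n\}}_{p_1,\dots,p_n}(p)}\bullet f^{\{n\}}_{p_1,\dots,p_n})(q)\right|\le|\mathcal M_p(q)|$$ for all $q\in\mathbb B$, and the inequality is strict for $q\in\mathbb B\setminus\{p\}$ unless $f$ is a regular Blaschke product of degree $n+1$.
   Context: $\mathbb H$ is the skew-field of quaternions, $\mathbb B=\{q\in\mathbb H:|q|<1\}$, $\mathbb S=\{I\in\mathbb H:I^2=-1\}$, $\mathbb C_I=\mathbb R+\mathbb RI$. A function $f:\mathbb B\to\mathbb H$ is slice regular if it has continuous partial derivatives and $\frac12(\partial_x+I\partial_y)f(x+yI)=0$ on $\mathbb B\cap\mathbb C_I$ for every $I\in\mathbb S$; equivalently $f(q)=\sum_{m\ge0}q^ma_m$ with $a_m\in\mathbb H$, converging on $\mathbb B$. For $f=\sum q^ma_m$, $g=\sum q^mb_m$: $f\ast g=\sum_m q^m\sum_{\ell=0}^m a_{m-\ell}b_\ell$ (constants are regarded as constant functions), $f^c=\sum q^m\overline{a_m}$, $f^s=f\ast f^c$, $f^{-\ast}(q)=f^s(q)^{-1}f^c(q)$, slice regular off the zero set of $f^s$. For $p\in\mathbb B$, $\mathcal M_p(q)=(1-q\overline p)^{-\ast}\ast(q-p)$. For $c\in\mathbb B$ and slice regular $g:\mathbb B\to\mathbb B$, $\mathcal M_c\bullet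 g:=(1-g\,\overline c)^{-\ast}\ast(g-c)$. Hyperbolic difference quotient: for slice regular $f:\mathbb B\to\mathbb B$ and $p\in\mathbb B$, let $\mathcal R_{f,p}$ be the unique slice regular function on $\mathbb B$ with $f(q)=f(p)+(q-p)\ast\mathcal R_{f,p}(q)$. Then $f^\star_p(q):=(1-q\overline p)\ast\mathcal R_{f,p}(q)\ast(1-\overline{f(p)}\ast f(q))^{-\ast}$ (equivalently $f^\star_p=\mathcal M_p^{-\ast}\ast(\mathcal M_{f(p)}\bullet f)$, extended over removable singularities). It is either a unimodular constant or a slice regular map $\mathbb B\to\mathbb B$. Iterated quotients: $f^{\{1\}}_{p_1}:=f^\star_{p_1}$, and for $n>1$, $f^{\{n\}}_{p_1,\dots,p_n}:=f^{\{n-1\}}_{p_1,\dots,p_{n-1}}$ if the latter is a unimodular constant, and $f^{\{n\}}_{p_1,\dots,p_n}:=(f^{\{n-1\}}_{p_1,\dots,p_{n-1}})^\star_{p_n}$ otherwise. A regular (finite) Blaschke product is a function $\mathcal M_{s_1}\ast\cdots\ast\mathcal M_{s_\kappa}u$ with $\kappa\ge1$, $s_1,\dots,s_\kappa\in\mathbb B$, $|u|=1$; $\kappa$ is uniquely determined and called its degree. *)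

(* Defs.v *)
From Stdlib Require Import Reals List ClassicalEpsilon.
From Coquelicot Require Import Coquelicot.
Open Scope R_scope.

(* (a, b, c, d) is a + b i + c j + d k; addition, real scaling and the topology
   are those of Coquelicot's product of normed modules. *)
Definition quat : Type := (R * R * R * R)%type.

Definition Q0 (q : quat) : R := fst (fst (fst q)).
Definition Q1 (q : quat) : R := snd (fst (fst q)).
Definition Q2 (q : quat) : R := snd (fst q).
Definition Q3 (q : quat) : R := snd q.

Definition RtoQ (x : R) : quat := (x, 0, 0, 0).

Definition qadd (p q : quat) : quat := plus p q.
Definition qopp (q : quat) : quat := opp q.
Definition qsub (p q : quat) : quat := minus p q.

Definition qmul (p q : quat) : quat :=
  (Q0 p * Q0 q - Q1 p * Q1 q - Q2 p * Q2 q - Q3 p * Q3 q,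
   Q0 p * Q1 q + Q1 p * Q0 q + Q2 p * Q3 q - Q3 p * Q2 q,
   Q0 p * Q2 q - Q1 p * Q3 q + Q2 p * Q0 q + Q3 p * Q1 q,
   Q0 p * Q3 q + Q1 p * Q2 q - Q2 p * Q1 q + Q3 p * Q0 q).

Definition qconj (q : quat) : quat := (Q0 q, - Q1 q, - Q2 q, - Q3 q).

Definition qnorm (q : quat) : R :=
  sqrt (Q0 q ^ 2 + Q1 q ^ 2 + Q2 q ^ 2 + Q3 q ^ 2).

Definition qinv (q : quat) : quat := qmul (RtoQ (/ qnorm q ^ 2)) (qconj q).

Declare Scope quat_scope.
Delimit Scope quat_scope with Q.
Bind Scope quat_scope with quat.
Infix "+" := qadd : quat_scope.
Infix "-" := qsub : quat_scope.
Notation "- q" := (qopp q) : quat_scope.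
Infix "*" := qmul : quat_scope.
Notation "1" := (RtoQ 1) : quat_scope.
Notation "0" := (RtoQ 0) : quat_scope.

Fixpoint qpow (q : quat) (m : nat) : quat :=
  match m with
  | O => 1%Q
  | S k => (q * qpow q k)%Q
  end.

Definition in_ball (q : quat) : Prop := qnorm q < 1.

Definition imag_unit (I : quat) : Prop := (I * I = RtoQ (-1))%Q.

(* Below, functions on the unit ball are total functions [quat -> quat] whose
   values outside the ball are never used. *)

Definition slice_pt (I : quat) (x y : R) : quat := (RtoQ x + RtoQ y * I)%Q.

(* The continuous partial derivatives are those of the restriction of [f] to
   each slice, as a function of (x, y). *)
Definition slice_regular (f : quat -> quat) : Prop :=
  forall I : quat, imag_unit I ->
  exists fx fy : R * R -> quat,
  forall x y : R, in_ball (slice_pt I x y) ->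
    is_derive (fun t : R => f (slice_pt I t y)) x (fx (x, y)) /\
    is_derive (fun t : R => f (slice_pt I x t)) y (fy (x, y)) /\
    continuous fx (x, y) /\
    continuous fy (x, y) /\
    (RtoQ (1 / 2) * (fx (x, y) + I * fy (x, y)) = 0)%Q.

Definition has_qpseries (f : quat -> quat) (a : nat -> quat) : Prop :=
  forall q : quat, in_ball q -> is_series (fun m => (qpow q m * a m)%Q) (f q).

Definition qpseries (a : nat -> quat) (q : quat) : quat :=
  let u := fun m => (qpow q m * a m)%Q in
  (Series (fun m => Q0 (u m)), Series (fun m => Q1 (u m)),
   Series (fun m => Q2 (u m)), Series (fun m => Q3 (u m))).

(* Every slice regular function on the ball has exactly one expansion, so the
   choice below is then determined by the values of [f] on the ball. *)
Definition qcoef (f : quat -> quat) : nat -> quat :=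
  epsilon (inhabits (fun _ => 0%Q)) (has_qpseries f).

Definition cst (c : quat) : quat -> quat := fun _ => c.

Definition star (f g : quat -> quat) : quat -> quat :=
  qpseries (fun m => sum_n (fun l => (qcoef f (m - l)%nat * qcoef g l)%Q) m).

Definition reg_conj (f : quat -> quat) : quat -> quat :=
  qpseries (fun m => qconj (qcoef f m)).

Definition symm (f : quat -> quat) : quat -> quat := star f (reg_conj f).

Definition star_inv (f : quat -> quat) : quat -> quat :=
  fun q => (qinv (symm f q) * reg_conj f q)%Q.

Definition moebius (p : quat) : quat -> quat :=
  star (star_inv (fun q => 1 - q * qconj p)%Q) (fun q => q - p)%Q.

Definition moebius_act (c : quat) (g : quat -> quat) : quat -> quat :=
  star (star_inv (fun q => 1 - g q * qconj c)%Q) (fun q => g q - c)%Q.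

Definition blaschke_prod (s : list quat) (u : quat) : quat -> quat :=
  List.fold_right (fun c F => star (moebius c) F) (cst u) s.

Definition is_blaschke (k : nat) (f : quat -> quat) : Prop :=
  (1 <= k)%nat /\
  exists (s : list quat) (u : quat),
    List.length s = k /\ List.Forall in_ball s /\ qnorm u = 1 /\
    forall q : quat, in_ball q -> f q = blaschke_prod s u q.

Definition diff_quot (f : quat -> quat) (p : quat) : quat -> quat :=
  epsilon (inhabits (cst 0%Q)) (fun r : quat -> quat =>
    slice_regular r /\
    forall q : quat, in_ball q ->
      f q = (f p + star (fun z => z - p) r q)%Q).

(* Left [star]-multiplication by a constant, unlike right multiplication, is
   not pointwise. *)
Definition hyp_quot (f : quat -> quat) (p : quat) : quat -> quat :=
  star (star (fun q => 1 - q * qconj p)%Q (diff_quot f p))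
       (star_inv (fun q => 1 - star (cst (qconj (f p))) f q)%Q).

Definition unimodular_constant (g : quat -> quat) : Prop :=
  exists u : quat, qnorm u = 1 /\ forall q : quat, in_ball q -> g q = u.

(* The base points are [ps 1], ..., [ps n]; the case n = 0 is a convention. *)
Fixpoint iter_hyp_quot (f : quat -> quat) (ps : nat -> quat) (n : nat)
  : quat -> quat :=
  match n with
  | O => f
  | S O => hyp_quot f (ps 1%nat)
  | S m =>
      let g := iter_hyp_quot f ps m in
      if excluded_middle_informative (unimodular_constant g)
      then g else hyp_quot g (ps n)
  end.

(* Main.v *)
Require Import Defs.
From Stdlib Require Import Reals Lra Lia List FunctionalExtensionality ClassicalEpsilon.
From Coquelicot Require Import Coquelicot.
Open Scope R_scope.

(** Write g for the n-th iterated quotient of [f], and h for the hyperbolic difference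
    quotient of g at p. The Moebius transform of g that vanishes at p is the star
    product M_p * h ([hyp_quot_spec]), and the product formula ([star_eval])
      (M_p * h)(q) = M_p(q) h(q'),  with q' conjugate to q,
    reduces the theorem to bounds for h: |h| <= 1 is the first assertion, and |h| < 1 is
    the second one. By the maximum principle either |h| < 1 on the whole ball or h is a
    unimodular constant ([schur_dichotomy]); so it remains to see that a unimodular
    constant among the quotients makes [f] a Blaschke product, of degree at most m if
    it is the m-th quotient, and of degree at most n + 1 if it is h. Since [f] is not
    a Blaschke product of degree at most n, upper bounds for the degree suffice: the
    first case is impossible and in the second one the degree is n + 1.

    The converse passage from a quotient to [f] is a multiplication by some M_p followed
    by a Moebius transformation M_c, and the difficulty is that M_c does not visibly
    respect factorizations into Moebius factors. What it does respect is the rank of the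
    kernel (1 - f(x) f(y)^-) / (1 - x y), x and y real: this kernel undergoes a congruence
    under M_c, and its rank grows by at most one under multiplication by M_p
    ([rank_inner_hyp_quot]). Conversely let [f] be a Schur function with kernel of rank at
    most k and with |f| tending to 1 at the unit sphere. If [f] has a zero s, then
    f = M_s * f1, and the kernel of f1 has smaller rank ([kernel_rank_peel]). If [f] has no
    zero, its star inverse is a regular function with the same boundary behaviour, and
    the maximum principle shows that [f] is a unimodular constant
    ([zero_free_constant]). Hence [f] is a product of at most k Moebius factors and a
    unimodular constant ([blaschke_of_rank]).

    Two tools serve throughout. Regular functions are determined by their values on the
    real axis, where star products are pointwise products, so that identities between
    them reduce to the algebra of quaternions. And for zero-free f the map
    q |-> f(q)^-1 q f(q) carries every sphere onto itself ([conj_onto]), so that norm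
    estimates pass from a star product to its right factor.

    The function theory is developed from the definition of slice regularity.
    Cauchy's formula in a single slice ([cauchy_invariance]) yields power series and
    Cauchy estimates; the latter, applied to star powers, give the maximum principle
    ([max_modulus], [max_const]). Pointwise inverses of symmetrizations are slice regular,
    hence power series again, which provides star inverses ([star_inv_regular]). *)

(** * Quaternions *)

(** The normed module on the carrier of [quat], spelled out because canonical
    structure inference does not see through the definition of [quat]. *)
Notation quatN := (prod_NormedModule R_AbsRing (prod_NormedModule R_AbsRing
  (prod_NormedModule R_AbsRing R_NormedModule R_NormedModule) R_NormedModule)
  R_NormedModule).

Lemma quat_ext (p q : quat) :
  Q0 p = Q0 q -> Q1 p = Q1 q -> Q2 p = Q2 q -> Q3 p = Q3 q -> p = q.
Proof.
destruct p as [[[a b] c] d], q as [[[a' b'] c'] d'].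
unfold Q0, Q1, Q2, Q3; simpl; intros; subst; reflexivity.
Qed.

Ltac qcoord :=
  unfold qadd, qsub, qopp, qmul, qconj, RtoQ, Q0, Q1, Q2, Q3, minus, plus, opp;
  simpl; unfold plus, opp; simpl.

Ltac qring := intros; apply quat_ext; qcoord; ring.

Open Scope quat_scope.

Lemma qadd_assoc p q r : p + (q + r) = p + q + r. Proof. qring. Qed.
Lemma qadd_0l p : 0 + p = p. Proof. qring. Qed.
Lemma qmul_assoc p q r : p * (q * r) = p * q * r. Proof. qring. Qed.
Lemma qmul_addl p q r : (p + q) * r = p * r + q * r. Proof. qring. Qed.
Lemma qmul_addr p q r : r * (p + q) = r * p + r * q. Proof. qring. Qed.
Lemma qmul_subl p q r : (p - q) * r = p * r - q * r. Proof. qring. Qed.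
Lemma qmul_subr p q r : r * (p - q) = r * p - r * q. Proof. qring. Qed.
Lemma qmul_1l p : 1 * p = p. Proof. qring. Qed.
Lemma qmul_1r p : p * 1 = p. Proof. qring. Qed.
Lemma qmul_0l p : 0 * p = 0. Proof. qring. Qed.
Lemma qmul_0r p : p * 0 = 0. Proof. qring. Qed.
Lemma qsub_neg p q : p - q = p + RtoQ (-1) * q. Proof. qring. Qed.
Lemma qsub_diag p : p - p = 0. Proof. qring. Qed.
Lemma RtoQ_comm x p : RtoQ x * p = p * RtoQ x. Proof. qring. Qed.
Lemma RtoQ_mul x y : RtoQ (x * y) = RtoQ x * RtoQ y. Proof. qring. Qed.
Lemma qconj_mul p q : qconj (p * q) = qconj q * qconj p. Proof. qring. Qed.
Lemma qconj_add p q : qconj (p + q) = qconj p + qconj q. Proof. qring. Qed.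
Lemma qconj_sub p q : qconj (p - q) = qconj p - qconj q. Proof. qring. Qed.
Lemma qconj_conj p : qconj (qconj p) = p. Proof. qring. Qed.
Lemma qconj_RtoQ x : qconj (RtoQ x) = RtoQ x. Proof. qring. Qed.

Lemma qconj_scal x p : qconj (RtoQ x * p) = RtoQ x * qconj p. Proof. qring. Qed.

Lemma qsub_eq0 p q : p - q = 0 -> p = q.
Proof.
intros H. replace p with ((p - q) + q) by qring. rewrite H. qring.
Qed.

Lemma qnorm_ge0 q : (0 <= qnorm q)%R.
Proof. apply sqrt_pos. Qed.

Lemma qnorm_sqr q :
  (qnorm q ^ 2 = Q0 q ^ 2 + Q1 q ^ 2 + Q2 q ^ 2 + Q3 q ^ 2)%R.
Proof. unfold qnorm; rewrite pow2_sqrt; [reflexivity | nra]. Qed.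

Lemma norm_qnorm (q : quatN) : norm q = qnorm q.
Proof.
destruct q as [[[a b] c] d].
unfold qnorm, Q0, Q1, Q2, Q3; simpl.
unfold norm; simpl; unfold prod_norm; simpl.
unfold norm; simpl; unfold prod_norm; simpl.
unfold norm; simpl; unfold prod_norm; simpl.
unfold norm; simpl; unfold abs; simpl.
f_equal. rewrite !Rmult_1_r, sqrt_sqrt.
- rewrite sqrt_sqrt.
  + repeat rewrite <- Rabs_mult.
    rewrite !Rabs_pos_eq by nra. ring.
  + nra.
- apply Rplus_le_le_0_compat; [| nra].
  nra.
Qed.

Lemma qnorm_triangle p q : (qnorm (p + q) <= qnorm p + qnorm q)%R.
Proof.
rewrite <- !norm_qnorm. apply (norm_triangle (p : quatN) q).
Qed.

Lemma qnorm_opp p : qnorm (- p) = qnorm p.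
Proof.
rewrite <- !norm_qnorm. apply (norm_opp (p : quatN)).
Qed.

Lemma qnorm_eq (p : quat) (x : R) : (0 <= x)%R -> (qnorm p ^ 2 = x ^ 2)%R -> qnorm p = x.
Proof.
intros Hx H. generalize (qnorm_ge0 p). nra.
Qed.

Lemma qnorm_mul p q : (qnorm (p * q) = qnorm p * qnorm q)%R.
Proof.
apply qnorm_eq.
- apply Rmult_le_pos; apply qnorm_ge0.
- rewrite Rpow_mult_distr, !qnorm_sqr. qcoord. ring.
Qed.

Lemma qnorm_conj p : qnorm (qconj p) = qnorm p.
Proof.
apply qnorm_eq; [apply qnorm_ge0 |]. rewrite !qnorm_sqr. qcoord. ring.
Qed.

Lemma qnorm_RtoQ x : qnorm (RtoQ x) = Rabs x.
Proof.
apply qnorm_eq; [apply Rabs_pos |]. rewrite pow2_abs, qnorm_sqr. qcoord. ring.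
Qed.

Lemma qnorm_1 : qnorm 1 = 1%R.
Proof. rewrite qnorm_RtoQ. apply Rabs_R1. Qed.

Lemma qnorm_0 : qnorm 0 = 0%R.
Proof. rewrite qnorm_RtoQ. apply Rabs_R0. Qed.

Lemma in_ball_0 : in_ball 0.
Proof. unfold in_ball. rewrite qnorm_0. lra. Qed.

Lemma qnorm_eq0 p : qnorm p = 0%R -> p = 0.
Proof.
intros H. generalize (qnorm_sqr p). rewrite H.
destruct p as [[[a b] c] d]. unfold Q0, Q1, Q2, Q3, RtoQ; simpl.
intros E. assert (a = 0 /\ b = 0 /\ c = 0 /\ d = 0)%R as (-> & -> & -> & ->);
  [repeat split; nra | reflexivity].
Qed.

Lemma qnorm_pos p : p <> 0 -> (0 < qnorm p)%R.
Proof.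
intros H. destruct (qnorm_ge0 p) as [K | K]; [exact K |].
exfalso; apply H, qnorm_eq0; now symmetry.
Qed.

Lemma qnorm_neq0 p : (0 < qnorm p)%R -> p <> 0.
Proof. intros H E. rewrite E, qnorm_0 in H. lra. Qed.

Lemma qnorm_sub_sym p q : qnorm (p - q) = qnorm (q - p).
Proof. rewrite <- (qnorm_opp (p - q)). f_equal. qring. Qed.

Lemma qnorm_sub_ge p q : (qnorm p - qnorm q <= qnorm (p - q))%R.
Proof.
assert (H := qnorm_triangle (p - q) q).
replace (p - q + q) with p in H by qring. lra.
Qed.

Lemma qnorm_sub_le p q : (qnorm (p - q) <= qnorm p + qnorm q)%R.
Proof.
replace (p - q) with (p + - q) by qring.
rewrite <- (qnorm_opp q). apply qnorm_triangle.
Qed.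

Lemma qnorm_pow q m : (qnorm (qpow q m) = qnorm q ^ m)%R.
Proof.
induction m as [| m IH]; simpl; [apply qnorm_1 |]. now rewrite qnorm_mul, IH.
Qed.

Lemma qmul_conj_r q : q * qconj q = RtoQ (qnorm q ^ 2).
Proof. rewrite qnorm_sqr. qring. Qed.

Lemma qmul_conj_l q : qconj q * q = RtoQ (qnorm q ^ 2).
Proof. rewrite qnorm_sqr. qring. Qed.

Lemma qinv_l q : q <> 0 -> qinv q * q = 1.
Proof.
intros H. apply qnorm_pos in H. unfold qinv.
rewrite <- qmul_assoc, qmul_conj_l, <- RtoQ_mul. f_equal. field. lra.
Qed.

Lemma qinv_r q : q <> 0 -> q * qinv q = 1.
Proof.
intros H. apply qnorm_pos in H. unfold qinv.
rewrite RtoQ_comm, qmul_assoc, qmul_conj_r, <- RtoQ_mul. f_equal. field. lra.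
Qed.

Lemma qnorm_inv q : q <> 0 -> qnorm (qinv q) = (/ qnorm q)%R.
Proof.
intros H. assert (K := qnorm_pos _ H).
apply Rmult_eq_reg_r with (qnorm q); [| lra].
rewrite <- qnorm_mul, qinv_l, qnorm_1 by exact H. field. lra.
Qed.

Lemma qmul_eq0 p q : p * q = 0 -> p = 0 \/ q = 0.
Proof.
intros H. assert (K : (qnorm p * qnorm q = 0)%R)
  by (rewrite <- qnorm_mul, H; apply qnorm_0).
apply Rmult_integral in K. destruct K; [left | right]; now apply qnorm_eq0.
Qed.

Lemma qmul_cancel_l p q r : p <> 0 -> p * q = p * r -> q = r.
Proof.
intros H E. rewrite <- (qmul_1l q), <- (qmul_1l r), <- (qinv_l p H).
now rewrite <- !qmul_assoc, E.
Qed.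

Lemma qmul_cancel_r p q r : p <> 0 -> q * p = r * p -> q = r.
Proof.
intros H E. rewrite <- (qmul_1r q), <- (qmul_1r r), <- (qinv_r p H).
now rewrite !qmul_assoc, E.
Qed.

Lemma qpow_RtoQ x m : qpow (RtoQ x) m = RtoQ (x ^ m).
Proof.
induction m as [| m IH]; simpl; [reflexivity |]. now rewrite IH, <- RtoQ_mul.
Qed.

Lemma qpow_add q m k : qpow q (m + k) = qpow q m * qpow q k.
Proof.
induction m as [| m IH]; simpl; [now rewrite qmul_1l |].
now rewrite IH, qmul_assoc.
Qed.

Lemma qpow_comm p q m : p * q = q * p -> p * qpow q m = qpow q m * p.
Proof.
intros H. induction m as [| m IH]; simpl; [now rewrite qmul_1l, qmul_1r |].
now rewrite qmul_assoc, H, <- !qmul_assoc, IH.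
Qed.

Lemma qpow_S_r q m : qpow q (S m) = qpow q m * q.
Proof. simpl. now apply qpow_comm. Qed.

Lemma scal_RtoQ (x : R) (q : quatN) : scal x q = (RtoQ x * q : quat).
Proof.
apply quat_ext; destruct q as [[[a b] c] d];
unfold scal; simpl; unfold prod_scal, scal; simpl;
unfold prod_scal, scal; simpl; unfold prod_scal, scal; simpl;
unfold scal; simpl; unfold mult; simpl; qcoord; ring.
Qed.

Lemma qnorm_comp q :
  (Rabs (Q0 q) <= qnorm q /\ Rabs (Q1 q) <= qnorm q /\
  Rabs (Q2 q) <= qnorm q /\ Rabs (Q3 q) <= qnorm q)%R.
Proof.
assert (H := qnorm_sqr q). assert (K := qnorm_ge0 q).
repeat split; apply Rsqr_incr_0_var; try exact K;
rewrite <- Rsqr_abs; unfold Rsqr; nra.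
Qed.

Lemma qnorm_le_comp q :
  (qnorm q <= Rabs (Q0 q) + Rabs (Q1 q) + Rabs (Q2 q) + Rabs (Q3 q))%R.
Proof.
apply Rsqr_incr_0_var.
- assert (H := qnorm_sqr q).
  rewrite !Rsqr_pow2, H.
  rewrite <- !(pow2_abs (Q0 q)), <- !(pow2_abs (Q1 q)), <- !(pow2_abs (Q2 q)), <- !(pow2_abs (Q3 q)).
  generalize (Rabs_pos (Q0 q)) (Rabs_pos (Q1 q)) (Rabs_pos (Q2 q)) (Rabs_pos (Q3 q)).
  generalize (Rabs (Q0 q)) (Rabs (Q1 q)) (Rabs (Q2 q)) (Rabs (Q3 q)).
  intros; nra.
- generalize (Rabs_pos (Q0 q)) (Rabs_pos (Q1 q)) (Rabs_pos (Q2 q)) (Rabs_pos (Q3 q)). lra.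
Qed.

Lemma slice_pt_ex q : exists I x y, imag_unit I /\ q = slice_pt I x y.
Proof.
destruct q as [[[a b] c] d].
destruct (Req_dec (b ^ 2 + c ^ 2 + d ^ 2) 0) as [H | H].
- exists (0, 1, 0, 0)%R, a, 0%R. split; [unfold imag_unit; qring |].
  assert (b = 0 /\ c = 0 /\ d = 0)%R as (-> & -> & ->) by (repeat split; nra).
  unfold slice_pt; qring.
- set (y := sqrt (b ^ 2 + c ^ 2 + d ^ 2)).
  assert (Hy : (y ^ 2 = b ^ 2 + c ^ 2 + d ^ 2)%R) by (unfold y; rewrite pow2_sqrt; [reflexivity | nra]).
  assert (Hy0 : y <> 0%R) by (intros E; rewrite E in Hy; nra).
  exists (0, b / y, c / y, d / y)%R, a, y. split.
  + unfold imag_unit; apply quat_ext; qcoord; try (field; exact Hy0).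
    apply Rmult_eq_reg_r with (y ^ 2)%R; [| nra].
    transitivity (- (b ^ 2 + c ^ 2 + d ^ 2))%R; [field; exact Hy0 | rewrite <- Hy; ring].
  + unfold slice_pt; apply quat_ext; qcoord; field; exact Hy0.
Qed.

Lemma imag_unit_coord I : imag_unit I ->
  (Q0 I = 0 /\ Q1 I ^ 2 + Q2 I ^ 2 + Q3 I ^ 2 = 1)%R.
Proof.
destruct I as [[[a b] c] d]. unfold imag_unit.
intros H. assert (H0 := f_equal Q0 H). assert (H1 := f_equal Q1 H).
assert (H2 := f_equal Q2 H). assert (H3 := f_equal Q3 H). clear H.
revert H0 H1 H2 H3. qcoord. intros.
assert (a = 0)%R by nra. subst. split; [reflexivity | nra].
Qed.

Lemma imag_unit_neq0 I : imag_unit I -> I <> 0.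
Proof.
intros H E. unfold imag_unit in H. rewrite E in H. apply (f_equal Q0) in H.
revert H. qcoord. lra.
Qed.

Lemma slice_pt_norm I x y : imag_unit I -> (qnorm (slice_pt I x y) ^ 2 = x ^ 2 + y ^ 2)%R.
Proof.
intros H. apply imag_unit_coord in H. destruct H as [H0 H1].
rewrite qnorm_sqr. unfold slice_pt.
replace (x ^ 2 + y ^ 2)%R with (x ^ 2 + y ^ 2 * (Q1 I ^ 2 + Q2 I ^ 2 + Q3 I ^ 2))%R by (rewrite H1; ring).
revert H0. destruct I as [[[a b] c] d]. qcoord. intros ->. ring.
Qed.

Close Scope quat_scope.

(** * Series of quaternions *)

Lemma linear_continuous {U V : NormedModule R_AbsRing} (T : U -> V) (x : U) :
  is_linear T -> continuous T x.
Proof.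
intros H. apply filterdiff_continuous. exists T. now apply filterdiff_linear.
Qed.

Lemma linear_zero {U V : NormedModule R_AbsRing} (T : U -> V) : is_linear T -> T zero = zero.
Proof.
intros H. transitivity (T (scal zero zero)).
- f_equal. symmetry. exact (@scal_zero_l _ (NormedModule.ModuleSpace R_AbsRing U) zero).
- rewrite (linear_scal T H). exact (@scal_zero_l _ (NormedModule.ModuleSpace R_AbsRing V) (T zero)).
Qed.

Lemma sum_n_linear {U V : NormedModule R_AbsRing} (T : U -> V) (u : nat -> U) n :
  is_linear T -> sum_n (fun k => T (u k)) n = T (sum_n u n).
Proof.
intros H. induction n as [| n IH]; [now rewrite !sum_O |].
now rewrite !sum_Sn, IH, (linear_plus T H).
Qed.

Lemma is_series_linear {U V : NormedModule R_AbsRing} (T : U -> V)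
    (u : nat -> U) (l : U) :
  is_linear T -> is_series u l -> is_series (fun n => T (u n)) (T l).
Proof.
intros H Hu. unfold is_series.
apply filterlim_ext with (fun n => T (sum_n u n)).
- intros n. now rewrite sum_n_linear.
- eapply filterlim_comp; [exact Hu | now apply linear_continuous].
Qed.

Lemma is_derive_linear {U V : NormedModule R_AbsRing} (T : U -> V)
    (u : R -> U) (x : R) (l : U) :
  is_linear T -> is_derive u x l -> is_derive (fun t => T (u t)) x (T l).
Proof.
intros H Hu. unfold is_derive.
apply filterdiff_ext_lin with (fun y : R => T (scal y l)).
- apply (filterdiff_comp' u T); [exact Hu | now apply filterdiff_linear].
- intros y. apply (linear_scal T H).
Qed.

Lemma linear_of_bound {U V : NormedModule R_AbsRing} (T : U -> V) (M : R) :
  (forall x y, T (plus x y) = plus (T x) (T y)) ->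
  (forall k x, T (scal k x) = scal k (T x)) ->
  (forall x, norm (T x) <= M * norm x) -> is_linear T.
Proof.
intros H1 H2 H3. split; [exact H1 | exact H2 |].
exists (Rmax M 1). split; [apply Rlt_le_trans with 1; [lra | apply Rmax_r] |].
intros x. apply Rle_trans with (1 := H3 x).
apply Rmult_le_compat_r; [apply norm_ge_0 | apply Rmax_l].
Qed.

Lemma linear_qmul_l (c : quat) : is_linear (fun q : quatN => (c * q)%Q : quatN).
Proof.
apply linear_of_bound with (qnorm c).
- intros x y. apply qmul_addr.
- intros k x. rewrite !scal_RtoQ, !qmul_assoc. now rewrite (RtoQ_comm k).
- intros x. rewrite !norm_qnorm, qnorm_mul. lra.
Qed.

Lemma linear_qmul_r (c : quat) : is_linear (fun q : quatN => (q * c)%Q : quatN).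
Proof.
apply linear_of_bound with (qnorm c).
- intros x y. apply qmul_addl.
- intros k x. now rewrite !scal_RtoQ, !qmul_assoc.
- intros x. rewrite !norm_qnorm, qnorm_mul. lra.
Qed.

Lemma linear_qconj : is_linear (fun q : quatN => qconj q : quatN).
Proof.
apply linear_of_bound with 1.
- intros x y. apply qconj_add.
- intros k x. rewrite !scal_RtoQ, qconj_mul, qconj_RtoQ. symmetry; apply RtoQ_comm.
- intros x. rewrite !norm_qnorm, qnorm_conj. lra.
Qed.

Lemma scal_coord (k : R) (x : quatN) :
  Q0 (scal k x) = k * Q0 x /\ Q1 (scal k x) = k * Q1 x /\
  Q2 (scal k x) = k * Q2 x /\ Q3 (scal k x) = k * Q3 x.
Proof. rewrite scal_RtoQ. destruct x as [[[a b] c] d]. qcoord. repeat split; ring. Qed.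

Ltac linear_coord :=
  apply linear_of_bound with 1; [reflexivity | intros k x; apply scal_coord |];
  intros x; rewrite norm_qnorm, Rmult_1_l; apply qnorm_comp.

Lemma linear_Q0 : is_linear (fun q : quatN => Q0 q : R_NormedModule).
Proof. linear_coord. Qed.
Lemma linear_Q1 : is_linear (fun q : quatN => Q1 q : R_NormedModule).
Proof. linear_coord. Qed.
Lemma linear_Q2 : is_linear (fun q : quatN => Q2 q : R_NormedModule).
Proof. linear_coord. Qed.
Lemma linear_Q3 : is_linear (fun q : quatN => Q3 q : R_NormedModule).
Proof. linear_coord. Qed.

(** For a lemma [L] with one premise per coordinate and a proof [K] of the premise
    for every real linear functional. *)
Tactic Notation "by_coord" uconstr(L) constr(K) :=
  apply L; [exact (K (fun q : quatN => Q0 q) linear_Q0) | exact (K (fun q : quatN => Q1 q) linear_Q1)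
   | exact (K (fun q : quatN => Q2 q) linear_Q2) | exact (K (fun q : quatN => Q3 q) linear_Q3)].

Lemma linear_RtoQ_l (c : quat) : is_linear (fun x : R_NormedModule => (RtoQ x * c)%Q : quatN).
Proof.
apply linear_of_bound with (qnorm c).
- intros x y. apply quat_ext; qcoord; ring.
- intros k x. rewrite scal_RtoQ, qmul_assoc, <- RtoQ_mul. reflexivity.
- intros x. rewrite norm_qnorm, qnorm_mul, qnorm_RtoQ. unfold norm; simpl. unfold abs; simpl. lra.
Qed.

Definition qi : quat := (0, 1, 0, 0).
Definition qj : quat := (0, 0, 1, 0).
Definition qk : quat := (0, 0, 0, 1).

Lemma quat_basis (q : quat) :
  (RtoQ (Q0 q) * 1 + RtoQ (Q1 q) * qi + (RtoQ (Q2 q) * qj + RtoQ (Q3 q) * qk) = q)%Q.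
Proof. unfold qi, qj, qk; qring. Qed.

Lemma is_series_coord (u : nat -> quatN) (l : quatN) :
  is_series (fun n => Q0 (u n)) (Q0 l) -> is_series (fun n => Q1 (u n)) (Q1 l) ->
  is_series (fun n => Q2 (u n)) (Q2 l) -> is_series (fun n => Q3 (u n)) (Q3 l) ->
  is_series u l.
Proof.
intros H0 H1 H2 H3.
apply (is_series_linear _ _ _ (linear_RtoQ_l 1%Q)) in H0.
apply (is_series_linear _ _ _ (linear_RtoQ_l qi)) in H1.
apply (is_series_linear _ _ _ (linear_RtoQ_l qj)) in H2.
apply (is_series_linear _ _ _ (linear_RtoQ_l qk)) in H3.
rewrite <- (quat_basis l).
eapply is_series_ext; [| exact (is_series_plus _ _ _ _ (is_series_plus _ _ _ _ H0 H1) (is_series_plus _ _ _ _ H2 H3))].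
intros n. exact (quat_basis (u n)).
Qed.

Lemma is_derive_coord (u : R -> quatN) (x : R) (l : quatN) :
  is_derive (fun t => Q0 (u t)) x (Q0 l) -> is_derive (fun t => Q1 (u t)) x (Q1 l) ->
  is_derive (fun t => Q2 (u t)) x (Q2 l) -> is_derive (fun t => Q3 (u t)) x (Q3 l) ->
  is_derive u x l.
Proof.
intros H0 H1 H2 H3.
apply (is_derive_linear _ _ _ _ (linear_RtoQ_l 1%Q)) in H0.
apply (is_derive_linear _ _ _ _ (linear_RtoQ_l qi)) in H1.
apply (is_derive_linear _ _ _ _ (linear_RtoQ_l qj)) in H2.
apply (is_derive_linear _ _ _ _ (linear_RtoQ_l qk)) in H3.
rewrite <- (quat_basis l).
eapply is_derive_ext; [| exact (is_derive_plus _ _ _ _ _ (is_derive_plus _ _ _ _ _ H0 H1) (is_derive_plus _ _ _ _ _ H2 H3))].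
intros n. exact (quat_basis (u n)).
Qed.

Lemma continuous_coord {U : UniformSpace} (u : U -> quatN) (x : U) :
  continuous (fun t => Q0 (u t)) x -> continuous (fun t => Q1 (u t)) x ->
  continuous (fun t => Q2 (u t)) x -> continuous (fun t => Q3 (u t)) x ->
  continuous u x.
Proof.
intros H0 H1 H2 H3.
assert (C : forall c (v : U -> R), continuous v x -> continuous (fun t => (RtoQ (v t) * c)%Q : quatN) x).
{ intros c v Hv. apply (continuous_comp v (fun y : R_NormedModule => (RtoQ y * c)%Q : quatN)); [exact Hv |].
  exact (linear_continuous _ _ (linear_RtoQ_l c)). }
eapply continuous_ext; [intros t; exact (quat_basis (u t)) |].
apply (continuous_plus (V := quatN)); apply (continuous_plus (V := quatN)); now apply C.
Qed.

Lemma continuous_linear {W : UniformSpace} {U V : NormedModule R_AbsRing}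
    (T : U -> V) (u : W -> U) (x : W) :
  is_linear T -> continuous u x -> continuous (fun t => T (u t)) x.
Proof.
intros H Hu. apply (continuous_comp u T); [exact Hu | now apply linear_continuous].
Qed.

Lemma qnorm_sum_n (u : nat -> quatN) n :
  qnorm (sum_n u n) <= sum_n (fun k => qnorm (u k)) n.
Proof.
induction n as [| n IH]; [rewrite !sum_O; lra |].
rewrite !sum_Sn. eapply Rle_trans; [apply qnorm_triangle |].
apply Rplus_le_compat; [exact IH | apply Rle_refl].
Qed.

Lemma is_series_norm_le (u : nat -> quatN) (l : quatN) (b : nat -> R) (s : R) :
  (forall n, qnorm (u n) <= b n) -> is_series u l -> is_series b s -> qnorm l <= s.
Proof.
intros H Hu Hb.
apply (is_lim_seq_le (fun n => qnorm (sum_n u n)) (sum_n b) (qnorm l) s).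
- intros n. eapply Rle_trans; [apply qnorm_sum_n |]. apply sum_n_m_le; exact H.
- rewrite <- norm_qnorm.
  apply filterlim_ext with (fun n => norm (sum_n u n)); [intros; apply norm_qnorm |].
  eapply filterlim_comp; [exact Hu | apply filterlim_norm].
- exact Hb.
Qed.

Lemma is_series_ex (u : nat -> quatN) (b : nat -> R) :
  (forall n, qnorm (u n) <= b n) -> ex_series b -> exists l, is_series u l.
Proof.
intros H Hb.
assert (E : forall T : quatN -> R, (forall q, Rabs (T q) <= qnorm q) -> ex_series (fun n => T (u n))).
{ intros T HT. apply (ex_series_le (V := R_CompleteNormedModule) _ b); [| exact Hb].
  intros n. apply Rle_trans with (2 := H n), HT. }
destruct (E (fun q => Q0 q)) as [l0 H0]; [intros q; apply qnorm_comp |].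
destruct (E (fun q => Q1 q)) as [l1 H1]; [intros q; apply qnorm_comp |].
destruct (E (fun q => Q2 q)) as [l2 H2]; [intros q; apply qnorm_comp |].
destruct (E (fun q => Q3 q)) as [l3 H3]; [intros q; apply qnorm_comp |].
exists (l0, l1, l2, l3). now apply is_series_coord.
Qed.

Lemma is_series_uniq (u : nat -> quatN) (l l' : quatN) :
  is_series u l -> is_series u l' -> l = l'.
Proof. apply (filterlim_locally_unique (V := quatN)). Qed.

Lemma qpseries_unique a q l :
  is_series (fun m => (qpow q m * a m)%Q : quatN) l -> qpseries a q = l.
Proof.
intros H. unfold qpseries.
assert (H0 := is_series_linear _ _ _ linear_Q0 H).
assert (H1 := is_series_linear _ _ _ linear_Q1 H).
assert (H2 := is_series_linear _ _ _ linear_Q2 H).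
assert (H3 := is_series_linear _ _ _ linear_Q3 H).
rewrite (is_series_unique _ _ H0), (is_series_unique _ _ H1),
  (is_series_unique _ _ H2), (is_series_unique _ _ H3).
now destruct l as [[[? ?] ?] ?].
Qed.

(** * Power series that converge on the ball *)

(** Radius of convergence at least one, in the form that products, shifts and tails
    preserve by direct estimates. *)
Definition conv (a : nat -> quat) : Prop :=
  forall r, 0 <= r < 1 -> exists C, forall m, qnorm (a m) * r ^ m <= C.

Lemma conv_pos a r : conv a -> 0 <= r < 1 ->
  exists C, 0 < C /\ forall m, qnorm (a m) * r ^ m <= C.
Proof.
intros H Hr. destruct (H r Hr) as [C HC]. exists (Rmax C 1). split.
- apply Rlt_le_trans with 1; [lra | apply Rmax_r].
- intros m. apply Rle_trans with C; [apply HC | apply Rmax_l].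
Qed.

Lemma ratio_lt_1 x r : 0 <= x < r -> 0 <= x / r < 1.
Proof.
intros H. split; [apply Rdiv_le_0_compat; lra |].
apply Rmult_lt_reg_r with r; [lra |]. field_simplify; lra.
Qed.

(** Boundedness on a slightly larger sphere gives geometric decay. *)
Lemma conv_geom a r : conv a -> 0 <= r < 1 ->
  exists C t, 0 < C /\ 0 <= t < 1 /\ forall m, qnorm (a m) * r ^ m <= C * t ^ m.
Proof.
intros H Hr. set (r' := (1 + r) / 2).
assert (Hr' : 0 < r' < 1 /\ r < r') by (unfold r'; lra).
destruct (conv_pos a r' H) as [C [C0 HC]]; [lra |].
assert (Ht := ratio_lt_1 r r' ltac:(lra)).
exists C, (r / r'). split; [exact C0 | split; [exact Ht |]].
intros m. replace (r ^ m) with (r' ^ m * (r / r') ^ m).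
- rewrite <- Rmult_assoc. apply Rmult_le_compat_r; [apply pow_le; lra | apply HC].
- rewrite <- Rpow_mult_distr. f_equal. field. lra.
Qed.

Lemma conv_ex_series a r : conv a -> 0 <= r < 1 ->
  ex_series (fun m => qnorm (a m) * r ^ m).
Proof.
intros H Hr. destruct (conv_geom a r H Hr) as (C & t & C0 & Ht & HC).
apply (ex_series_le (V := R_CompleteNormedModule) _ (fun m => C * t ^ m)).
- intros n. unfold norm; simpl. unfold abs; simpl. rewrite Rabs_pos_eq; [apply HC |].
  apply Rmult_le_pos; [apply qnorm_ge0 | apply pow_le; lra].
- apply (ex_series_scal (V := R_NormedModule)), ex_series_geom. rewrite Rabs_pos_eq; lra.
Qed.

Lemma has_qpseries_qpseries a : conv a -> has_qpseries (qpseries a) a.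
Proof.
intros H q Hq.
destruct (is_series_ex (fun m => (qpow q m * a m)%Q) (fun m => qnorm (a m) * qnorm q ^ m)) as [l Hl].
- intros m. rewrite qnorm_mul, qnorm_pow. lra.
- apply conv_ex_series; [exact H |]. split; [apply qnorm_ge0 | exact Hq].
- now rewrite (qpseries_unique _ _ _ Hl).
Qed.

Lemma in_ball_RtoQ x : in_ball (RtoQ x) <-> Rabs x < 1.
Proof. unfold in_ball. now rewrite qnorm_RtoQ. Qed.

Lemma qnorm_le_add_sub s x : qnorm x <= qnorm (s + x)%Q + qnorm s.
Proof.
replace x with ((s + x) - s)%Q at 1 by qring. apply qnorm_sub_le.
Qed.

Lemma has_qpseries_conv f a : has_qpseries f a -> conv a.
Proof.
intros H r Hr.
assert (Hb : in_ball (RtoQ r)) by (apply in_ball_RtoQ; rewrite Rabs_pos_eq; lra).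
specialize (H _ Hb).
destruct (filterlim_bounded (V := quatN) _ (ex_intro _ _ H)) as [M HM].
exists (M + M). intros m.
assert (E : qnorm (a m) * r ^ m = qnorm (qpow (RtoQ r) m * a m)%Q).
{ rewrite qnorm_mul, qnorm_pow, qnorm_RtoQ, Rabs_pos_eq by lra. ring. }
rewrite E. assert (M0 : 0 <= M) by (eapply Rle_trans; [| apply (HM 0%nat)]; apply (norm_ge_0 (V := quatN))).
destruct m as [| m].
- specialize (HM 0%nat). rewrite sum_O, norm_qnorm in HM. lra.
- assert (H1 := HM (S m)). assert (H2 := HM m). rewrite !norm_qnorm in H1, H2. rewrite sum_Sn in H1.
  eapply Rle_trans; [apply (qnorm_le_add_sub (sum_n (fun m => (qpow (RtoQ r) m * a m)%Q : quatN) m)) |].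
  exact (Rplus_le_compat _ _ _ _ H1 H2).
Qed.

Lemma is_pseries_coord (T : quatN -> R) a x v : is_linear (T : quatN -> R_NormedModule) ->
  is_series (fun m => (qpow (RtoQ x) m * a m)%Q : quatN) v ->
  is_pseries (fun n => T (a n)) x (T v).
Proof.
intros HT H. apply is_pseries_R.
apply (is_series_linear _ _ _ HT) in H.
eapply is_series_ext; [| exact H]. intros n. simpl.
rewrite qpow_RtoQ, <- scal_RtoQ, (linear_scal _ HT).
unfold scal; simpl; unfold mult; simpl. ring.
Qed.

Lemma CV_radius_pos (a : nat -> R) x l : 0 < x -> is_pseries a x l -> Rbar_lt 0 (CV_radius a).
Proof.
intros Hx H. destruct (Rbar_lt_le_dec 0 (CV_radius a)) as [K | K]; [exact K | exfalso].
assert (Rbar_lt (CV_radius a) (Rabs x)).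
{ apply Rbar_le_lt_trans with 0; [exact K |]. simpl. rewrite Rabs_pos_eq; lra. }
apply (CV_disk_outside a x); [assumption |].
apply ex_series_lim_0. exists l. exact (proj1 (is_pseries_R a x l) H).
Qed.

(** On the real axis the powers of the variable are real, so each coordinate is an
    ordinary real power series. *)
Lemma coef_unique (f : R -> quat) a b d : 0 < d ->
  (forall x, Rabs x < d -> is_series (fun m => (qpow (RtoQ x) m * a m)%Q : quatN) (f x)) ->
  (forall x, Rabs x < d -> is_series (fun m => (qpow (RtoQ x) m * b m)%Q : quatN) (f x)) ->
  a = b.
Proof.
intros Hd Ha Hb. apply functional_extensionality; intros n.
assert (K : forall T : quatN -> R, is_linear (T : quatN -> R_NormedModule) -> T (a n) = T (b n)).
{ intros T HT.
  assert (Hx : Rabs (d / 2) < d) by (rewrite Rabs_pos_eq; lra).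
  apply (PSeries_ext_recip (fun n => T (a n)) (fun n => T (b n))).
  - apply (CV_radius_pos _ (d / 2) (T (f (d / 2)))); [lra | now apply is_pseries_coord, Ha].
  - apply (CV_radius_pos _ (d / 2) (T (f (d / 2)))); [lra | now apply is_pseries_coord, Hb].
  - exists (mkposreal _ Hd). intros y Hy.
    assert (Hy' : Rabs y < d).
    { change (Rabs (y - 0) < d) in Hy. now rewrite Rminus_0_r in Hy. }
    rewrite (is_pseries_unique _ _ _ (is_pseries_coord T a y _ HT (Ha y Hy'))).
    now rewrite (is_pseries_unique _ _ _ (is_pseries_coord T b y _ HT (Hb y Hy'))). }
by_coord quat_ext K.
Qed.

(** Identities between regular functions can thus be checked near the origin of the
    real axis, where [star] is the pointwise product. *)
Lemma qpseries_coef_unique f g a b d : 0 < d ->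
  has_qpseries f a -> has_qpseries g b ->
  (forall x, Rabs x < d -> f (RtoQ x) = g (RtoQ x)) -> a = b.
Proof.
intros Hd Ha Hb E.
apply (coef_unique (fun x => f (RtoQ x)) a b (Rmin d 1)); [apply Rmin_pos; lra | |];
intros x Hx; assert (H1 := Rlt_le_trans _ _ _ Hx (Rmin_l _ _));
assert (H2 := Rlt_le_trans _ _ _ Hx (Rmin_r _ _)).
- now apply Ha, in_ball_RtoQ.
- rewrite E by exact H1. now apply Hb, in_ball_RtoQ.
Qed.

Lemma qcoef_eq f a : has_qpseries f a -> qcoef f = a.
Proof.
intros H. apply (qpseries_coef_unique f f _ _ 1); [lra | | exact H | reflexivity].
exact (epsilon_spec (inhabits (fun _ => 0%Q)) (has_qpseries f) (ex_intro _ a H)).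
Qed.

Lemma poly_geom_bounded t : 0 <= t < 1 -> exists C, forall m, INR (S m) * t ^ m <= C.
Proof.
intros Ht. exists (/ (1 - t)). intros m.
apply Rmult_le_reg_l with (1 - t); [lra |]. rewrite Rinv_r by lra.
assert (H : INR (S m) * t ^ m * (1 - t) <= 1 - t ^ S m).
{ induction m as [| m IH]; [rewrite pow_1, pow_O, INR_1; lra |].
  rewrite (S_INR (S m)).
  replace (t ^ S (S m)) with (t * t ^ S m) by reflexivity.
  assert (P : t ^ S m <= 1) by (rewrite <- (pow1 (S m)); apply pow_incr; lra).
  assert (P' : t * (INR (S m) * t ^ m * (1 - t)) <= t * (1 - t ^ S m))
    by (apply Rmult_le_compat_l; lra).
  assert (P'' : 0 <= (1 - t) * (1 - t ^ S m)) by (apply Rmult_le_pos; lra).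
  replace (t ^ S m) with (t * t ^ m) in * by reflexivity. lra. }
assert (P := pow_le t (S m) (proj1 Ht)). lra.
Qed.

Lemma conv_mulS a : conv a -> conv (fun m => RtoQ (INR (S m)) * a m)%Q.
Proof.
intros H r Hr. destruct (conv_geom a r H Hr) as (C & t & C0 & Ht & HC).
destruct (poly_geom_bounded t Ht) as [D HD]. exists (C * D). intros m.
rewrite qnorm_mul, qnorm_RtoQ, Rabs_pos_eq by apply pos_INR.
rewrite Rmult_assoc.
apply Rle_trans with (INR (S m) * (C * t ^ m)).
- apply Rmult_le_compat_l; [apply pos_INR | apply HC].
- replace (INR (S m) * (C * t ^ m)) with (C * (INR (S m) * t ^ m)) by ring.
  apply Rmult_le_compat_l; [lra | apply HD].
Qed.

Lemma conv_shift a : conv a -> conv (fun m => a (S m)).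
Proof.
intros H r Hr. set (r' := (1 + r) / 2).
destruct (conv_pos a r' H) as [C [C0 HC]]; [unfold r'; lra |].
exists (C / r'). intros m. apply Rle_trans with (qnorm (a (S m)) * r' ^ m).
- apply Rmult_le_compat_l; [apply qnorm_ge0 |]. apply pow_incr. unfold r'; lra.
- apply Rmult_le_reg_r with r'; [unfold r'; lra |].
  replace (C / r' * r') with C by (field; unfold r'; lra).
  specialize (HC (S m)). simpl in HC. lra.
Qed.

Lemma conv_bound a (b : nat -> quat) K : (forall m, qnorm (b m) <= K * qnorm (a m)) ->
  0 <= K -> conv a -> conv b.
Proof.
intros H HK Ha r Hr. destruct (Ha r Hr) as [C HC]. exists (K * C). intros m.
apply Rle_trans with (K * qnorm (a m) * r ^ m).
- apply Rmult_le_compat_r; [apply pow_le; lra | apply H].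
- rewrite Rmult_assoc. now apply Rmult_le_compat_l.
Qed.

Definition cprod (a b : nat -> quat) (m : nat) : quat :=
  sum_n (fun l => (a (m - l)%nat * b l)%Q : quatN) m.

Lemma sum_n_le (u v : nat -> R) n : (forall k, (k <= n)%nat -> u k <= v k) -> sum_n u n <= sum_n v n.
Proof.
intros H. induction n as [| n IH]; [rewrite !sum_O; apply H; lia |].
rewrite !sum_Sn. apply Rplus_le_compat; [apply IH; intros; apply H; lia | apply H; lia].
Qed.

Lemma sum_n_Rconst (c : R) n : sum_n (fun _ => c) n = INR (S n) * c.
Proof. now rewrite sum_n_const. Qed.

Lemma conv_cprod a b : conv a -> conv b -> conv (cprod a b).
Proof.
intros Ha Hb r Hr. set (r' := (1 + r) / 2).
assert (Hr' : 0 < r' < 1 /\ r < r') by (unfold r'; lra).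
destruct (conv_pos a r' Ha) as [C [C0 HC]]; [lra |].
destruct (conv_pos b r' Hb) as [D [D0 HD]]; [lra |].
assert (Ht := ratio_lt_1 r r' ltac:(lra)).
destruct (poly_geom_bounded _ Ht) as [E HE]. exists (C * D * E). intros m.
assert (H : qnorm (cprod a b m) * r' ^ m <= INR (S m) * (C * D)).
{ unfold cprod. rewrite <- sum_n_Rconst.
  apply Rle_trans with (sum_n (fun l => qnorm (a (m - l)%nat * b l)%Q) m * r' ^ m).
  - apply Rmult_le_compat_r; [apply pow_le; lra | apply qnorm_sum_n].
  - rewrite <- (sum_n_mult_r (K := R_Ring)). apply sum_n_le. intros l Hl.
    unfold mult; simpl. rewrite qnorm_mul.
    replace (r' ^ m) with (r' ^ (m - l) * r' ^ l) by (rewrite <- pow_add; f_equal; lia).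
    replace (qnorm (a (m - l)%nat) * qnorm (b l) * (r' ^ (m - l) * r' ^ l))
      with ((qnorm (a (m - l)%nat) * r' ^ (m - l)) * (qnorm (b l) * r' ^ l)) by ring.
    apply Rmult_le_compat; try (apply Rmult_le_pos; [apply qnorm_ge0 | apply pow_le; lra]);
    [apply HC | apply HD]. }
replace (r ^ m) with (r' ^ m * (r / r') ^ m)
  by (rewrite <- Rpow_mult_distr; f_equal; field; lra).
rewrite <- Rmult_assoc.
apply Rle_trans with (INR (S m) * (C * D) * (r / r') ^ m).
- apply Rmult_le_compat_r; [apply pow_le; lra | exact H].
- replace (INR (S m) * (C * D) * (r / r') ^ m) with (C * D * (INR (S m) * (r / r') ^ m)) by ring.
  apply Rmult_le_compat_l; [nra | apply HE].
Qed.

Lemma sum_n_qmul_l c (u : nat -> quatN) n :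
  sum_n (fun k => (c * u k)%Q : quatN) n = (c * sum_n u n)%Q.
Proof. apply (sum_n_linear _ u n (linear_qmul_l c)). Qed.

(** The power q^l of each term of the Cauchy product stays on the left, next to the
    partial sum for the left factor, and does not meet b_l. *)
Lemma cprod_partial q a b n :
  sum_n (fun m => (qpow q m * cprod a b m)%Q : quatN) n =
  sum_n (fun l => (qpow q l * sum_n (fun k => (qpow q k * a k)%Q : quatN) (n - l) * b l)%Q : quatN) n.
Proof.
induction n as [| n IH].
- unfold cprod. rewrite !sum_O. change (0 - 0)%nat with 0%nat. rewrite ?sum_O.
  simpl. now rewrite !qmul_1l.
- rewrite (sum_Sn (fun m => (qpow q m * cprod a b m)%Q : quatN)), IH.
  unfold cprod. rewrite (sum_Sn (fun l => (a (S n - l)%nat * b l)%Q : quatN)).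
  rewrite (sum_Sn (fun l => (qpow q l * sum_n _ (S n - l) * b l)%Q : quatN)).
  rewrite Nat.sub_diag, sum_O.
  rewrite (sum_n_ext_loc (fun l => (qpow q l * sum_n (fun k => (qpow q k * a k)%Q : quatN) (S n - l) * b l)%Q : quatN)
     (fun l => plus ((qpow q l * sum_n (fun k => (qpow q k * a k)%Q : quatN) (n - l) * b l)%Q : quatN)
                    ((qpow q (S n) * (a (S n - l)%nat * b l))%Q : quatN))).
  + rewrite (sum_n_plus (G := quatN)), sum_n_qmul_l.
    set (A := sum_n _ n). set (B := sum_n _ n).
    change ((A + qpow q (S n) * (B + a 0%nat * b (S n)) = A + qpow q (S n) * B + qpow q (S n) * (1 * a 0%nat) * b (S n))%Q).
    now rewrite qmul_1l, qmul_addr, !qmul_assoc, qadd_assoc.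
  + intros l Hl. replace (S n - l)%nat with (S (n - l)) by lia. rewrite sum_Sn.
    replace (S n) with (l + S (n - l))%nat at 1 by lia. rewrite qpow_add.
    set (A := sum_n _ (n - l)).
    change ((qpow q l * (A + qpow q (S (n - l)) * a (S (n - l))) * b l =
      qpow q l * A * b l + qpow q l * qpow q (S (n - l)) * (a (S (n - l)) * b l))%Q).
    now rewrite qmul_addr, qmul_addl, !qmul_assoc.
Qed.

Lemma is_series_tail (u : nat -> quatN) l C t n : 0 <= t < 1 ->
  (forall k, qnorm (u k) <= C * t ^ k) -> is_series u l ->
  qnorm (sum_n u n - l)%Q <= C * t ^ S n / (1 - t).
Proof.
intros Ht H Hl. rewrite qnorm_sub_sym.
assert (G := is_series_scal_l (V := R_NormedModule) (C * t ^ S n) _ _ (is_series_geom t ltac:(rewrite Rabs_pos_eq; lra))).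
refine (is_series_norm_le (fun k => u (S n + k)%nat) _ _ _ _ _ G).
- intros k. eapply Rle_trans; [apply H |]. rewrite pow_add. right. unfold scal; simpl. unfold mult; simpl. ring.
- apply (is_series_incr_n u (S n)); [lia |]. simpl Init.Nat.pred.
  replace (plus _ _) with l; [exact Hl |]. change (l = (l - sum_n u n) + sum_n u n)%Q. generalize (sum_n u n). clear. qring.
Qed.

Lemma is_lim_poly_geom t : 0 <= t < 1 -> is_lim_seq (fun m => INR (S m) * t ^ m) 0.
Proof.
intros Ht. set (s := (1 + t) / 2).
assert (Hs : 0 < s < 1 /\ t < s) by (unfold s; lra).
assert (Hts := ratio_lt_1 t s ltac:(lra)).
destruct (poly_geom_bounded _ Hts) as [C HC].
apply is_lim_seq_le_le with (fun _ => 0) (fun m => C * s ^ m).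
- intros m. split; [apply Rmult_le_pos; [apply pos_INR | apply pow_le; lra] |].
  replace (t ^ m) with ((t / s) ^ m * s ^ m) by (rewrite <- Rpow_mult_distr; f_equal; field; lra).
  rewrite <- Rmult_assoc. apply Rmult_le_compat_r; [apply pow_le; lra | apply HC].
- apply is_lim_seq_const.
- replace (Finite 0) with (Rbar_mult C 0) by (simpl; f_equal; ring).
  apply is_lim_seq_scal_l. apply is_lim_seq_geom. rewrite Rabs_pos_eq; lra.
Qed.

(** In a star product the left factor enters only through its value at [q]. The
    reordered partial sums differ from those of this series by a convolution of two
    geometrically decaying sequences. *)
Lemma star_series f g a b q : has_qpseries f a -> has_qpseries g b -> in_ball q ->
  is_series (fun m => (qpow q m * f q * b m)%Q : quatN) (star f g q).
Proof.
intros Hf Hg Hq.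
assert (Ha := has_qpseries_conv _ _ Hf). assert (Hb := has_qpseries_conv _ _ Hg).
assert (Hr : 0 <= qnorm q < 1) by (split; [apply qnorm_ge0 | exact Hq]).
unfold star. rewrite (qcoef_eq _ _ Hf), (qcoef_eq _ _ Hg).
assert (Hs := has_qpseries_qpseries _ (conv_cprod _ _ Ha Hb) q Hq).
change (qpseries _ q) with (qpseries (cprod a b) q).
destruct (is_series_ex (fun m => (qpow q m * f q * b m)%Q) (fun m => qnorm (f q) * (qnorm (b m) * qnorm q ^ m))) as [l Hl].
{ intros m. rewrite !qnorm_mul, qnorm_pow. lra. }
{ apply (ex_series_scal (V := R_NormedModule)). now apply conv_ex_series. }
replace (qpseries (cprod a b) q) with l; [exact Hl |].
destruct (conv_geom a _ Ha Hr) as (C & t & C0 & Ht & HC).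
destruct (conv_geom b _ Hb Hr) as (D & t' & D0 & Ht' & HD).
set (s := Rmax t t').
assert (Hs1 : 0 <= s < 1) by (unfold s; split; [apply Rle_trans with t; [lra | apply Rmax_l] | apply Rmax_lub_lt; lra]).
assert (Hts : forall m, t ^ m <= s ^ m) by (intros; apply pow_incr; split; [lra | apply Rmax_l]).
assert (Hts' : forall m, t' ^ m <= s ^ m) by (intros; apply pow_incr; split; [lra | apply Rmax_r]).
apply qsub_eq0, qnorm_eq0.
set (E := C * s / (1 - s)).
assert (HE0 : 0 <= E) by (unfold E; apply Rdiv_le_0_compat; nra).
assert (L : is_lim_seq (fun n => D * E * (INR (S n) * s ^ n)) 0).
{ replace (Finite 0) with (Rbar_mult (D * E) 0) by (simpl; f_equal; ring).
  apply is_lim_seq_scal_l. now apply is_lim_poly_geom. }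
assert (B : forall n, qnorm (sum_n (fun m => (qpow q m * f q * b m)%Q : quatN) n -
   sum_n (fun m => (qpow q m * cprod a b m)%Q : quatN) n)%Q <= D * E * (INR (S n) * s ^ n)).
{ intros n. rewrite cprod_partial.
  rewrite qnorm_sub_sym.
  set (X := sum_n _ n). set (Y := sum_n _ n).
  assert (EQ : (X - Y)%Q = sum_n (fun l0 => (qpow q l0 * (sum_n (fun k => (qpow q k * a k)%Q : quatN) (n - l0) - f q) * b l0)%Q : quatN) n).
  { unfold X, Y.
    rewrite (sum_n_ext (fun l0 => (qpow q l0 * (sum_n (fun k => (qpow q k * a k)%Q : quatN) (n - l0) - f q) * b l0)%Q : quatN)
      (fun l0 => plus ((qpow q l0 * sum_n (fun k => (qpow q k * a k)%Q : quatN) (n - l0) * b l0)%Q : quatN)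
       ((RtoQ (-1) * (qpow q l0 * f q * b l0))%Q : quatN))).
    - rewrite (sum_n_plus (G := quatN)), sum_n_qmul_l.
      set (U := sum_n _ n). set (V := sum_n _ n). change (U - V = U + RtoQ (-1) * V)%Q. apply qsub_neg.
    - intros k. set (U := sum_n _ _). change ((qpow q k * (U - f q) * b k = qpow q k * U * b k + RtoQ (-1) * (qpow q k * f q * b k))%Q).
      now rewrite qmul_subr, qmul_subl, qsub_neg. }
  rewrite EQ. eapply Rle_trans; [apply qnorm_sum_n |].
  replace (D * E * (INR (S n) * s ^ n)) with (INR (S n) * (D * E * s ^ n)) by ring.
  rewrite <- sum_n_Rconst. apply sum_n_le. intros k Hk.
  rewrite !qnorm_mul, qnorm_pow.
  assert (T0 : forall j, qnorm (qpow q j * a j)%Q <= C * s ^ j).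
  { intros j. rewrite qnorm_mul, qnorm_pow, Rmult_comm.
    eapply Rle_trans; [apply HC | apply Rmult_le_compat_l; [lra | apply Hts]]. }
  assert (T := is_series_tail (fun j => (qpow q j * a j)%Q) (f q) C s (n - k) Hs1 T0 (Hf q Hq)).
  revert T. generalize (qnorm_ge0 (sum_n (fun j => (qpow q j * a j)%Q : quatN) (n - k) - f q)%Q).
  generalize (qnorm (sum_n (fun j => (qpow q j * a j)%Q : quatN) (n - k) - f q)%Q).
  intros w W0 T.
  assert (T2 : w <= E * s ^ (n - k)).
  { eapply Rle_trans; [exact T |]. unfold E. simpl. right. field. lra. }
  assert (T3 : qnorm (b k) * qnorm q ^ k <= D * s ^ k) by (eapply Rle_trans; [apply HD | apply Rmult_le_compat_l; [lra | apply Hts']]).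
  replace (s ^ n) with (s ^ (n - k) * s ^ k) by (rewrite <- pow_add; f_equal; lia).
  replace (qnorm q ^ k * w * qnorm (b k)) with ((qnorm (b k) * qnorm q ^ k) * w) by ring.
  replace (D * E * (s ^ (n - k) * s ^ k)) with ((D * s ^ k) * (E * s ^ (n - k))) by ring.
  apply Rmult_le_compat; try assumption.
  apply Rmult_le_pos; [apply qnorm_ge0 | apply pow_le; lra]. }
assert (L2 : is_lim_seq (fun n => qnorm (sum_n (fun m => (qpow q m * f q * b m)%Q : quatN) n -
   sum_n (fun m => (qpow q m * cprod a b m)%Q : quatN) n)%Q) (qnorm (l - qpseries (cprod a b) q)%Q)).
{ rewrite <- norm_qnorm.
  apply filterlim_ext with (fun n => norm (minus (sum_n (fun m => (qpow q m * f q * b m)%Q : quatN) n)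
   (sum_n (fun m => (qpow q m * cprod a b m)%Q : quatN) n))); [intros; apply norm_qnorm |].
  eapply filterlim_comp; [| apply filterlim_norm].
  unfold minus. eapply filterlim_comp_2; [exact Hl | | apply (filterlim_plus (V := quatN))].
  eapply filterlim_comp; [exact Hs | apply (filterlim_opp (V := quatN))]. }
assert (F := is_lim_seq_le _ _ _ _ B L2 L). simpl in F. generalize (qnorm_ge0 (l - qpseries (cprod a b) q)%Q). lra.
Qed.

Lemma has_qpseries_star f g a b : has_qpseries f a -> has_qpseries g b ->
  has_qpseries (star f g) (cprod a b).
Proof.
intros Hf Hg. unfold star. rewrite (qcoef_eq _ _ Hf), (qcoef_eq _ _ Hg).
change (has_qpseries (qpseries (cprod a b)) (cprod a b)).
apply has_qpseries_qpseries, conv_cprod; eapply has_qpseries_conv; eassumption.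
Qed.

(** * Regular functions and the star product *)

Definition regular (f : quat -> quat) : Prop := exists a, has_qpseries f a.

Lemma regular_ext f g : (forall q, in_ball q -> f q = g q) -> regular f -> regular g.
Proof.
intros E [a H]. exists a. intros q Hq. rewrite <- E by exact Hq. now apply H.
Qed.

Lemma regular_eq f g d : 0 < d -> regular f -> regular g ->
  (forall x, Rabs x < d -> f (RtoQ x) = g (RtoQ x)) ->
  forall q, in_ball q -> f q = g q.
Proof.
intros Hd [a Ha] [b Hb] E q Hq.
assert (K := qpseries_coef_unique f g a b d Hd Ha Hb E). subst b.
exact (is_series_uniq _ _ _ (Ha q Hq) (Hb q Hq)).
Qed.

Lemma qcoef_ext f g : regular f -> (forall q, in_ball q -> f q = g q) -> qcoef f = qcoef g.
Proof.
intros [a H] E. rewrite (qcoef_eq f a H). symmetry. apply qcoef_eq.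
intros q Hq. rewrite <- E by exact Hq. now apply H.
Qed.

Lemma star_ext f f' g g' : regular f -> regular g ->
  (forall q, in_ball q -> f q = f' q) -> (forall q, in_ball q -> g q = g' q) ->
  star f g = star f' g'.
Proof.
intros Hf Hg E E'. unfold star.
now rewrite (qcoef_ext f f' Hf E), (qcoef_ext g g' Hg E').
Qed.

Lemma regular_add f g : regular f -> regular g -> regular (fun q => f q + g q)%Q.
Proof.
intros [a Ha] [b Hb]. exists (fun m => a m + b m)%Q. intros q Hq.
eapply is_series_ext; [| exact (is_series_plus _ _ _ _ (Ha q Hq) (Hb q Hq))].
intros n. symmetry. apply qmul_addr.
Qed.

Lemma regular_mul_r f c : regular f -> regular (fun q => f q * c)%Q.
Proof.
intros [a Ha]. exists (fun m => a m * c)%Q. intros q Hq.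
eapply is_series_ext; [| exact (is_series_linear _ _ _ (linear_qmul_r c) (Ha q Hq))].
intros n. symmetry. apply qmul_assoc.
Qed.

Lemma regular_sub f g : regular f -> regular g -> regular (fun q => f q - g q)%Q.
Proof.
intros Hf Hg.
apply regular_ext with (fun q => f q + g q * RtoQ (-1))%Q.
- intros q _. rewrite qsub_neg. now rewrite RtoQ_comm.
- apply regular_add; [exact Hf | now apply regular_mul_r].
Qed.

Lemma is_series_fin (u : nat -> quatN) n :
  (forall k, (n < k)%nat -> u k = 0%Q) -> is_series u (sum_n u n).
Proof.
intros H. apply filterlim_ext_loc with (fun _ => sum_n u n); [| apply filterlim_const].
exists n. intros m Hm. induction m as [| m IH].
- replace n with 0%nat by lia. reflexivity.
- destruct (Nat.eq_dec n (S m)) as [-> | K]; [reflexivity |].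
  rewrite sum_Sn, <- IH by lia. rewrite H by lia. symmetry. apply (plus_zero_r (G := quatN)).
Qed.

Lemma is_series_zero : is_series (fun _ => 0%Q : quatN) 0%Q.
Proof.
assert (H := is_series_fin (fun _ => 0%Q) 0 (fun _ _ => eq_refl)).
now rewrite sum_O in H.
Qed.

Lemma regular_cst c : regular (fun _ => c).
Proof.
exists (fun m => match m with O => c | _ => 0%Q end). intros q _.
set (u := fun m => (qpow q m * match m with O => c | _ => 0 end)%Q : quatN).
replace c with (sum_n u 0) by (rewrite sum_O; apply qmul_1l).
apply is_series_fin. intros [| k] Hk; [lia | apply qmul_0r].
Qed.

Lemma has_qpseries_id_mul f a : has_qpseries f a ->
  has_qpseries (fun q => q * f q)%Q (fun m => match m with O => 0%Q | S k => a k end).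
Proof.
intros H q Hq. apply (is_series_decr_1 (V := quatN)).
replace (plus _ _) with (q * f q : quat)%Q.
- eapply is_series_ext; [| exact (is_series_linear _ _ _ (linear_qmul_l q) (H q Hq))].
  intros n. apply qmul_assoc.
- rewrite qmul_0r. generalize (q * f q)%Q. intros w. symmetry.
  change (w - 0 = w)%Q. qring.
Qed.

Lemma regular_id_mul f : regular f -> regular (fun q => q * f q)%Q.
Proof. intros [a H]. exact (ex_intro _ _ (has_qpseries_id_mul f a H)). Qed.

Lemma regular_id : regular (fun q => q).
Proof.
apply regular_ext with (fun q => q * 1)%Q; [intros; apply qmul_1r |].
apply regular_id_mul, regular_cst.
Qed.

Lemma regular_id_sub p : regular (fun q => q - p)%Q.
Proof. apply regular_sub; [apply regular_id | apply regular_cst]. Qed.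

Lemma regular_star f g : regular f -> regular g -> regular (star f g).
Proof. intros [a Ha] [b Hb]. exists (cprod a b). now apply has_qpseries_star. Qed.

(** The product formula f * g (q) = f(q) g(f(q)^-1 q f(q)), stated without an inverse so
    that it also covers the zeros of [f] (take [s = q]) and values that commute
    with [q]. *)
Lemma star_at f g q s : regular f -> regular g -> in_ball q -> in_ball s ->
  (q * f q = f q * s)%Q -> star f g q = (f q * g s)%Q.
Proof.
intros [a Ha] [b Hb] Hq Hs E.
apply (is_series_uniq _ _ _ (star_series f g a b q Ha Hb Hq)).
eapply is_series_ext; [| exact (is_series_linear _ _ _ (linear_qmul_l (f q)) (Hb s Hs))].
intros m. simpl. rewrite qmul_assoc. f_equal.
induction m as [| m IH]; simpl; [now rewrite qmul_1l, qmul_1r |].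
now rewrite qmul_assoc, <- E, <- !qmul_assoc, IH.
Qed.

Lemma star_real f g x : regular f -> regular g -> Rabs x < 1 ->
  star f g (RtoQ x) = (f (RtoQ x) * g (RtoQ x))%Q.
Proof.
intros Hf Hg Hx. apply star_at; try assumption; try (now apply in_ball_RtoQ).
apply RtoQ_comm.
Qed.

Lemma star_zero f g q : regular f -> regular g -> in_ball q -> f q = 0%Q ->
  star f g q = 0%Q.
Proof.
intros Hf Hg Hq E. rewrite (star_at f g q q Hf Hg Hq Hq); rewrite E.
- apply qmul_0l.
- now rewrite qmul_0l, qmul_0r.
Qed.

Lemma conv_conj a : conv a -> conv (fun m => qconj (a m)).
Proof.
intros H r Hr. destruct (H r Hr) as [C HC]. exists C. intros m.
rewrite qnorm_conj. apply HC.
Qed.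

Lemma has_qpseries_conj f a : has_qpseries f a ->
  has_qpseries (reg_conj f) (fun m => qconj (a m)).
Proof.
intros H. unfold reg_conj. rewrite (qcoef_eq _ _ H).
apply has_qpseries_qpseries. apply conv_conj, (has_qpseries_conv _ _ H).
Qed.

Lemma regular_conj f : regular f -> regular (reg_conj f).
Proof. intros [a H]. exact (ex_intro _ _ (has_qpseries_conj f a H)). Qed.

Lemma reg_conj_real f x : regular f -> Rabs x < 1 -> reg_conj f (RtoQ x) = qconj (f (RtoQ x)).
Proof.
intros [a H] Hx. apply in_ball_RtoQ in Hx.
apply (is_series_uniq _ _ _ (has_qpseries_conj f a H _ Hx)).
eapply is_series_ext; [| exact (is_series_linear _ _ _ linear_qconj (H _ Hx))].
intros n. simpl. rewrite qconj_mul, !qpow_RtoQ, qconj_RtoQ. symmetry; apply RtoQ_comm.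
Qed.

Lemma regular_symm f : regular f -> regular (symm f).
Proof. intros H. exact (regular_star f (reg_conj f) H (regular_conj f H)). Qed.

(** * Values on a sphere *)

(** [q] and [s] are conjugate: both are x + y I for the same x and the same |y|. *)
Definition same_sphere (q s : quat) : Prop := Q0 q = Q0 s /\ qnorm q = qnorm s.

Lemma same_sphere_ball q s : same_sphere q s -> in_ball s -> in_ball q.
Proof. intros [_ H]. unfold in_ball. now rewrite H. Qed.

Lemma same_sphere_refl q : same_sphere q q. Proof. now split. Qed.

Lemma same_sphere_sqr q s : same_sphere q s ->
  (q * q = RtoQ (2 * Q0 s) * q - RtoQ (qnorm s ^ 2))%Q.
Proof.
intros [H1 H2]. rewrite <- H1, <- H2, qnorm_sqr. qring.
Qed.

Lemma same_sphere_conj_by w s : w <> 0%Q -> same_sphere (w * s * qinv w)%Q s.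
Proof.
intros Hw. split.
- replace (Q0 (w * s * qinv w)%Q) with (Q0 (qinv w * (w * s))%Q).
  + now rewrite qmul_assoc, qinv_l, qmul_1l.
  + generalize (w * s)%Q (qinv w). intros; qcoord; ring.
- rewrite !qnorm_mul, qnorm_inv by exact Hw. field.
  apply Rgt_not_eq, qnorm_pos, Hw.
Qed.

(** The coefficients A, B of q^m = A q + B, valid for all q with q^2 = T q - N, that is
    on one sphere. *)
Fixpoint sphere_coef (T N : R) (m : nat) : R * R :=
  match m with
  | O => (0, 1)
  | S k => (fst (sphere_coef T N k) * T + snd (sphere_coef T N k),
            - N * fst (sphere_coef T N k))
  end.

Lemma qpow_sphere q s m : same_sphere q s ->
  let c := sphere_coef (2 * Q0 s) (qnorm s ^ 2) m in
  qpow q m = (RtoQ (fst c) * q + RtoQ (snd c))%Q.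
Proof.
intros H. induction m as [| m IH]; simpl; [qring |].
simpl in IH. rewrite IH, qmul_addr, qmul_assoc, (RtoQ_comm _ q), <- (RtoQ_comm _ q).
rewrite <- qmul_assoc, (same_sphere_sqr q s H).
generalize (sphere_coef (2 * Q0 s) (qnorm s * (qnorm s * 1)) m). intros [A B].
simpl. rewrite <- (RtoQ_comm B q). qring.
Qed.

Lemma vect_part_mul x y q : Q1 (RtoQ x * q + RtoQ y)%Q = x * Q1 q /\
  Q2 (RtoQ x * q + RtoQ y)%Q = x * Q2 q /\ Q3 (RtoQ x * q + RtoQ y)%Q = x * Q3 q
  /\ Q0 (RtoQ x * q + RtoQ y)%Q = x * Q0 q + y.
Proof. repeat split; qcoord; ring. Qed.

(** For a nonreal [q] the real coefficients of a combination of q and 1 are bounded by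
    its norm; this is what makes the two coefficient series below converge. *)
Lemma real_dec q : (exists x, q = RtoQ x) \/
  (exists d, 0 < d /\ forall x y, Rabs x * d <= qnorm (RtoQ x * q + RtoQ y)%Q).
Proof.
assert (K : forall i : quat -> R, (forall q, Rabs (i q) <= qnorm q) ->
  (forall x y, i (RtoQ x * q + RtoQ y)%Q = x * i q) -> i q <> 0 ->
  exists d, 0 < d /\ forall x y, Rabs x * d <= qnorm (RtoQ x * q + RtoQ y)%Q).
{ intros i H1 H2 H3. exists (Rabs (i q)). split; [now apply Rabs_pos_lt |].
  intros x y. rewrite <- Rabs_mult, <- (H2 x y). apply H1. }
destruct (Req_dec (Q1 q) 0) as [H1 | H1];
[| right; apply (K Q1); [intros; apply qnorm_comp | intros; apply vect_part_mul | exact H1]].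
destruct (Req_dec (Q2 q) 0) as [H2 | H2];
[| right; apply (K Q2); [intros; apply qnorm_comp | intros; apply vect_part_mul | exact H2]].
destruct (Req_dec (Q3 q) 0) as [H3 | H3];
[| right; apply (K Q3); [intros; apply qnorm_comp | intros; apply vect_part_mul | exact H3]].
left. exists (Q0 q). apply quat_ext; [reflexivity | exact H1 | exact H2 | exact H3].
Qed.

(** Summing the affine expressions of the powers. Replacing the coefficients of [f]
    by their conjugates conjugates [Y] and [Z]. *)
Lemma regular_sphere f s : regular f -> in_ball s -> (~ exists x, s = RtoQ x) ->
  exists Y Z, forall q, same_sphere q s ->
    f q = (q * Y + Z)%Q /\ reg_conj f q = (q * qconj Y + qconj Z)%Q.
Proof.
intros [a Ha] Hs Hr. destruct (real_dec s) as [K | (d & Hd & Hdist)]; [now elim Hr |].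
set (c := sphere_coef (2 * Q0 s) (qnorm s ^ 2)).
assert (HA : forall m, Rabs (fst (c m)) <= qnorm s ^ m * / d).
{ intros m. apply Rmult_le_reg_r with d; [exact Hd |].
  rewrite Rmult_assoc, Rinv_l, Rmult_1_r by lra.
  eapply Rle_trans; [apply (Hdist _ (snd (c m))) |].
  rewrite <- qnorm_pow. right. f_equal. symmetry. apply qpow_sphere, same_sphere_refl. }
assert (HB : forall m, Rabs (snd (c m)) <= qnorm s ^ m * (1 + qnorm s * / d)).
{ intros m. assert (E := qpow_sphere s s m (same_sphere_refl s)). fold c in E. simpl in E.
  apply (f_equal Q0) in E. rewrite (proj2 (proj2 (proj2 (vect_part_mul _ _ _)))) in E.
  replace (snd (c m)) with (Q0 (qpow s m) - fst (c m) * Q0 s) by (rewrite E; ring).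
  eapply Rle_trans; [apply Rabs_triang |]. rewrite Rabs_Ropp, Rabs_mult.
  assert (E1 := proj1 (qnorm_comp (qpow s m))). rewrite qnorm_pow in E1.
  assert (E2 : Rabs (fst (c m)) * Rabs (Q0 s) <= qnorm s ^ m * / d * qnorm s).
  { apply Rmult_le_compat; try apply Rabs_pos; [apply HA | apply qnorm_comp]. }
  lra. }
assert (S : ex_series (fun m => qnorm (a m) * qnorm s ^ m)).
{ apply conv_ex_series; [apply (has_qpseries_conv _ _ Ha) | split; [apply qnorm_ge0 | exact Hs]]. }
assert (G : forall (e : nat -> R) K, (forall m, Rabs (e m) <= qnorm s ^ m * K) ->
   exists l, is_series (fun m => (RtoQ (e m) * a m)%Q : quatN) l).
{ intros e K HK. apply is_series_ex with (fun m => K * (qnorm (a m) * qnorm s ^ m)).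
  - intros m. rewrite qnorm_mul, qnorm_RtoQ.
    replace (K * (qnorm (a m) * qnorm s ^ m)) with (qnorm s ^ m * K * qnorm (a m)) by ring.
    apply Rmult_le_compat_r; [apply qnorm_ge0 | apply HK].
  - now apply (ex_series_scal (V := R_NormedModule)). }
destruct (G _ _ HA) as [Y HY]. destruct (G _ _ HB) as [Z HZ].
exists Y, Z. intros q Hq.
assert (Hqb := same_sphere_ball q s Hq Hs).
assert (E := fun m => qpow_sphere q s m Hq). fold c in E. simpl in E.
split.
- apply (is_series_uniq _ _ _ (Ha q Hqb)).
  eapply is_series_ext; [| exact (is_series_plus _ _ _ _ (is_series_linear _ _ _ (linear_qmul_l q) HY) HZ)].
  intros m. simpl. rewrite E, qmul_addl, qmul_assoc. now rewrite (RtoQ_comm _ q).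
- apply (is_series_uniq _ _ _ (has_qpseries_conj f a Ha q Hqb)).
  apply (is_series_linear _ _ _ linear_qconj) in HY.
  apply (is_series_linear _ _ _ linear_qconj) in HZ.
  eapply is_series_ext; [| exact (is_series_plus _ _ _ _ (is_series_linear _ _ _ (linear_qmul_l q) HY) HZ)].
  intros m. simpl. rewrite !qconj_scal, E, qmul_addl, qmul_assoc. now rewrite (RtoQ_comm _ q).
Qed.

Definition zero_free_sphere (f : quat -> quat) (s : quat) : Prop :=
  forall q, same_sphere q s -> f q <> 0%Q.

(** If q Y^- + Z^- vanishes at [s], then Z = - Y s^-, so that q Y + Z vanishes at
    Y s^- Y^-1, a point of the same sphere. *)
Lemma reg_conj_neq0 f s : regular f -> in_ball s -> zero_free_sphere f s ->
  reg_conj f s <> 0%Q.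
Proof.
intros Hf Hs H.
destruct (excluded_middle_informative (exists x, s = RtoQ x)) as [[x ->] | Hr].
- rewrite reg_conj_real by (try exact Hf; now apply in_ball_RtoQ).
  intros E. apply (H _ (same_sphere_refl _)). rewrite <- (qconj_conj (f _)), E. apply qconj_RtoQ.
- destruct (regular_sphere f s Hf Hs Hr) as (Y & Z & YZ). intros E.
  rewrite (proj2 (YZ s (same_sphere_refl s))) in E.
  assert (EZ : Z = (RtoQ (-1) * (Y * qconj s))%Q).
  { apply (f_equal qconj) in E. rewrite qconj_add, qconj_mul, !qconj_conj, qconj_RtoQ in E.
    replace Z with ((Y * qconj s + Z) + RtoQ (-1) * (Y * qconj s))%Q by qring.
    rewrite E. apply qadd_0l. }
  destruct (excluded_middle_informative (Y = 0%Q)) as [Y0 | Y0].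
  + apply (H s (same_sphere_refl s)). rewrite (proj1 (YZ s (same_sphere_refl s))), EZ, Y0. qring.
  + assert (K : same_sphere (Y * qconj s * qinv Y)%Q s).
    { destruct (same_sphere_conj_by Y (qconj s) Y0) as [K1 K2]. split.
      - rewrite K1. reflexivity.
      - rewrite K2. apply qnorm_conj. }
    apply (H _ K). rewrite (proj1 (YZ _ K)), EZ, <- (qmul_assoc (Y * qconj s)%Q), qinv_l, qmul_1r by exact Y0.
    generalize (Y * qconj s)%Q. qring.
Qed.

(** On spheres without zeros of [f], the map q |-> f(q)^-1 q f(q) that occurs in the
    product formula is onto. With f(q) = q Y + Z the preimage of [s] is w s w^-1 for
    w = Y s^- + Z, the conjugate of the value of [reg_conj f] at [s]. *)
Lemma conj_onto f s : regular f -> in_ball s -> zero_free_sphere f s ->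
  exists q, same_sphere q s /\ (q * f q = f q * s)%Q.
Proof.
intros Hf Hs H.
destruct (excluded_middle_informative (exists x, s = RtoQ x)) as [[x ->] | Hr].
- exists (RtoQ x). split; [apply same_sphere_refl | apply RtoQ_comm].
- assert (N := reg_conj_neq0 f s Hf Hs H).
  destruct (regular_sphere f s Hf Hs Hr) as (Y & Z & YZ).
  rewrite (proj2 (YZ s (same_sphere_refl s))) in N.
  set (w := (Y * qconj s + Z)%Q).
  assert (Hw : w <> 0%Q).
  { intros E. apply N. apply (f_equal qconj) in E. unfold w in E.
    now rewrite qconj_add, qconj_mul, qconj_conj, qconj_RtoQ in E. }
  assert (K := same_sphere_conj_by w s Hw).
  set (q := (w * s * qinv w)%Q) in *. exists q. split; [exact K |].
  assert (Eq : (q * w = w * s)%Q).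
  { unfold q. now rewrite <- !qmul_assoc, qinv_l, qmul_1r. }
  rewrite (proj1 (YZ _ K)).
  assert (EZ : Z = (w - Y * qconj s)%Q) by (unfold w; qring).
  rewrite EZ, qmul_addr, qmul_assoc, (same_sphere_sqr q s K), qmul_subr, Eq.
  rewrite qnorm_sqr. clearbody q w. clear. qring.
Qed.

Lemma same_sphere_trans q r s : same_sphere q r -> same_sphere r s -> same_sphere q s.
Proof. intros [H1 H2] [K1 K2]; split; congruence. Qed.

Lemma star_eval f g q : regular f -> regular g -> in_ball q -> f q <> 0%Q ->
  exists s, same_sphere s q /\ star f g q = (f q * g s)%Q.
Proof.
intros Hf Hg Hq H.
exists (qinv (f q) * q * f q)%Q.
assert (K : same_sphere (qinv (f q) * q * f q)%Q q).
{ split.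
  - replace (Q0 (qinv (f q) * q * f q)%Q) with (Q0 (f q * (qinv (f q) * q))%Q).
    + now rewrite qmul_assoc, qinv_r, qmul_1l.
    + generalize (qinv (f q) * q)%Q (f q). intros; qcoord; ring.
  - rewrite !qnorm_mul, qnorm_inv by exact H. field.
    apply Rgt_not_eq, qnorm_pos, H. }
split; [exact K |].
apply star_at; try assumption; [now apply same_sphere_ball with q |].
now rewrite !qmul_assoc, qinv_r, qmul_1l by exact H.
Qed.

Lemma symm_neq0 f q : regular f -> in_ball q -> zero_free_sphere f q -> symm f q <> 0%Q.
Proof.
intros Hf Hq H. unfold symm.
destruct (star_eval f (reg_conj f) q Hf (regular_conj f Hf) Hq (H q (same_sphere_refl q)))
  as (s & Hs & E).
rewrite E. intros E0. apply qmul_eq0 in E0. destruct E0 as [E0 | E0].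
- exact (H q (same_sphere_refl q) E0).
- revert E0. apply reg_conj_neq0; [exact Hf | now apply same_sphere_ball with q |].
  intros r Hr. apply H. now apply same_sphere_trans with s.
Qed.

(** Remainder theorem. The m-th coefficient of the quotient is the value at [p] of the
    series of the a_(m+1+i), by telescoping. *)
Lemma regular_divide f p : regular f -> in_ball p ->
  exists r, regular r /\ forall q, in_ball q -> f q = (f p + star (fun z => z - p) r q)%Q.
Proof.
intros [a Ha] Hp. assert (Ca := has_qpseries_conv _ _ Ha).
set (T := fun m => qpseries (fun i => a (m + i)%nat) p).
assert (Csh : forall m, conv (fun i => a (m + i)%nat)).
{ intros m. induction m as [| m IH]; [exact Ca |].
  assert (K := conv_shift _ IH). intros r Hr. destruct (K r Hr) as [C HC]. exists C.
  intros i. specialize (HC i). now replace (S m + i)%nat with (m + S i)%nat by lia. }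
assert (HT : forall m, is_series (fun i => (qpow p i * a (m + i)%nat)%Q : quatN) (T m)).
{ intros m. exact (has_qpseries_qpseries _ (Csh m) p Hp). }
assert (RT : forall m, T m = (a m + p * T (S m))%Q).
{ intros m. apply (is_series_uniq _ _ _ (HT m)). apply (is_series_decr_1 (V := quatN)).
  replace (plus _ _) with (p * T (S m) : quat)%Q.
  - eapply is_series_ext; [| exact (is_series_linear _ _ _ (linear_qmul_l p) (HT (S m)))].
    intros n. simpl. rewrite qmul_assoc. do 2 f_equal. lia.
  - rewrite Nat.add_0_r. simpl. generalize (a m) (p * T (S m))%Q. intros u v.
    change (v = (u + v) - 1 * u)%Q. qring. }
assert (CT : conv T).
{ intros r Hr. set (r' := Rmax ((1 + qnorm p) / 2) r).
  assert (P0 := qnorm_ge0 p). assert (P1 : qnorm p < 1) by exact Hp.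
  assert (Hr' : 0 < r' < 1 /\ r <= r' /\ qnorm p < r').
  { assert (L1 := Rmax_l ((1 + qnorm p) / 2) r). assert (L2 := Rmax_r ((1 + qnorm p) / 2) r).
    fold r' in L1, L2. assert (r' < 1) by (apply Rmax_lub_lt; lra). lra. }
  destruct (conv_pos a r' Ca) as [C [C0 HC]]; [lra |].
  assert (Ht := ratio_lt_1 (qnorm p) r' ltac:(lra)).
  exists (C * / (1 - qnorm p / r')). intros m.
  apply Rle_trans with (qnorm (T m) * r' ^ m).
  { apply Rmult_le_compat_l; [apply qnorm_ge0 | apply pow_incr; lra]. }
  assert (G := is_series_scal_l (V := R_NormedModule) (C * / r' ^ m) _ _
    (is_series_geom (qnorm p / r') ltac:(rewrite Rabs_pos_eq; lra))).
  assert (Pm : 0 < r' ^ m) by (apply pow_lt; lra).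
  assert (N0 : forall i, qnorm (qpow p i * a (m + i)%nat)%Q <= scal (C * / r' ^ m) ((qnorm p / r') ^ i)).
  { intros i. simpl. rewrite qnorm_mul, qnorm_pow.
  change (scal (C * / r' ^ m) ((qnorm p / r') ^ i)) with (C * / r' ^ m * (qnorm p / r') ^ i).
  specialize (HC (m + i)%nat). rewrite pow_add in HC.
  assert (Pi : 0 < r' ^ i) by (apply pow_lt; lra).
  unfold Rdiv. rewrite Rpow_mult_distr, pow_inv.
  replace (C * / r' ^ m * (qnorm p ^ i * / r' ^ i)) with (qnorm p ^ i * (C * / (r' ^ m * r' ^ i))) by (field; lra).
  apply Rmult_le_compat_l; [apply pow_le; lra |].
  apply Rmult_le_reg_r with (r' ^ m * r' ^ i); [nra |].
  rewrite Rmult_assoc, Rinv_l, Rmult_1_r; [exact HC | nra]. }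
  assert (N := is_series_norm_le _ _ _ _ N0 (HT m) G).
  change (scal (C * / r' ^ m) (/ (1 - qnorm p / r'))) with (C * / r' ^ m * / (1 - qnorm p / r')) in N.
  apply Rmult_le_compat_r with (r := r' ^ m) in N; [| lra].
  eapply Rle_trans; [exact N |]. right. field. split; [lra | split; lra]. }
set (r := qpseries (fun m => T (S m))).
assert (Hr : has_qpseries r (fun m => T (S m))) by (apply has_qpseries_qpseries, conv_shift, CT).
assert (Rr : regular r) by (now exists (fun m => T (S m))).
assert (Rp := regular_id_sub p).
exists r. split; [exact Rr |].
apply regular_eq with 1; [lra | now exists a | apply regular_add; [apply regular_cst | now apply regular_star] |].
intros x Hx. rewrite star_real by assumption.
assert (Hxb : in_ball (RtoQ x)) by now apply in_ball_RtoQ.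
assert (T0 : T 0%nat = f p) by (apply (is_series_uniq _ _ _ (HT 0%nat)), Ha, Hp).
rewrite <- T0.
assert (S1 : is_series (fun m => (qpow (RtoQ x) m * T m)%Q : quatN) (T 0%nat + RtoQ x * r (RtoQ x))%Q).
{ apply (is_series_decr_1 (V := quatN)).
  replace (plus _ _) with (RtoQ x * r (RtoQ x))%Q.
  - eapply is_series_ext; [| exact (is_series_linear _ _ _ (linear_qmul_l (RtoQ x)) (Hr _ Hxb))].
    intros n. apply qmul_assoc.
  - simpl. generalize (T 0%nat) (RtoQ x * r (RtoQ x))%Q. intros u v.
    change (v = (u + v) - 1 * u)%Q. qring. }
assert (S2 := is_series_linear _ _ _ (linear_qmul_l (RtoQ (-1) * p)%Q) (Hr _ Hxb)).
apply (is_series_uniq _ _ _ (Ha _ Hxb)).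
replace (T 0%nat + (RtoQ x - p) * r (RtoQ x))%Q with
 (plus (T 0%nat + RtoQ x * r (RtoQ x) : quatN)%Q (RtoQ (-1) * p * r (RtoQ x) : quatN)%Q).
- eapply is_series_ext; [| exact (is_series_plus _ _ _ _ S1 S2)].
  intros m. simpl. rewrite qpow_RtoQ, (RT m).
  generalize (a m) (T (S m)) (x ^ m). intros u v y. clear.
  change (RtoQ y * (u + p * v) + RtoQ (-1) * p * (RtoQ y * v) = RtoQ y * u)%Q. qring.
- generalize (T 0%nat) (r (RtoQ x)). clear. intros u v.
  change (u + RtoQ x * v + RtoQ (-1) * p * v = u + (RtoQ x - p) * v)%Q. qring.
Qed.

(** At [p = 0] the values on the real axis leave the origin undecided, and the
    coefficients are compared instead. *)
Lemma star_cancel p f g : regular f -> regular g ->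
  (forall x, Rabs x < 1 -> (RtoQ x - p) * f (RtoQ x) = (RtoQ x - p) * g (RtoQ x))%Q ->
  forall q, in_ball q -> f q = g q.
Proof.
intros Hf Hg H.
destruct (excluded_middle_informative (p = 0%Q)) as [-> | Hp].
- destruct Hf as [a Ha], Hg as [b Hb].
  assert (E := qpseries_coef_unique _ _ _ _ 1 ltac:(lra)
    (has_qpseries_id_mul f a Ha) (has_qpseries_id_mul g b Hb)).
  assert (E' : a = b).
  { assert (Z : forall x, (RtoQ x - 0 = RtoQ x)%Q) by qring.
    assert (K := E (fun x Hx => eq_ind _ (fun w => (w * f (RtoQ x) = w * g (RtoQ x))%Q) (H x Hx) _ (Z x))).
    apply functional_extensionality. intros n. exact (f_equal (fun c => c (S n)) K). }
  subst b. intros q Hq. exact (is_series_uniq _ _ _ (Ha q Hq) (Hb q Hq)).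
- assert (Hp' := qnorm_pos p Hp).
  apply regular_eq with (Rmin 1 (qnorm p)); try assumption; [apply Rmin_pos; lra |].
  intros x Hx.
  assert (Hx1 := Rlt_le_trans _ _ _ Hx (Rmin_l _ _)).
  assert (Hx2 := Rlt_le_trans _ _ _ Hx (Rmin_r _ _)).
  apply qmul_cancel_l with (RtoQ x - p)%Q; [| now apply H].
  intros E. apply qsub_eq0 in E. rewrite <- E, qnorm_RtoQ in Hx2. lra.
Qed.

(** * Power series are slice regular *)

Lemma is_derive_quadratic (u : R -> quatN) (x : R) (l : quatN) (d C : R) : 0 < d ->
  (forall h, Rabs h < d -> qnorm (u (x + h)%R - u x - RtoQ h * l)%Q <= C * h ^ 2) ->
  is_derive u x l.
Proof.
intros Hd H.
assert (K : forall T : quat -> R, (forall q, Rabs (T q) <= qnorm q) ->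
   (forall p q r h, T (p - q - RtoQ h * r)%Q = T p - T q - h * T r) ->
   is_derive (fun t => T (u t)) x (T l)).
{ intros T HT HL. apply is_derive_Reals. intros eps Heps.
  set (C' := Rmax C 1). assert (HC' : 0 < C') by (apply Rlt_le_trans with 1; [lra | apply Rmax_r]).
  assert (Hm : 0 < Rmin d (eps / C')) by (apply Rmin_pos; [lra | now apply Rdiv_lt_0_compat]).
  exists (mkposreal _ Hm). simpl. intros h Hh0 Hh.
  assert (Hh1 := Rlt_le_trans _ _ _ Hh (Rmin_l _ _)).
  assert (Hh2 := Rlt_le_trans _ _ _ Hh (Rmin_r _ _)).
  assert (Hpos := Rabs_pos_lt h Hh0).
  replace ((T (u (x + h)) - T (u x)) / h - T l) with (T (u (x + h)%R - u x - RtoQ h * l)%Q / h)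
    by (rewrite HL; field; exact Hh0).
  unfold Rdiv. rewrite Rabs_mult, Rabs_inv.
  apply Rle_lt_trans with (C' * h ^ 2 * / Rabs h).
  - apply Rmult_le_compat_r; [left; now apply Rinv_0_lt_compat |].
    eapply Rle_trans; [apply HT |]. eapply Rle_trans; [now apply H |].
    apply Rmult_le_compat_r; [apply pow2_ge_0 | apply Rmax_l].
  - rewrite <- (pow2_abs h). replace (C' * Rabs h ^ 2 * / Rabs h) with (C' * Rabs h) by (field; lra).
    apply Rmult_lt_reg_r with (/ C'); [now apply Rinv_0_lt_compat |].
    replace (C' * Rabs h * / C') with (Rabs h) by (field; lra). exact Hh2. }
apply is_derive_coord; apply K; try (intros; apply qnorm_comp); intros; qcoord; ring.
Qed.

Lemma continuous_lipschitz (F : R * R -> quatN) (x y d K : R) : 0 < d ->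
  (forall h k, Rabs h < d -> Rabs k < d ->
     qnorm (F (x + h, y + k)%R - F (x, y))%Q <= K * (Rabs h + Rabs k)) ->
  continuous F (x, y).
Proof.
intros Hd H.
assert (G : forall T : quat -> R, (forall q, Rabs (T q) <= qnorm q) ->
   (forall p q, T (p - q)%Q = T p - T q) -> continuous (fun p => T (F p)) (x, y)).
{ intros T HT HL.
  set (K' := Rmax K 1). assert (HK' : 0 < K') by (apply Rlt_le_trans with 1; [lra | apply Rmax_r]).
  apply filterlim_locally. intros eps.
  assert (Hm : 0 < Rmin d (eps / (2 * K'))).
  { apply Rmin_pos; [lra |]. apply Rdiv_lt_0_compat; [apply cond_pos | lra]. }
  exists (mkposreal _ Hm). intros [x' y'] [Hx' Hy'].
  change (Rabs (x' - x) < Rmin d (eps / (2 * K'))) in Hx'.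
  change (Rabs (y' - y) < Rmin d (eps / (2 * K'))) in Hy'.
  change (Rabs (T (F (x', y')) - T (F (x, y))) < eps).
  specialize (H (x' - x) (y' - y)
    (Rlt_le_trans _ _ _ Hx' (Rmin_l _ _)) (Rlt_le_trans _ _ _ Hy' (Rmin_l _ _))).
  assert (EX : forall s t : R, s + (t - s) = t) by (intros; ring).
  rewrite !EX in H.
  rewrite <- HL. eapply Rle_lt_trans; [apply HT |]. eapply Rle_lt_trans; [exact H |].
  assert (E1 := Rlt_le_trans _ _ _ Hx' (Rmin_r _ _)).
  assert (E2 := Rlt_le_trans _ _ _ Hy' (Rmin_r _ _)).
  apply Rle_lt_trans with (K' * (Rabs (x' - x) + Rabs (y' - y))).
  - apply Rmult_le_compat_r; [| apply Rmax_l].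
    generalize (Rabs_pos (x' - x)) (Rabs_pos (y' - y)). lra.
  - replace (pos eps) with (K' * (eps / (2 * K') + eps / (2 * K'))) by (field; lra).
    apply Rmult_lt_compat_l; lra. }
apply continuous_coord; apply G; try (intros; apply qnorm_comp); intros; qcoord; ring.
Qed.

(** Second order Taylor remainder of a power, at commuting arguments. The factor r^2 on
    the left stands for the exponent m - 2 on the right, which would be truncated. *)
Lemma qpow_remainder z h r m : (z * h = h * z)%Q -> 0 < r ->
  qnorm z <= r -> qnorm (z + h)%Q <= r ->
  r ^ 2 * qnorm (qpow (z + h) m - qpow z m - h * (RtoQ (INR m) * qpow z (pred m)))%Q
    <= INR m ^ 2 * r ^ m * qnorm h ^ 2.
Proof.
intros E Hr Hz Hzh. assert (Hh := qnorm_ge0 h).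
assert (C : forall n X P, ((z + h) * X - z * (z * P) - h * (RtoQ (n + 1) * (z * P)) =
   (z + h) * (X - z * P - h * (RtoQ n * P)) + RtoQ n * (h * h * P))%Q).
{ intros n X P.
  assert (mv : forall c u v, (u * (RtoQ c * v) = RtoQ c * (u * v))%Q)
    by (intros c u v; now rewrite !qmul_assoc, RtoQ_comm).
  assert (Ec : (z * (h * P) = h * (z * P))%Q) by now rewrite !qmul_assoc, E.
  rewrite !qmul_addl, !qmul_subr, !mv, Ec, <- (qmul_assoc h h P).
  generalize (z * X)%Q (h * X)%Q (z * (z * P))%Q (h * (z * P))%Q (h * (h * P))%Q.
  clear. qring. }
destruct m as [| m].
- simpl. replace (_ - _)%Q with (RtoQ 0) by qring. rewrite qnorm_0. simpl. nra.
- induction m as [| m IH].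
  + replace (_ - _)%Q with (RtoQ 0) by (simpl; qring). rewrite qnorm_0. simpl. nra.
  + change (pred (S m)) with m in IH. change (pred (S (S m))) with (S m).
    rewrite (S_INR (S m)).
    assert (CC := C (INR (S m)) (qpow (z + h) (S m)) (qpow z m)).
    change (qpow z (S m)) with (z * qpow z m)%Q in *.
    change (qpow (z + h) (S (S m))) with ((z + h) * qpow (z + h) (S m))%Q.
    change (qpow z (S (S m))) with (z * (z * qpow z m))%Q.
    rewrite CC. clear CC.
    set (d := (qpow (z + h) (S m) - z * qpow z m - h * (RtoQ (INR (S m)) * qpow z m))%Q) in *.
    assert (N1 : qnorm ((z + h) * d + RtoQ (INR (S m)) * (h * h * qpow z m))%Q <=
      r * qnorm d + INR (S m) * (qnorm h ^ 2 * r ^ m)).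
    { eapply Rle_trans; [apply qnorm_triangle |]. apply Rplus_le_compat.
      - rewrite qnorm_mul. apply Rmult_le_compat_r; [apply qnorm_ge0 | exact Hzh].
      - rewrite !qnorm_mul, qnorm_RtoQ, qnorm_pow, Rabs_pos_eq by apply pos_INR.
        apply Rmult_le_compat_l; [apply pos_INR |].
        replace (qnorm h ^ 2) with (qnorm h * qnorm h) by ring.
        apply Rmult_le_compat_l; [nra |]. apply pow_incr; split; [apply qnorm_ge0 | exact Hz]. }
    apply Rle_trans with (r ^ 2 * (r * qnorm d + INR (S m) * (qnorm h ^ 2 * r ^ m))).
    { apply Rmult_le_compat_l; [nra | exact N1]. }
    assert (N2 : r * (r ^ 2 * qnorm d) <= r * (INR (S m) ^ 2 * r ^ S m * qnorm h ^ 2)).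
    { apply Rmult_le_compat_l; [lra | exact IH]. }
    assert (P := pow_lt r m Hr). assert (N := pos_INR (S m)).
    replace (r ^ S (S m)) with (r * r * r ^ m) by (simpl; ring).
    replace (r ^ S m) with (r * r ^ m) in N2 by reflexivity.
    set (n := INR (S m)) in *.
    assert (W : 0 <= r * r * r ^ m * qnorm h ^ 2).
    { repeat apply Rmult_le_pos; try lra; try apply pow2_ge_0. }
    nra.
Qed.

Definition qderiv (a : nat -> quat) : nat -> quat := fun m => (RtoQ (INR (S m)) * a (S m))%Q.

Lemma conv_qderiv a : conv a -> conv (qderiv a).
Proof.
intros H. exact (conv_mulS _ (conv_shift _ H)).
Qed.

Lemma has_qpseries_remainder f a f1 r : has_qpseries f a -> has_qpseries f1 (qderiv a) ->
  0 < r < 1 -> exists C, 0 <= C /\ forall z h, (z * h = h * z)%Q -> qnorm z <= r ->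
    qnorm (z + h)%Q <= r -> qnorm (f (z + h) - f z - h * f1 z)%Q <= C * qnorm h ^ 2.
Proof.
intros Hf Hf1 Hr. assert (Ca := has_qpseries_conv _ _ Hf).
destruct (conv_ex_series _ r (conv_mulS _ (conv_mulS _ Ca)) ltac:(lra)) as [S HS].
assert (S0 : 0 <= S).
{ rewrite <- (qnorm_0). refine (is_series_norm_le (fun _ => 0%Q : quatN) 0%Q _ S _ _ HS).
  - intros n. rewrite qnorm_0. apply Rmult_le_pos; [apply qnorm_ge0 | apply pow_le; lra].
  - exact is_series_zero. }
exists (S * / r ^ 2). split; [apply Rmult_le_pos; [lra | left; apply Rinv_0_lt_compat; nra] |].
intros z h E Hz Hzh.
assert (Bz : in_ball z) by (unfold in_ball; lra).
assert (Bzh : in_ball (z + h)%Q) by (unfold in_ball; lra).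
assert (S3 : is_series (fun m => (h * (RtoQ (INR m) * qpow z (pred m) * a m))%Q : quatN) (h * f1 z)%Q).
{ apply (is_series_linear _ _ _ (linear_qmul_l h)).
  apply (is_series_decr_1 (V := quatN)).
  replace (plus _ _) with (f1 z).
  - eapply is_series_ext; [| exact (Hf1 z Bz)]. intros m. unfold qderiv. simpl pred.
    now rewrite qmul_assoc, <- RtoQ_comm.
  - generalize (f1 z) (a 0%nat). intros u v. simpl.
    change (u = u - RtoQ 0 * 1 * v)%Q. qring. }
assert (S1 := Hf _ Bzh). assert (S2 := Hf _ Bz).
assert (S4 := is_series_minus _ _ _ _ (is_series_minus _ _ _ _ S1 S2) S3).
assert (G := is_series_scal_l (V := R_NormedModule) (/ r ^ 2 * qnorm h ^ 2) _ _ HS).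
replace (S * / r ^ 2 * qnorm h ^ 2) with (/ r ^ 2 * qnorm h ^ 2 * S) by ring.
refine (is_series_norm_le _ _ _ _ _ S4 G). intros m.
change (qnorm (qpow (z + h) m * a m - qpow z m * a m - h * (RtoQ (INR m) * qpow z (pred m) * a m))%Q <=
 / r ^ 2 * qnorm h ^ 2 * (qnorm (RtoQ (INR (Datatypes.S m)) * (RtoQ (INR (Datatypes.S m)) * a m))%Q * r ^ m)).
replace (qpow (z + h) m * a m - qpow z m * a m - h * (RtoQ (INR m) * qpow z (pred m) * a m))%Q
 with ((qpow (z + h) m - qpow z m - h * (RtoQ (INR m) * qpow z (pred m))) * a m)%Q
 by (rewrite !qmul_subl, !qmul_assoc; reflexivity).
rewrite !qnorm_mul, qnorm_RtoQ, Rabs_pos_eq by apply pos_INR.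
assert (R := qpow_remainder z h r m E (proj1 Hr) Hz Hzh).
set (d := qnorm (qpow (z + h) m - _ - _)%Q) in *.
assert (R2 : d <= / r ^ 2 * (INR m ^ 2 * r ^ m * qnorm h ^ 2)).
{ apply Rmult_le_reg_l with (r ^ 2); [nra |]. rewrite <- Rmult_assoc, Rinv_r, Rmult_1_l by nra. exact R. }
apply Rle_trans with (/ r ^ 2 * (INR m ^ 2 * r ^ m * qnorm h ^ 2) * qnorm (a m)).
{ apply Rmult_le_compat_r; [apply qnorm_ge0 | exact R2]. }
replace (/ r ^ 2 * (INR m ^ 2 * r ^ m * qnorm h ^ 2) * qnorm (a m)) with
 (INR m ^ 2 * (/ r ^ 2 * qnorm h ^ 2 * qnorm (a m) * r ^ m)) by ring.
replace (/ r ^ 2 * qnorm h ^ 2 * (INR (Datatypes.S m) * (INR (Datatypes.S m) * qnorm (a m)) * r ^ m)) with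
 (INR (Datatypes.S m) ^ 2 * (/ r ^ 2 * qnorm h ^ 2 * qnorm (a m) * r ^ m)) by ring.
apply Rmult_le_compat_r.
- repeat apply Rmult_le_pos; try lra; try apply qnorm_ge0; try apply pow2_ge_0; try (apply pow_le; lra).
  left. apply Rinv_0_lt_compat. nra.
- rewrite S_INR. assert (N := pos_INR m). nra.
Qed.

Lemma slice_pt_comm I x y x' y' : (slice_pt I x y * slice_pt I x' y' = slice_pt I x' y' * slice_pt I x y)%Q.
Proof. unfold slice_pt. qring. Qed.

Lemma slice_pt_add I x y x' y' : slice_pt I (x + x') (y + y') = (slice_pt I x y + slice_pt I x' y')%Q.
Proof. unfold slice_pt. qring. Qed.

Lemma slice_pt_norm_le I x y : imag_unit I -> qnorm (slice_pt I x y) <= Rabs x + Rabs y.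
Proof.
intros H. assert (N := slice_pt_norm I x y H).
assert (P := qnorm_ge0 (slice_pt I x y)). rewrite <- (pow2_abs x), <- (pow2_abs y) in N.
generalize (Rabs_pos x) (Rabs_pos y). intros. nra.
Qed.

(** The points of a slice commute, so the remainder estimate applies to every
    direction in it and gives both partial derivatives and joint continuity. *)
Lemma regular_derivatives f a f1 I x y : has_qpseries f a -> has_qpseries f1 (qderiv a) ->
  imag_unit I -> in_ball (slice_pt I x y) ->
  is_derive (fun t : R => f (slice_pt I t y) : quatN) x (f1 (slice_pt I x y)) /\
  is_derive (fun t : R => f (slice_pt I x t) : quatN) y (I * f1 (slice_pt I x y))%Q /\
  continuous (fun p : R * R => f (slice_pt I (fst p) (snd p)) : quatN) (x, y).
Proof.
intros Hf Hf1 HI Hb. set (z := slice_pt I x y) in *.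
assert (Z0 := qnorm_ge0 z). assert (Z1 : qnorm z < 1) by exact Hb.
set (r := (1 + qnorm z) / 2).
destruct (has_qpseries_remainder f a f1 r Hf Hf1) as (C & C0 & HC); [unfold r; lra |].
assert (K : forall h k, Rabs h + Rabs k <= (1 - qnorm z) / 2 ->
   qnorm (f (slice_pt I (x + h) (y + k)) - f z - slice_pt I h k * f1 z)%Q <= C * (Rabs h + Rabs k) ^ 2).
{ intros h k Hhk. rewrite slice_pt_add. fold z.
  assert (Nh := slice_pt_norm_le I h k HI).
  eapply Rle_trans; [apply HC |].
  - apply slice_pt_comm.
  - unfold r; lra.
  - eapply Rle_trans; [apply qnorm_triangle |]. unfold r; lra.
  - apply Rmult_le_compat_l; [exact C0 |]. apply pow_incr. split; [apply qnorm_ge0 | exact Nh]. }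
split; [| split].
- apply is_derive_quadratic with ((1 - qnorm z) / 2) C; [lra |]. intros h Hh.
  specialize (K h 0). rewrite Rabs_R0, !Rplus_0_r, pow2_abs in K.
  replace (slice_pt I h 0) with (RtoQ h) in K by (unfold slice_pt; qring).
  apply K. lra.
- apply is_derive_quadratic with ((1 - qnorm z) / 2) C; [lra |]. intros h Hh.
  specialize (K 0 h). rewrite Rabs_R0, Rplus_0_r, Rplus_0_l, pow2_abs in K.
  replace (slice_pt I 0 h) with (RtoQ h * I)%Q in K by (unfold slice_pt; qring).
  rewrite qmul_assoc. apply K. lra.
- apply continuous_lipschitz with ((1 - qnorm z) / 4) (C + qnorm (f1 z)); [lra |].
  intros h k Hh Hk. simpl.
  specialize (K h k ltac:(lra)).
  set (w := f (slice_pt I (x + h) (y + k))) in *.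
  change (qnorm (w - f z)%Q <= (C + qnorm (f1 z)) * (Rabs h + Rabs k)).
  replace (w - f z)%Q with ((w - f z - slice_pt I h k * f1 z) + slice_pt I h k * f1 z)%Q
    by (generalize (f z) (slice_pt I h k * f1 z)%Q; clearbody w; qring).
  eapply Rle_trans; [apply qnorm_triangle |].
  rewrite Rmult_plus_distr_r. apply Rplus_le_compat.
  + eapply Rle_trans; [exact K |]. apply Rmult_le_compat_l; [exact C0 |].
    generalize (Rabs_pos h) (Rabs_pos k). intros. nra.
  + rewrite qnorm_mul, Rmult_comm. apply Rmult_le_compat_l; [apply qnorm_ge0 |].
    now apply slice_pt_norm_le.
Qed.

Lemma imag_unit_mul I q : imag_unit I -> (I * (I * q) = RtoQ (-1) * q)%Q.
Proof. intros H. now rewrite qmul_assoc, H. Qed.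

Lemma regular_slice_regular f : regular f -> slice_regular f.
Proof.
intros [a Ha] I HI.
assert (C1 := conv_qderiv a (has_qpseries_conv _ _ Ha)).
assert (C2 := conv_qderiv _ C1).
assert (H1 := has_qpseries_qpseries _ C1). assert (H2 := has_qpseries_qpseries _ C2).
set (f1 := qpseries (qderiv a)) in *.
exists (fun p => f1 (slice_pt I (fst p) (snd p))), (fun p => I * f1 (slice_pt I (fst p) (snd p)))%Q.
intros x y Hxy. simpl.
destruct (regular_derivatives f a f1 I x y Ha H1 HI Hxy) as (D1 & D2 & _).
destruct (regular_derivatives f1 _ _ I x y H1 H2 HI Hxy) as (_ & _ & D3).
split; [exact D1 | split; [exact D2 | split; [exact D3 | split]]].
- exact (continuous_linear _ _ _ (linear_qmul_l I) D3).
- rewrite imag_unit_mul by exact HI. generalize (f1 (slice_pt I x y)). qring.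
Qed.

(** * Calculus for quaternion valued functions *)

Lemma is_derive_eq {V : NormedModule R_AbsRing} (u : R -> V) x l l' :
  is_derive u x l -> l = l' -> is_derive u x l'.
Proof. now intros H <-. Qed.

Lemma Derive_of (g : R -> R) (x l : R) : is_derive g x l -> Derive (fun t => g t) x = l.
Proof. apply is_derive_unique. Qed.

Lemma is_derive_qmul (u v : R -> quatN) x (lu lv : quatN) :
  is_derive u x lu -> is_derive v x lv ->
  is_derive (fun t => (u t * v t)%Q : quatN) x (lu * v x + u x * lv)%Q.
Proof.
intros Hu Hv.
assert (U0 := is_derive_linear _ _ _ _ linear_Q0 Hu).
assert (U1 := is_derive_linear _ _ _ _ linear_Q1 Hu).
assert (U2 := is_derive_linear _ _ _ _ linear_Q2 Hu).
assert (U3 := is_derive_linear _ _ _ _ linear_Q3 Hu).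
assert (V0 := is_derive_linear _ _ _ _ linear_Q0 Hv).
assert (V1 := is_derive_linear _ _ _ _ linear_Q1 Hv).
assert (V2 := is_derive_linear _ _ _ _ linear_Q2 Hv).
assert (V3 := is_derive_linear _ _ _ _ linear_Q3 Hv).
assert (K : forall (a b c d a' b' c' d' : R -> R) la lb lc ld la' lb' lc' ld' (s1 s2 s3 : R),
  is_derive a x la -> is_derive b x lb -> is_derive c x lc -> is_derive d x ld ->
  is_derive a' x la' -> is_derive b' x lb' -> is_derive c' x lc' -> is_derive d' x ld' ->
  is_derive (fun t => a t * a' t + s1 * (b t * b' t) + s2 * (c t * c' t) + s3 * (d t * d' t)) x
    (la * a' x + a x * la' + s1 * (lb * b' x + b x * lb') + s2 * (lc * c' x + c x * lc')
      + s3 * (ld * d' x + d x * ld'))).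
{ intros a b c d a' b' c' d' la lb lc ld la' lb' lc' ld' s1 s2 s3 Ha Hb Hc Hd Ha' Hb' Hc' Hd'.
  auto_derive; [repeat split; eexists; eassumption |].
  rewrite (Derive_of _ _ _ Ha), (Derive_of _ _ _ Hb), (Derive_of _ _ _ Hc), (Derive_of _ _ _ Hd),
    (Derive_of _ _ _ Ha'), (Derive_of _ _ _ Hb'), (Derive_of _ _ _ Hc'), (Derive_of _ _ _ Hd').
  ring. }
apply is_derive_coord.
- eapply is_derive_ext; [| eapply is_derive_eq; [exact (K _ _ _ _ _ _ _ _ _ _ _ _ _ _ _ _ (-1) (-1) (-1) U0 U1 U2 U3 V0 V1 V2 V3) |]].
  + intros t. cbv beta. generalize (u t) (v t). intros; qcoord; ring.
  + cbv beta. generalize (u x) (v x). intros; qcoord; ring.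
- eapply is_derive_ext; [| eapply is_derive_eq; [exact (K _ _ _ _ _ _ _ _ _ _ _ _ _ _ _ _ 1 1 (-1) U0 U1 U2 U3 V1 V0 V3 V2) |]].
  + intros t. cbv beta. generalize (u t) (v t). intros; qcoord; ring.
  + cbv beta. generalize (u x) (v x). intros; qcoord; ring.
- eapply is_derive_ext; [| eapply is_derive_eq; [exact (K _ _ _ _ _ _ _ _ _ _ _ _ _ _ _ _ (-1) 1 1 U0 U1 U2 U3 V2 V3 V0 V1) |]].
  + intros t. cbv beta. generalize (u t) (v t). intros; qcoord; ring.
  + cbv beta. generalize (u x) (v x). intros; qcoord; ring.
- eapply is_derive_ext; [| eapply is_derive_eq; [exact (K _ _ _ _ _ _ _ _ _ _ _ _ _ _ _ _ 1 (-1) 1 U0 U1 U2 U3 V3 V2 V1 V0) |]].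
  + intros t. cbv beta. generalize (u t) (v t). intros; qcoord; ring.
  + cbv beta. generalize (u x) (v x). intros; qcoord; ring.
Qed.

Lemma qnormsq_coord_pos q : q <> 0%Q -> 0 < Q0 q ^ 2 + Q1 q ^ 2 + Q2 q ^ 2 + Q3 q ^ 2.
Proof. intros H. rewrite <- qnorm_sqr. apply qnorm_pos in H. nra. Qed.

Lemma is_derive_qinv (u : R -> quatN) x (l : quatN) :
  is_derive u x l -> u x <> 0%Q ->
  is_derive (fun t => qinv (u t) : quatN) x (- (qinv (u x) * l * qinv (u x)))%Q.
Proof.
intros Hu Hx.
assert (U0 := is_derive_linear _ _ _ _ linear_Q0 Hu).
assert (U1 := is_derive_linear _ _ _ _ linear_Q1 Hu).
assert (U2 := is_derive_linear _ _ _ _ linear_Q2 Hu).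
assert (U3 := is_derive_linear _ _ _ _ linear_Q3 Hu).
assert (P := qnormsq_coord_pos _ Hx).
assert (E : forall q, qinv q = (RtoQ (/ (Q0 q ^ 2 + Q1 q ^ 2 + Q2 q ^ 2 + Q3 q ^ 2)) * qconj q)%Q).
{ intros q. unfold qinv. now rewrite qnorm_sqr. }
assert (K : forall (a b c d : R -> R) la lb lc ld,
  is_derive a x la -> is_derive b x lb -> is_derive c x lc -> is_derive d x ld ->
  a x ^ 2 + b x ^ 2 + c x ^ 2 + d x ^ 2 <> 0 ->
  is_derive (fun t => / (a t ^ 2 + b t ^ 2 + c t ^ 2 + d t ^ 2)) x
   (- (2 * (la * a x + lb * b x + lc * c x + ld * d x)) / (a x ^ 2 + b x ^ 2 + c x ^ 2 + d x ^ 2) ^ 2)).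
{ intros a b c d la lb lc ld A B C D N.
  auto_derive; [repeat split; try (eexists; eassumption); intros Z; apply N; rewrite <- Z; ring |].
  rewrite (Derive_of _ _ _ A), (Derive_of _ _ _ B), (Derive_of _ _ _ C), (Derive_of _ _ _ D).
  field. repeat split; intros Z; apply N; rewrite <- Z; ring. }
assert (D := K _ _ _ _ _ _ _ _ U0 U1 U2 U3 ltac:(apply Rgt_not_eq, P)).
apply (is_derive_linear _ _ _ _ (linear_RtoQ_l 1%Q)) in D.
assert (C := is_derive_linear _ _ _ _ linear_qconj Hu).
eapply is_derive_ext; [| eapply is_derive_eq; [exact (is_derive_qmul _ _ _ _ _ D C) |]].
- intros t. simpl. now rewrite E, qmul_1r.
(* the derivative of 1 / |u|^2 enters through q^- l q^- = 2 <l, q> q^- - |q|^2 l^- *)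
- cbv beta. rewrite !E. revert P. generalize (u x). intros q P. clear - P.
  set (N := Q0 q ^ 2 + Q1 q ^ 2 + Q2 q ^ 2 + Q3 q ^ 2) in *.
  set (s := Q0 l * Q0 q + Q1 l * Q1 q + Q2 l * Q2 q + Q3 l * Q3 q).
  assert (J : (qconj q * l * qconj q = RtoQ (2 * s) * qconj q - RtoQ N * qconj l)%Q)
    by (unfold s, N; qring).
  assert (J' : forall n A, (- (RtoQ n * A * l * (RtoQ n * A)) = RtoQ (- (n * n)) * (A * l * A))%Q).
  { intros n A. rewrite (RtoQ_comm n A) at 2. rewrite !qmul_assoc, <- (RtoQ_comm n).
    rewrite !qmul_assoc, <- RtoQ_mul. generalize (n * n)%R. intros k.
    rewrite <- !qmul_assoc. generalize (A * (l * A))%Q. qring. }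
  rewrite J', J. replace (- (2 * s) / N ^ 2) with (/ N * / N * - (2 * s)) by (field; lra).
  replace (RtoQ (/ N) * 1)%Q with (RtoQ (/ N * / N * N)) by (rewrite qmul_1r; f_equal; field; lra).
  generalize (/ N) (qconj q) (qconj l) s N. clear. intros; qring.
Qed.

Lemma is_derive_continuous_q (u : R -> quatN) x l : is_derive u x l -> continuous u x.
Proof. intros H. apply ex_derive_continuous. now exists l. Qed.

Lemma continuous_qmul {U : UniformSpace} (u v : U -> quatN) x :
  continuous u x -> continuous v x -> continuous (fun t => (u t * v t)%Q : quatN) x.
Proof.
intros Hu Hv.
assert (U0 := continuous_linear _ _ _ linear_Q0 Hu).
assert (U1 := continuous_linear _ _ _ linear_Q1 Hu).
assert (U2 := continuous_linear _ _ _ linear_Q2 Hu).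
assert (U3 := continuous_linear _ _ _ linear_Q3 Hu).
assert (S : forall a, continuous a x -> continuous (fun t => (RtoQ (a t) * v t)%Q : quatN) x).
{ intros a Ha. eapply continuous_ext; [| exact (continuous_scal _ _ _ Ha Hv)].
  intros t. apply scal_RtoQ. }
assert (S0 := S _ U0). assert (S1 := continuous_linear _ _ _ (linear_qmul_l qi) (S _ U1)).
assert (S2 := continuous_linear _ _ _ (linear_qmul_l qj) (S _ U2)).
assert (S3 := continuous_linear _ _ _ (linear_qmul_l qk) (S _ U3)).
eapply continuous_ext; [| exact (continuous_plus _ _ _ (continuous_plus _ _ _ S0 S1) (continuous_plus _ _ _ S2 S3))].
intros t. cbv beta. generalize (u t) (v t). intros a b.
change (RtoQ (Q0 a) * b + qi * (RtoQ (Q1 a) * b) + (qj * (RtoQ (Q2 a) * b) + qk * (RtoQ (Q3 a) * b)) = a * b)%Q.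
unfold qi, qj, qk. qring.
Qed.

Lemma continuous_qpow {U : UniformSpace} (u : U -> quatN) x m :
  continuous u x -> continuous (fun t => qpow (u t) m : quatN) x.
Proof.
intros H. induction m as [| m IH]; simpl; [apply continuous_const | now apply continuous_qmul].
Qed.

Definition qInt (u : R -> quat) : quat :=
  (RInt (fun t => Q0 (u t)) 0 (2 * PI), RInt (fun t => Q1 (u t)) 0 (2 * PI),
   RInt (fun t => Q2 (u t)) 0 (2 * PI), RInt (fun t => Q3 (u t)) 0 (2 * PI)).

Lemma qInt_unique (u : R -> quatN) l : is_RInt u 0 (2 * PI) l -> qInt u = l.
Proof.
intros H. destruct l as [[[l0 l1] l2] l3].
assert (H3 := is_RInt_fct_extend_snd _ _ _ _ H).
apply is_RInt_fct_extend_fst in H.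
assert (H2 := is_RInt_fct_extend_snd _ _ _ _ H).
apply is_RInt_fct_extend_fst in H.
assert (H1 := is_RInt_fct_extend_snd _ _ _ _ H).
apply is_RInt_fct_extend_fst in H.
apply (is_RInt_unique (V := R_CompleteNormedModule)) in H, H1, H2, H3.
unfold qInt, Q0, Q1, Q2, Q3. simpl in *. now rewrite H, H1, H2, H3.
Qed.

Lemma qInt_correct (u : R -> quatN) : (forall t, continuous u t) ->
  is_RInt u 0 (2 * PI) (qInt u).
Proof.
intros H.
assert (K : forall T : quatN -> R, is_linear (T : quatN -> R_NormedModule) ->
  is_RInt (fun t => T (u t)) 0 (2 * PI) (RInt (fun t => T (u t)) 0 (2 * PI))).
{ intros T HT. apply (RInt_correct (V := R_CompleteNormedModule)).
  apply (ex_RInt_continuous (V := R_CompleteNormedModule)). intros t _.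
  exact (continuous_linear _ _ _ HT (H t)). }
apply (is_RInt_fct_extend_pair (U := prod_NormedModule R_AbsRing (prod_NormedModule R_AbsRing R_NormedModule R_NormedModule) R_NormedModule)); [| apply (K (fun q => Q3 q)), linear_Q3].
apply (is_RInt_fct_extend_pair (U := prod_NormedModule R_AbsRing R_NormedModule R_NormedModule)); [| apply (K (fun q => Q2 q)), linear_Q2].
apply (is_RInt_fct_extend_pair (U := R_NormedModule)); [apply (K (fun q => Q0 q)), linear_Q0 | apply (K (fun q => Q1 q)), linear_Q1].
Qed.

Lemma is_RInt_linear {U V : NormedModule R_AbsRing} (T : U -> V) u a b l :
  is_linear T -> is_RInt u a b l -> is_RInt (fun t => T (u t)) a b (T l).
Proof.
intros HT H. unfold is_RInt.
assert (E : forall s, Riemann_sum (fun t => T (u t)) s = T (Riemann_sum u s)).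
{ apply SF_cons_ind; [intros x; symmetry; exact (linear_zero T HT) |].
  intros h s IH. now rewrite !Riemann_sum_cons, IH, (linear_plus T HT), (linear_scal T HT). }
apply filterlim_ext with (fun s => T (scal (sign (b - a)) (Riemann_sum u s))).
- intros s. now rewrite (linear_scal T HT), E.
- eapply filterlim_comp; [exact H | now apply linear_continuous].
Qed.

Lemma qInt_linear (T : quatN -> quatN) (u : R -> quatN) : is_linear T ->
  (forall t, continuous u t) -> qInt (fun t => T (u t)) = T (qInt u).
Proof. intros HT H. apply qInt_unique, is_RInt_linear, qInt_correct; assumption. Qed.

Lemma qInt_add (u v : R -> quatN) : (forall t, continuous u t) -> (forall t, continuous v t) ->
  qInt (fun t => u t + v t)%Q = (qInt u + qInt v)%Q.
Proof.
intros Hu Hv. apply qInt_unique.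
exact (is_RInt_plus _ _ _ _ _ _ (qInt_correct u Hu) (qInt_correct v Hv)).
Qed.

Lemma qInt_ext u v : (forall t, u t = v t) -> qInt u = qInt v.
Proof. intros H. f_equal. now apply functional_extensionality. Qed.

Lemma qInt_norm (u : R -> quatN) M : (forall t, continuous u t) ->
  (forall t, 0 <= t <= 2 * PI -> qnorm (u t) <= M) -> qnorm (qInt u) <= 2 * PI * M.
Proof.
intros Hu HM. rewrite <- norm_qnorm. rewrite <- (Rminus_0_r (2 * PI)).
refine (norm_RInt_le_const u 0 (2 * PI) _ M _ _ (qInt_correct u Hu)).
- generalize PI_RGT_0; lra.
- intros t Ht. rewrite norm_qnorm. now apply HM.
Qed.

Lemma qInt_derive (u du : R -> quatN) : (forall t, is_derive u t (du t)) ->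
  (forall t, continuous du t) -> qInt du = (u (2 * PI)%R - u 0%R)%Q.
Proof.
intros H Hc.
assert (K : forall T : quatN -> R, is_linear (T : quatN -> R_NormedModule) ->
  RInt (fun t => T (du t)) 0 (2 * PI) = T (u (2 * PI)) - T (u 0)).
{ intros T HT. apply (is_RInt_unique (V := R_CompleteNormedModule)).
  apply (is_RInt_derive (V := R_CompleteNormedModule) (fun t => T (u t)) (fun t => T (du t))).
  - intros t _. exact (is_derive_linear _ _ _ _ HT (H t)).
  - intros t _. exact (continuous_linear _ _ _ HT (Hc t)). }
by_coord quat_ext K.
Qed.

(** * Cauchy's formula in a slice *)

Lemma continuous_slice_pt I (x y : R) : imag_unit I ->
  continuous (fun p : R * R => slice_pt I (fst p) (snd p) : quatN) (x, y).
Proof.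
intros HI. apply continuous_lipschitz with 1 1; [lra |]. intros h k _ _. simpl.
rewrite slice_pt_add, Rmult_1_l.
replace (slice_pt I x y + slice_pt I h k - slice_pt I x y)%Q with (slice_pt I h k)
  by (generalize (slice_pt I x y) (slice_pt I h k); qring).
now apply slice_pt_norm_le.
Qed.

Lemma locally_in_ball I (x y : R) : imag_unit I -> in_ball (slice_pt I x y) ->
  locally (x, y) (fun p : R * R => in_ball (slice_pt I (fst p) (snd p))).
Proof.
intros HI H.
assert (C : continuous (fun p : R * R => norm (slice_pt I (fst p) (snd p) : quatN)) (x, y)).
{ apply (continuous_comp (fun p : R * R => slice_pt I (fst p) (snd p) : quatN) norm).
  - now apply continuous_slice_pt.
  - apply filterlim_norm. }
assert (L : locally (norm (slice_pt I x y : quatN)) (fun u => u < 1)).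
{ apply open_lt. rewrite norm_qnorm. exact H. }
specialize (C _ L). unfold filtermap in C. refine (filter_imp _ _ _ C). intros p Hp.
simpl in Hp. rewrite norm_qnorm in Hp. exact Hp.
Qed.

(** In a slice the Cauchy-Riemann equation reads f_y = I f_x, so the derivative along a
    curve (X, Y) is (X' + Y' I) f_x; [f1] is f_x. Continuity of the partial derivatives
    makes [f] differentiable there. *)
Lemma slice_chain f I : slice_regular f -> imag_unit I ->
  exists f1 : R * R -> quatN,
    (forall x y, in_ball (slice_pt I x y) -> continuous f1 (x, y)) /\
    (forall x y, in_ball (slice_pt I x y) ->
       continuous (fun p : R * R => f (slice_pt I (fst p) (snd p)) : quatN) (x, y)) /\
    (forall (X Y : R -> R) t X' Y', is_derive X t X' -> is_derive Y t Y' ->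
       in_ball (slice_pt I (X t) (Y t)) ->
       is_derive (fun s => f (slice_pt I (X s) (Y s)) : quatN) t
         (slice_pt I X' Y' * f1 (X t, Y t))%Q).
Proof.
intros Hf HI. destruct (Hf I HI) as (fx & fy & H). exists fx.
assert (Efy : forall x y, in_ball (slice_pt I x y) -> fy (x, y) = (I * fx (x, y))%Q).
{ intros x y Hb. destruct (H x y Hb) as (_ & _ & _ & _ & E).
  apply qmul_eq0 in E. destruct E as [E | E]; [apply (f_equal Q0) in E; unfold Q0, RtoQ in E; simpl in E; lra |].
  apply qsub_eq0. apply (f_equal (fun q => I * q)%Q) in E.
  rewrite qmul_addr, imag_unit_mul, qmul_0r in E by exact HI.
  revert E. generalize (fy (x, y)) (I * fx (x, y))%Q. intros u v E.
  replace (u - v)%Q with (RtoQ (-1) * (v + RtoQ (-1) * u))%Q by qring. rewrite E. apply qmul_0r. }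
assert (FD : forall T : quatN -> R, is_linear (T : quatN -> R_NormedModule) ->
  forall x y, in_ball (slice_pt I x y) ->
  filterdiff (fun u : R * R => T (f (slice_pt I (fst u) (snd u)))) (locally (x, y))
    (fun u : R * R => plus (scal (fst u) (T (fx (x, y)))) (scal (snd u) (T (fy (x, y)))))).
{ intros T HT x y Hb.
  apply (is_derive_filterdiff (fun x y => T (f (slice_pt I x y))) x y (fun x y => T (fx (x, y)))).
  - refine (filter_imp _ _ _ (locally_in_ball I x y HI Hb)). intros [x' y'] Hb'. simpl in *.
    exact (is_derive_linear _ _ _ _ HT (proj1 (H x' y' Hb'))).
  - exact (is_derive_linear _ _ _ _ HT (proj1 (proj2 (H x y Hb)))).
  - apply continuous_ext with (fun u => T (fx u)); [intros [u v]; reflexivity |].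
    exact (continuous_linear _ _ _ HT (proj1 (proj2 (proj2 (H x y Hb))))). }
split; [| split].
- intros x y Hb. exact (proj1 (proj2 (proj2 (H x y Hb)))).
- intros x y Hb.
  assert (G : forall T : quatN -> R, is_linear (T : quatN -> R_NormedModule) ->
    continuous (fun p : R * R => T (f (slice_pt I (fst p) (snd p)))) (x, y)).
  { intros T HT.
    exact (filterdiff_continuous (U := prod_NormedModule R_AbsRing R_NormedModule R_NormedModule)
      (V := R_NormedModule) _ _ (ex_intro _ _ (FD T HT x y Hb))). }
  by_coord continuous_coord G.
- intros X Y t X' Y' HX HY Hb.
  assert (G : forall T : quatN -> R, is_linear (T : quatN -> R_NormedModule) ->
    is_derive (fun s => T (f (slice_pt I (X s) (Y s)))) t (T (slice_pt I X' Y' * fx (X t, Y t))%Q)).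
  { intros T HT. apply is_derive_Reals.
    replace (T (slice_pt I X' Y' * fx (X t, Y t))%Q) with
      (T (fx (X t, Y t)) * X' + T (fy (X t, Y t)) * Y').
    - apply (derivable_pt_lim_comp_2d (fun x y => T (f (slice_pt I x y))) X Y);
      [| now apply is_derive_Reals | now apply is_derive_Reals].
      apply filterdiff_differentiable_pt_lim. exact (FD T HT _ _ Hb).
    - rewrite Efy by exact Hb. generalize (fx (X t, Y t)). intros w.
      replace (slice_pt I X' Y' * w)%Q with (plus (scal X' (w : quatN)) (scal Y' (I * w : quatN)%Q)).
      + rewrite (linear_plus _ HT), !(linear_scal _ HT).
        unfold plus, scal; simpl. unfold mult; simpl. ring.
      + rewrite !scal_RtoQ. change (RtoQ X' * w + RtoQ Y' * (I * w) = slice_pt I X' Y' * w)%Q.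
        unfold slice_pt. now rewrite qmul_addl, qmul_assoc. }
  by_coord is_derive_coord G.
Qed.

Definition circ (I : quat) (r th : R) : quat := slice_pt I (r * cos th) (r * sin th).
Definition icirc (I : quat) (r th : R) : quat := slice_pt I (cos th / r) (- (sin th / r)).

Lemma icirc_circ I r th : imag_unit I -> 0 < r -> (icirc I r th * circ I r th = 1)%Q.
Proof.
intros HI Hr. unfold icirc, circ, slice_pt.
assert (S : sin th * sin th + cos th * cos th = 1).
{ generalize (sin2_cos2 th). unfold Rsqr. lra. }
replace 1%Q with (RtoQ (sin th * sin th + cos th * cos th) : quat) by now rewrite S.
rewrite !qmul_addl, !qmul_addr.
replace (RtoQ (- (sin th / r)) * I * (RtoQ (r * sin th) * I))%Q with
 (RtoQ (- (sin th / r) * (r * sin th)) * (I * I))%Q by qring.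
rewrite HI. apply quat_ext; qcoord; field; lra.
Qed.

Lemma circ_norm I r th : imag_unit I -> 0 < r -> qnorm (circ I r th) = r.
Proof.
intros HI Hr. apply qnorm_eq; [lra |]. unfold circ. rewrite slice_pt_norm by exact HI.
assert (S := sin2_cos2 th). unfold Rsqr in S.
replace ((r * cos th) ^ 2 + (r * sin th) ^ 2) with (r ^ 2 * (sin th * sin th + cos th * cos th)) by ring.
rewrite S; ring.
Qed.

Lemma icirc_norm I r th : imag_unit I -> 0 < r -> qnorm (icirc I r th) = / r.
Proof.
intros HI Hr. apply Rmult_eq_reg_r with r; [| lra].
rewrite <- (circ_norm I r th HI Hr) at 2. rewrite <- qnorm_mul, icirc_circ by assumption.
rewrite qnorm_1. field. lra.
Qed.

Lemma is_derive_slice_pt I (X Y : R -> R) t X' Y' : is_derive X t X' -> is_derive Y t Y' ->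
  is_derive (fun s => slice_pt I (X s) (Y s) : quatN) t (slice_pt I X' Y').
Proof.
intros HX HY.
assert (K := is_derive_plus _ _ _ _ _ (is_derive_linear _ _ _ _ (linear_RtoQ_l 1%Q) HX)
  (is_derive_linear _ _ _ _ (linear_RtoQ_l I) HY)).
eapply is_derive_ext; [| eapply is_derive_eq; [exact K |]].
- intros s. unfold slice_pt. now rewrite <- (qmul_1r (RtoQ (X s))) at 2.
- unfold slice_pt. now rewrite <- (qmul_1r (RtoQ X')) at 2.
Qed.

Lemma icirc_is_derive I r th : imag_unit I -> 0 < r ->
  is_derive (fun t => icirc I r t : quatN) th (RtoQ (-1) * I * icirc I r th)%Q.
Proof.
intros HI Hr. eapply is_derive_eq.
- apply is_derive_slice_pt.
  + instantiate (1 := - (sin th / r)). auto_derive; [exact Logic.I | field; lra].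
  + instantiate (1 := - (cos th / r)). auto_derive; [exact Logic.I | field; lra].
- unfold icirc, slice_pt. rewrite qmul_addr.
  replace (RtoQ (-1) * I * (RtoQ (- (sin th / r)) * I))%Q with (RtoQ (sin th / r) * (I * I))%Q by qring.
  rewrite HI. generalize (cos th / r) (sin th / r). intros; qring.
Qed.

Lemma icirc_continuous I r th : imag_unit I -> 0 < r -> continuous (fun t => icirc I r t : quatN) th.
Proof. intros HI Hr. eapply is_derive_continuous_q, icirc_is_derive; assumption. Qed.

Lemma icirc_comm I r th : (I * icirc I r th = icirc I r th * I)%Q.
Proof. unfold icirc, slice_pt. qring. Qed.

Lemma icirc_pow_is_derive I r th m : imag_unit I -> 0 < r ->
  is_derive (fun t => qpow (icirc I r t) m : quatN) th (RtoQ (- INR m) * I * qpow (icirc I r th) m)%Q.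
Proof.
intros HI Hr. induction m as [| m IH].
- simpl. eapply is_derive_eq; [apply (is_derive_const (V := quatN)) |].
  change (0 = RtoQ (- 0) * I * 1)%Q. qring.
- simpl (qpow _ (S m)). eapply is_derive_eq.
  + apply is_derive_qmul; [now apply icirc_is_derive | exact IH].
  + rewrite S_INR.
    replace (icirc I r th * (RtoQ (- INR m) * I * qpow (icirc I r th) m))%Q with
      (RtoQ (- INR m) * (I * icirc I r th) * qpow (icirc I r th) m)%Q.
    * rewrite <- !qmul_assoc. generalize (I * (icirc I r th * qpow (icirc I r th) m))%Q.
      generalize (INR m). qring.
    * rewrite icirc_comm, !qmul_assoc. now rewrite (RtoQ_comm _ (icirc I r th)).
Qed.

Lemma icirc_2PI I r : icirc I r (2 * PI) = icirc I r 0.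
Proof. unfold icirc. now rewrite cos_2PI, sin_2PI, cos_0, sin_0. Qed.

Lemma qInt_icirc_pow I r m : imag_unit I -> 0 < r ->
  qInt (fun t => qpow (icirc I r t) (S m)) = 0%Q.
Proof.
intros HI Hr.
assert (C : forall t, continuous (fun t => qpow (icirc I r t) (S m) : quatN) t)
  by (intros t; now apply continuous_qpow, icirc_continuous).
assert (K := qInt_derive (fun t => qpow (icirc I r t) (S m))
   (fun t => RtoQ (- INR (S m)) * I * qpow (icirc I r t) (S m))%Q
   (fun t => icirc_pow_is_derive I r t (S m) HI Hr)
   (fun t => continuous_linear _ _ _ (linear_qmul_l _) (C t))).
rewrite (qInt_linear _ _ (linear_qmul_l (RtoQ (- INR (S m)) * I)%Q) C) in K.
cbv beta in K. rewrite icirc_2PI, qsub_diag in K.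
apply qmul_eq0 in K. destruct K as [K | K]; [exfalso | exact K].
apply qmul_eq0 in K. destruct K as [K | K].
- apply (f_equal Q0) in K. change (- INR (S m) = 0) in K.
  assert (L := lt_0_INR (S m) (Nat.lt_0_succ m)). lra.
- exact (imag_unit_neq0 I HI K).
Qed.

Lemma qInt_cst c : qInt (fun _ => c) = (RtoQ (2 * PI) * c)%Q.
Proof.
apply qInt_unique. rewrite <- scal_RtoQ. rewrite <- (Rminus_0_r (2 * PI)) at 2.
apply (is_RInt_const (V := quatN)).
Qed.

(** zeta / (zeta - z) at zeta = r e^(I th): the Cauchy kernel with respect to the angle. *)
Definition kern (I : quat) (r : R) (z : quat) (th : R) : quat :=
  (circ I r th * qinv (circ I r th - z))%Q.

Lemma circ_sub_neq0 I r z th : imag_unit I -> 0 < r -> qnorm z < r -> (circ I r th - z <> 0)%Q.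
Proof.
intros HI Hr Hz E. apply qsub_eq0 in E. rewrite <- E, circ_norm in Hz by assumption. lra.
Qed.

Lemma circ_is_derive_ex I r th : imag_unit I -> exists l, is_derive (fun t => circ I r t : quatN) th l.
Proof.
intros HI. eexists. apply is_derive_slice_pt; apply Derive_correct; auto_derive; exact Logic.I.
Qed.

Lemma circ_continuous I r th : imag_unit I -> continuous (fun t => circ I r t : quatN) th.
Proof. intros HI. destruct (circ_is_derive_ex I r th HI). eapply is_derive_continuous_q; eassumption. Qed.

Lemma kern_continuous I r z th : imag_unit I -> 0 < r -> qnorm z < r ->
  continuous (fun t => kern I r z t : quatN) th.
Proof.
intros HI Hr Hz. apply continuous_qmul; [now apply circ_continuous |].
destruct (circ_is_derive_ex I r th HI) as [l Hl].
assert (K := is_derive_minus _ _ _ _ _ Hl (is_derive_const (z : quatN) th)).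
eapply is_derive_continuous_q. apply is_derive_qinv; [exact K |].
now apply circ_sub_neq0.
Qed.

Lemma kern_norm I r z th : imag_unit I -> 0 < r -> qnorm z < r ->
  qnorm (kern I r z th) <= r / (r - qnorm z).
Proof.
intros HI Hr Hz. unfold kern. rewrite qnorm_mul, circ_norm by assumption.
rewrite qnorm_inv by now apply circ_sub_neq0.
apply Rmult_le_compat_l; [lra |]. apply Rinv_le_contravar; [lra |].
rewrite <- (circ_norm I r th HI Hr) at 1. apply qnorm_sub_ge.
Qed.

Lemma kern_step I r x y th : imag_unit I -> 0 < r -> qnorm (slice_pt I x y) < r ->
  let z := slice_pt I x y in
  (kern I r z th = 1 + z * (icirc I r th * kern I r z th))%Q.
Proof.
intros HI Hr Hz z. unfold kern.
assert (N := circ_sub_neq0 I r z th HI Hr Hz).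
rewrite (qmul_assoc (icirc I r th)), icirc_circ, qmul_1l by assumption.
apply qmul_cancel_r with (circ I r th - z)%Q; [exact N |].
rewrite qmul_addl, <- !qmul_assoc, !qinv_l by exact N.
rewrite !qmul_1r, qmul_1l. generalize (circ I r th) z. qring.
Qed.

Lemma icirc_pow_comm I r th x y m :
  (slice_pt I x y * qpow (icirc I r th) m = qpow (icirc I r th) m * slice_pt I x y)%Q.
Proof. apply qpow_comm, slice_pt_comm. Qed.

(** Iterating [kern_step] under the integral sign; the remainder after N steps is
    of the order of (|z| / r)^N. *)
Lemma kern_series I r x y (phi : R -> quatN) M : imag_unit I -> 0 < r ->
  let z := slice_pt I x y in qnorm z < r ->
  (forall t, continuous phi t) -> (forall t, 0 <= t <= 2 * PI -> qnorm (phi t) <= M) ->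
  is_series (fun m => (qpow z m * qInt (fun t => qpow (icirc I r t) m * phi t))%Q : quatN)
    (qInt (fun t => kern I r z t * phi t)%Q).
Proof.
intros HI Hr z Hz Hc HM.
set (Rm := fun N => qInt (fun t => (qpow z N * qpow (icirc I r t) N) * (kern I r z t * phi t))%Q).
assert (Cp : forall N t, continuous (fun t => qpow (icirc I r t) N : quatN) t)
  by (intros N t; now apply continuous_qpow, icirc_continuous).
assert (Ck : forall t, continuous (fun t => (kern I r z t * phi t)%Q : quatN) t)
  by (intros t; apply continuous_qmul; [now apply kern_continuous | apply Hc]).
assert (Cz : forall N t, continuous (fun t => (qpow z N * qpow (icirc I r t) N)%Q : quatN) t)
  by (intros N t; exact (continuous_linear _ _ _ (linear_qmul_l _) (Cp N t))).
assert (Step : forall N, Rm N = ((qpow z N * qInt (fun t => qpow (icirc I r t) N * phi t)) + Rm (S N))%Q).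
{ intros N. unfold Rm.
  rewrite <- (qInt_linear _ _ (linear_qmul_l (qpow z N))) by (intros t; apply continuous_qmul; [apply Cp | apply Hc]).
  rewrite <- (qInt_add (fun t => (qpow z N * (qpow (icirc I r t) N * phi t))%Q)).
  - apply qInt_ext. intros t. assert (KS := kern_step I r x y t HI Hr Hz). cbv zeta in KS. fold z in KS. rewrite KS at 1.
    rewrite qmul_addl, qmul_1l, qmul_addr. f_equal; [now rewrite qmul_assoc |].
    assert (ZC : (qpow z N * qpow (icirc I r t) N * z = qpow z N * z * qpow (icirc I r t) N)%Q)
      by (rewrite <- !qmul_assoc; f_equal; symmetry; apply icirc_pow_comm).
    now rewrite !qpow_S_r, !qmul_assoc, ZC.
  - intros t. apply (continuous_linear _ _ _ (linear_qmul_l (qpow z N))).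
    apply continuous_qmul; [apply Cp | apply Hc].
  - intros t. apply continuous_qmul; [apply (Cz (S N)) | apply Ck]. }
set (u := fun m => (qpow z m * qInt (fun t => qpow (icirc I r t) m * phi t))%Q : quatN).
assert (Sum : forall N, (sum_n u N + Rm (S N))%Q = Rm 0%nat).
{ intros N. induction N as [| N IH].
  - rewrite sum_O. symmetry. apply (Step 0%nat).
  - rewrite sum_Sn, <- IH, (Step (S N)).
    change ((sum_n u N + u (S N)) + Rm (S (S N)) = sum_n u N + (u (S N) + Rm (S (S N))))%Q.
    symmetry. apply qadd_assoc. }
assert (R0 : Rm 0%nat = qInt (fun t => kern I r z t * phi t)%Q).
{ unfold Rm. apply qInt_ext. intros t. simpl. now rewrite !qmul_1l. }
rewrite <- R0.
set (t0 := qnorm z / r).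
assert (Ht0 : 0 <= t0 < 1) by (apply ratio_lt_1; split; [apply qnorm_ge0 | exact Hz]).
set (K := 2 * PI * (r / (r - qnorm z) * M)).
assert (M0 : 0 <= M).
{ eapply Rle_trans; [apply qnorm_ge0 | apply (HM 0)]. generalize PI_RGT_0; lra. }
assert (Bound : forall N, qnorm (Rm N) <= K * t0 ^ N).
{ intros N. unfold K. rewrite Rmult_assoc. apply qInt_norm.
  - intros t. apply continuous_qmul; [apply Cz | apply Ck].
  - intros t Ht. rewrite !qnorm_mul, !qnorm_pow, icirc_norm by assumption.
    rewrite <- Rpow_mult_distr. change (qnorm z * / r) with t0. rewrite Rmult_comm.
    apply Rmult_le_compat_r; [apply pow_le; lra |].
    apply Rmult_le_compat; try apply qnorm_ge0; [now apply kern_norm | now apply HM]. }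
apply (filterlim_locally_ball_norm (K := R_AbsRing) (U := quatN)). intros eps.
assert (L : is_lim_seq (fun N => K * t0 ^ S N) 0).
{ replace (Finite 0) with (Rbar_mult K 0) by (simpl; f_equal; ring).
  apply is_lim_seq_scal_l. apply (is_lim_seq_incr_1 (fun n => t0 ^ n)).
  apply is_lim_seq_geom. rewrite Rabs_pos_eq; lra. }
apply is_lim_seq_spec in L. destruct (L eps) as [N0 HN]. exists N0. intros n Hn.
specialize (HN n Hn). unfold ball_norm.
replace (minus (sum_n u n) (Rm 0%nat)) with (RtoQ (-1) * Rm (S n))%Q.
- rewrite norm_qnorm, qnorm_mul, qnorm_RtoQ, (Rabs_left (-1)) by lra. replace (- (-1)) with 1 by ring. rewrite Rmult_1_l.
  eapply Rle_lt_trans; [apply Bound |]. rewrite Rminus_0_r in HN.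
  eapply Rle_lt_trans; [apply Rle_abs | exact HN].
- rewrite <- (Sum n). change (RtoQ (-1) * Rm (S n) = sum_n u n - (sum_n u n + Rm (S n)))%Q.
  generalize (sum_n u n) (Rm (S n)). clear. intros; qring.
Qed.

(** The kernel has mean one: in its expansion against a constant only the term of
    order zero has a nonzero integral. *)
Lemma kern_mean I r x y c : imag_unit I -> 0 < r ->
  let z := slice_pt I x y in qnorm z < r ->
  qInt (fun t => kern I r z t * c)%Q = (RtoQ (2 * PI) * c)%Q.
Proof.
intros HI Hr z Hz.
assert (S := kern_series I r x y (fun _ => c) (qnorm c) HI Hr Hz
  (fun t => continuous_const c t) (fun _ _ => Rle_refl _)). fold z in S.
apply (is_series_uniq _ _ _ S).
set (u := fun m => (qpow z m * qInt (fun t => qpow (icirc I r t) m * c))%Q : quatN) in *.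
replace (RtoQ (2 * PI) * c)%Q with (sum_n u 0).
- apply is_series_fin. intros [| k] Hk; [lia |]. unfold u.
  rewrite (qInt_linear (fun q => (q * c)%Q) (fun t => qpow (icirc I r t) (Datatypes.S k)) (linear_qmul_r c)).
  + rewrite qInt_icirc_pow by assumption. now rewrite qmul_0l, qmul_0r.
  + intros t. now apply continuous_qpow, icirc_continuous.
- rewrite sum_O. unfold u. simpl qpow. rewrite qmul_1l, <- qInt_cst. apply qInt_ext.
  intros t. apply qmul_1l.
Qed.

Definition segment (a b t : R) : R := a + t * (b - a).

(** The margin beyond the end points of the segment leaves room to differentiate in
    [t] at them. *)
Lemma segment_norm I r x0 y0 t t' th : imag_unit I -> 0 < r < 1 ->
  qnorm (slice_pt I x0 y0) < r -> 0 <= t <= 1 -> Rabs (t' - t) < (1 - r) / 4 ->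
  in_ball (slice_pt I (segment x0 (r * cos th) t') (segment y0 (r * sin th) t')).
Proof.
intros HI Hr Hz Ht Ht'.
replace (slice_pt I (segment x0 (r * cos th) t') (segment y0 (r * sin th) t'))
  with (RtoQ (1 - t') * slice_pt I x0 y0 + RtoQ t' * circ I r th)%Q
  by (unfold segment, circ, slice_pt; qring).
unfold in_ball. eapply Rle_lt_trans; [apply qnorm_triangle |].
rewrite !qnorm_mul, !qnorm_RtoQ, circ_norm by (try exact HI; lra).
assert (A := Rabs_pos (1 - t')).
apply Rle_lt_trans with (Rabs (1 - t') * r + Rabs t' * r).
{ apply Rplus_le_compat_r, Rmult_le_compat_l; [exact A | lra]. }
assert (B : Rabs (1 - t') + Rabs t' <= 1 + (1 - r) / 2).
{ unfold Rabs in *. destruct (Rcase_abs (1 - t')), (Rcase_abs t'), (Rcase_abs (t' - t)); lra. }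
rewrite <- Rmult_plus_distr_r.
apply Rle_lt_trans with ((1 + (1 - r) / 2) * r); [apply Rmult_le_compat_r; lra | nra].
Qed.

Lemma segment_continuous r x0 y0 t th :
  continuous (fun p : R * R => (segment x0 (r * cos (snd p)) (fst p),
    segment y0 (r * sin (snd p)) (fst p))) (t, th).
Proof.
assert (P : forall g : R -> R, (forall u, ex_derive g u) -> forall c,
  continuous (fun p : R * R => segment c (r * g (snd p)) (fst p)) (t, th)).
{ intros g Hg c. apply (continuous_plus (V := R_NormedModule)); [apply continuous_const |].
  apply (continuous_mult (K := R_AbsRing)); [apply continuous_fst |].
  apply (continuous_minus (V := R_NormedModule)); [| apply continuous_const].
  apply (continuous_mult (K := R_AbsRing)); [apply continuous_const |].
  apply (continuous_comp (snd : R * R -> R) g); [apply continuous_snd |].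
  apply (ex_derive_continuous (V := R_NormedModule)), Hg. }
assert (Px := P cos (fun u => ltac:(auto_derive; exact Logic.I)) x0).
assert (Py := P sin (fun u => ltac:(auto_derive; exact Logic.I)) y0).
apply filterlim_locally. intros eps.
refine (filter_imp _ _ _ (filter_and _ _ (proj1 (filterlim_locally _ _) Px eps)
  (proj1 (filterlim_locally _ _) Py eps))).
intros p [A B]. split; assumption.
Qed.

(** The integral of the Cauchy kernel against the values of [f] on the circle
    shrunk towards [z] with ratio [t] does not depend on [t]: its derivative in [t]
    is the integral over the circle of a derivative in the angle. Comparing [t = 1]
    with [t = 0] replaces the values on the circle by the value at the centre. *)
Lemma cauchy_invariance f I r x0 y0 : slice_regular f -> imag_unit I -> 0 < r < 1 ->
  let z := slice_pt I x0 y0 in qnorm z < r ->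
  qInt (fun th => kern I r z th * f (circ I r th))%Q = qInt (fun th => kern I r z th * f z)%Q.
Proof.
intros Hf HI Hr z Hz.
set (X := fun t th : R => segment x0 (r * cos th) t).
set (Y := fun t th : R => segment y0 (r * sin th) t).
assert (Near : forall t t' th, 0 <= t <= 1 -> Rabs (t' - t) < (1 - r) / 4 ->
  in_ball (slice_pt I (X t' th) (Y t' th))) by (intros t t' th; now apply segment_norm).
assert (In : forall t th, 0 <= t <= 1 -> in_ball (slice_pt I (X t th) (Y t th))).
{ intros t th Ht. apply Near with t; [exact Ht |]. rewrite Rminus_diag, Rabs_R0. lra. }
destruct (slice_chain f I Hf HI) as (f1 & C1 & C0 & D).
set (d := (1 - r) / 4). assert (Hd : 0 < d) by (unfold d; lra).
set (F := fun t th => f (slice_pt I (X t th) (Y t th))).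
(* the derivative of the integrand in t; the kernel cancels the inner derivative *)
assert (Dt : forall t th, in_ball (slice_pt I (X t th) (Y t th)) ->
  is_derive (fun s => (kern I r z th * F s th)%Q : quatN) t
    (circ I r th * f1 (X t th, Y t th))%Q).
{ intros t th Hb.
  assert (DX : is_derive (fun s => X s th) t (r * cos th - x0))
    by (unfold X, segment; auto_derive; [exact Logic.I | ring]).
  assert (DY : is_derive (fun s => Y s th) t (r * sin th - y0))
    by (unfold Y, segment; auto_derive; [exact Logic.I | ring]).
  assert (K := is_derive_linear _ _ _ _ (linear_qmul_l (kern I r z th)) (D _ _ t _ _ DX DY Hb)).
  eapply is_derive_eq; [exact K |]. cbv beta.
  replace (slice_pt I (r * cos th - x0) (r * sin th - y0)) with (circ I r th - z)%Q
    by (unfold circ, z, slice_pt; qring).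
  rewrite qmul_assoc. unfold kern. f_equal.
  rewrite <- qmul_assoc, qinv_l; [apply qmul_1r |]. apply circ_sub_neq0; try assumption; lra. }
assert (Cf1 : forall t th, in_ball (slice_pt I (X t th) (Y t th)) ->
  continuous (fun p : R * R => f1 (X (fst p) (snd p), Y (fst p) (snd p))) (t, th)).
{ intros t th Hb.
  apply (continuous_comp (fun p : R * R => (X (fst p) (snd p), Y (fst p) (snd p))) f1);
  [apply segment_continuous | apply C1, Hb]. }
assert (CF : forall t th, in_ball (slice_pt I (X t th) (Y t th)) ->
  continuous (fun s => F t s : quatN) th).
{ intros t th Hb.
  assert (K : continuous (fun p : R * R => F (fst p) (snd p) : quatN) (t, th)).
  { apply (continuous_comp (fun p : R * R => (X (fst p) (snd p), Y (fst p) (snd p)))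
      (fun p : R * R => f (slice_pt I (fst p) (snd p)) : quatN));
    [apply segment_continuous | apply C0, Hb]. }
  apply (continuous_comp_2 (fun _ => t) (fun s => s) (fun a b => F a b : quatN));
  [apply continuous_const | apply continuous_id | exact K]. }
assert (Ck : forall t th, in_ball (slice_pt I (X t th) (Y t th)) ->
  continuous (fun s => (kern I r z s * F t s)%Q : quatN) th).
{ intros t th Hb. apply continuous_qmul; [apply kern_continuous; try assumption; lra | now apply CF]. }
assert (Cc : forall t th, in_ball (slice_pt I (X t th) (Y t th)) ->
  continuous (fun p : R * R => (circ I r (snd p) * f1 (X (fst p) (snd p), Y (fst p) (snd p)))%Q : quatN) (t, th)).
{ intros t th Hb. apply continuous_qmul; [| now apply Cf1].
  apply (continuous_comp (snd : R * R -> R) (fun s => circ I r s : quatN)); [apply continuous_snd |].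
  now apply circ_continuous. }
assert (Cc1 : forall t th, in_ball (slice_pt I (X t th) (Y t th)) ->
  continuous (fun s => (circ I r s * f1 (X t s, Y t s))%Q : quatN) th).
{ intros t th Hb.
  apply (continuous_comp_2 (fun _ => t) (fun s => s)
    (fun a b => (circ I r b * f1 (X a b, Y a b))%Q : quatN));
  [apply continuous_const | apply continuous_id | exact (Cc t th Hb)]. }
(* the integral of that derivative vanishes, being that of a derivative in th *)
assert (Zero : forall t, 0 < t < 1 -> qInt (fun s => circ I r s * f1 (X t s, Y t s))%Q = 0%Q).
{ intros t Ht.
  assert (Bt : forall th, in_ball (slice_pt I (X t th) (Y t th))) by (intros; apply In; lra).
  assert (DF : forall th, is_derive (fun s => F t s : quatN) th
    (RtoQ t * I * (circ I r th * f1 (X t th, Y t th)))%Q).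
  { intros th.
    assert (DX : is_derive (fun s => X t s) th (t * (r * - sin th)))
      by (unfold X, segment; auto_derive; [exact Logic.I | ring]).
    assert (DY : is_derive (fun s => Y t s) th (t * (r * cos th)))
      by (unfold Y, segment; auto_derive; [exact Logic.I | ring]).
    eapply is_derive_eq; [exact (D _ _ th _ _ DX DY (Bt th)) |].
    rewrite qmul_assoc. f_equal. unfold circ, slice_pt. rewrite qmul_addr.
    replace (RtoQ t * I * (RtoQ (r * sin th) * I))%Q with (RtoQ (t * (r * sin th)) * (I * I))%Q by qring.
    rewrite HI. generalize (cos th) (sin th). intros; qring. }
  assert (K := qInt_derive _ _ DF
    (fun th => continuous_linear _ _ _ (linear_qmul_l (RtoQ t * I)%Q) (Cc1 t th (Bt th)))).
  assert (K1 := qInt_linear _ _ (linear_qmul_l (RtoQ t * I)%Q) (fun th => Cc1 t th (Bt th))).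
  assert (K2 := eq_trans (eq_sym K1) K). cbv beta in K2. clear K K1. rename K2 into K.
  unfold F, X, Y, segment in K. rewrite cos_2PI, sin_2PI, cos_0, sin_0, qsub_diag in K.
  apply qmul_eq0 in K. destruct K as [K | K]; [exfalso | exact K].
  apply qmul_eq0 in K. destruct K as [K | K].
  - apply (f_equal Q0) in K. change (t = 0) in K. lra.
  - exact (imag_unit_neq0 I HI K). }
assert (Main : forall T : quatN -> R, is_linear (T : quatN -> R_NormedModule) ->
  RInt (fun th => T (kern I r z th * F 1%R th)%Q) 0 (2 * PI) =
  RInt (fun th => T (kern I r z th * F 0%R th)%Q) 0 (2 * PI)).
{ intros T HT.
  set (G := fun t => RInt (fun th => T (kern I r z th * F t th)%Q) 0 (2 * PI)).
  change (G 1 = G 0).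
  assert (DT : forall t th, in_ball (slice_pt I (X t th) (Y t th)) ->
    is_derive (fun s => T (kern I r z th * F s th)%Q) t (T (circ I r th * f1 (X t th, Y t th))%Q))
    by (intros t th Hb; exact (is_derive_linear _ _ _ _ HT (Dt t th Hb))).
  assert (DG : forall t, 0 <= t <= 1 ->
    is_derive G t (RInt (fun th => T (circ I r th * f1 (X t th, Y t th))%Q) 0 (2 * PI))).
  { intros t Ht. unfold G.
    assert (Loc : forall P : R -> Prop, (forall t', Rabs (t' - t) < d -> P t') -> locally t P).
    { intros P HP. exists (mkposreal d Hd). intros t' Ht'. apply HP. exact Ht'. }
    eapply is_derive_eq.
    - apply (is_derive_RInt_param (fun t th => T (kern I r z th * F t th)%Q)).
      + apply Loc. intros t' Ht' th _. eexists. apply DT. now apply Near with t.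
      + intros th _. apply continuity_2d_pt_ext_loc with (fun u v => T (circ I r v * f1 (X u v, Y u v))%Q).
        * exists (mkposreal d Hd). intros u v Hu _. symmetry. apply is_derive_unique, DT.
          now apply Near with t.
        * apply continuity_2d_pt_filterlim.
          exact (continuous_linear _ _ _ HT (Cc t th (In t th Ht))).
      + apply Loc. intros t' Ht'. apply (ex_RInt_continuous (V := R_CompleteNormedModule)).
        intros th _. apply (continuous_linear _ _ _ HT (Ck t' th (Near t t' th Ht Ht'))).
    - apply RInt_ext. intros th _. apply is_derive_unique, DT, In, Ht. }
  destruct (MVT_gen G 0 1 (fun _ => 0)) as (c & _ & E).
  - rewrite Rmin_left, Rmax_right by lra. intros t Ht.
    eapply is_derive_eq; [apply DG; lra |].
    assert (K := f_equal T (Zero t Ht)).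
    transitivity (T 0%Q); [| exact (linear_zero T HT)]. rewrite <- K.
    apply (is_RInt_unique (V := R_CompleteNormedModule)).
    apply (is_RInt_linear T _ _ _ _ HT), qInt_correct. intros th. apply Cc1, In. lra.
  - rewrite Rmin_left, Rmax_right by lra. intros t Ht.
    apply continuity_pt_filterlim. apply (ex_derive_continuous (V := R_NormedModule)).
    eexists. now apply DG.
  - lra. }
assert (E1 : forall th, F 1 th = f (circ I r th))
  by (intros th; unfold F, X, Y, segment, circ; f_equal; f_equal; ring).
assert (E0 : forall th, F 0 th = f z)
  by (intros th; unfold F, X, Y, segment, z; f_equal; f_equal; ring).
transitivity (qInt (fun th => kern I r z th * F 1%R th)%Q);
  [apply qInt_ext; intros th; now rewrite E1 |].
transitivity (qInt (fun th => kern I r z th * F 0%R th)%Q);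
  [| apply qInt_ext; intros th; now rewrite E0].
by_coord quat_ext Main.
Qed.

Lemma circle_continuous f I r : slice_regular f -> imag_unit I -> 0 < r < 1 ->
  forall th, continuous (fun t => f (circ I r t) : quatN) th.
Proof.
intros Hf HI Hr th. destruct (slice_chain f I Hf HI) as (f1 & _ & C0 & _).
assert (B : in_ball (circ I r th)) by (unfold in_ball; rewrite circ_norm; try exact HI; lra).
apply (continuous_comp_2 (fun t => r * cos t) (fun t => r * sin t) (fun a b => f (slice_pt I a b) : quatN)).
- apply (ex_derive_continuous (V := R_NormedModule)). auto_derive. exact Logic.I.
- apply (ex_derive_continuous (V := R_NormedModule)). auto_derive. exact Logic.I.
- exact (C0 _ _ B).
Qed.

Lemma circle_bounded f I r : slice_regular f -> imag_unit I -> 0 < r < 1 ->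
  exists M, forall th, 0 <= th <= 2 * PI -> qnorm (f (circ I r th)) <= M.
Proof.
intros Hf HI Hr.
assert (C := circle_continuous f I r Hf HI Hr).
assert (K : forall T : quatN -> R, is_linear (T : quatN -> R_NormedModule) ->
  exists M, forall th, 0 <= th <= 2 * PI -> Rabs (T (f (circ I r th))) <= M).
{ intros T HT.
  destruct (continuity_ab_maj (fun th => Rabs (T (f (circ I r th)))) 0 (2 * PI)) as (m & Hm & _).
  - generalize PI_RGT_0; lra.
  - intros c _. apply continuity_pt_filterlim.
    apply (continuous_comp (fun th => T (f (circ I r th))) Rabs).
    + exact (continuous_linear _ _ _ HT (C c)).
    + apply continuous_Rabs.
  - exists (Rabs (T (f (circ I r m)))). exact Hm. }
destruct (K (fun q => Q0 q) linear_Q0) as [M0 H0].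
destruct (K (fun q => Q1 q) linear_Q1) as [M1 H1].
destruct (K (fun q => Q2 q) linear_Q2) as [M2 H2].
destruct (K (fun q => Q3 q) linear_Q3) as [M3 H3].
exists (M0 + M1 + M2 + M3). intros s Hs.
eapply Rle_trans; [apply qnorm_le_comp |].
specialize (H0 s Hs). specialize (H1 s Hs). specialize (H2 s Hs). specialize (H3 s Hs).
simpl in *. lra.
Qed.

Definition cauchy_coef (f : quat -> quat) (I : quat) (r : R) (m : nat) : quat :=
  (RtoQ (/ (2 * PI)) * qInt (fun t => qpow (icirc I r t) m * f (circ I r t)))%Q.

Lemma cauchy_coef_bound f I r m M : slice_regular f -> imag_unit I -> 0 < r < 1 ->
  (forall th, 0 <= th <= 2 * PI -> qnorm (f (circ I r th)) <= M) -> qnorm (cauchy_coef f I r m) * r ^ m <= M.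
Proof.
intros Hf HI Hr HM. unfold cauchy_coef.
assert (HPI := PI_RGT_0).
assert (P := pow_lt r m ltac:(lra)).
assert (B := qInt_norm (fun t => qpow (icirc I r t) m * f (circ I r t))%Q (/ r ^ m * M)).
rewrite qnorm_mul, qnorm_RtoQ, Rabs_pos_eq by (left; apply Rinv_0_lt_compat; lra).
assert (B' : qnorm (qInt (fun t => qpow (icirc I r t) m * f (circ I r t))%Q) <= 2 * PI * (/ r ^ m * M)).
{ apply B.
  - intros t. apply continuous_qmul; [apply continuous_qpow, icirc_continuous; try exact HI; lra |].
    now apply circle_continuous.
  - intros t Ht. rewrite qnorm_mul, qnorm_pow, icirc_norm, pow_inv by (try exact HI; lra).
    apply Rmult_le_compat_l; [left; now apply Rinv_0_lt_compat | now apply HM]. }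
apply Rle_trans with (/ (2 * PI) * (2 * PI * (/ r ^ m * M)) * r ^ m).
- apply Rmult_le_compat_r; [lra |]. apply Rmult_le_compat_l; [left; apply Rinv_0_lt_compat; lra | exact B'].
- right. field. lra.
Qed.

Lemma cauchy_series f I r x y : slice_regular f -> imag_unit I -> 0 < r < 1 ->
  let z := slice_pt I x y in qnorm z < r ->
  is_series (fun m => (qpow z m * cauchy_coef f I r m)%Q : quatN) (f z).
Proof.
intros Hf HI Hr z Hz.
destruct (circle_bounded f I r Hf HI Hr) as [M HM].
assert (S := kern_series I r x y (fun t => f (circ I r t)) M HI (proj1 Hr) Hz
  (circle_continuous f I r Hf HI Hr) HM).
assert (E : qInt (fun t => kern I r z t * f (circ I r t))%Q = (RtoQ (2 * PI) * f z)%Q)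
  by exact (eq_trans (cauchy_invariance f I r x y Hf HI Hr Hz) (kern_mean I r x y (f z) HI (proj1 Hr) Hz)).
assert (S' : is_series (fun m => (qpow z m * qInt (fun t => qpow (icirc I r t) m * f (circ I r t)))%Q : quatN)
  (RtoQ (2 * PI) * f z)%Q) by (rewrite <- E; exact S).
clear S. rename S' into S.
apply (is_series_linear _ _ _ (linear_qmul_l (RtoQ (/ (2 * PI))))) in S.
rewrite qmul_assoc, <- RtoQ_mul, Rinv_l, qmul_1l in S by (generalize PI_RGT_0; lra).
eapply is_series_ext; [| exact S]. intros m. simpl. unfold cauchy_coef.
rewrite !qmul_assoc. fold z. now rewrite (RtoQ_comm _ (qpow z m)).
Qed.

(** The Cauchy coefficients do not depend on slice and radius: all slices share the
    real axis, which determines the coefficients. *)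
Theorem slice_regular_regular f : slice_regular f -> regular f.
Proof.
intros Hf.
assert (HI : imag_unit qi) by (unfold imag_unit, qi; qring).
exists (cauchy_coef f qi (/ 2)). intros q Hq.
destruct (slice_pt_ex q) as (J & x & y & HJ & ->).
set (r := (1 + qnorm (slice_pt J x y)) / 2).
assert (N := qnorm_ge0 (slice_pt J x y)).
assert (Hr : 0 < r < 1 /\ qnorm (slice_pt J x y) < r) by (unfold in_ball in Hq; unfold r; lra).
rewrite (coef_unique (fun x => f (RtoQ x)) (cauchy_coef f qi (/ 2)) (cauchy_coef f J r) (Rmin (/ 2) r)).
- apply cauchy_series; try assumption; apply Hr.
- apply Rmin_pos; lra.
- intros t Ht. assert (Ht1 := Rlt_le_trans _ _ _ Ht (Rmin_l _ _)).
  replace (RtoQ t) with (slice_pt qi t 0) by (unfold slice_pt; qring).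
  apply cauchy_series; try assumption; [lra |].
  replace (slice_pt qi t 0) with (RtoQ t) by (unfold slice_pt; qring). now rewrite qnorm_RtoQ.
- intros t Ht. assert (Ht1 := Rlt_le_trans _ _ _ Ht (Rmin_r _ _)).
  replace (RtoQ t) with (slice_pt J t 0) by (unfold slice_pt; qring).
  apply cauchy_series; try assumption; [lra |].
  replace (slice_pt J t 0) with (RtoQ t) by (unfold slice_pt; qring). now rewrite qnorm_RtoQ.
Qed.

(** The Cauchy estimate needs a bound on one slice only. *)
Lemma cauchy_estimate f a I r M m : has_qpseries f a -> imag_unit I -> 0 < r < 1 ->
  (forall x y, qnorm (slice_pt I x y) = r -> qnorm (f (slice_pt I x y)) <= M) ->
  qnorm (a m) * r ^ m <= M.
Proof.
intros Ha HI Hr HM.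
assert (Hf : slice_regular f) by (apply regular_slice_regular; now exists a).
replace a with (cauchy_coef f I r).
- apply cauchy_coef_bound; try assumption. intros th _. apply HM.
  exact (circ_norm I r th HI (proj1 Hr)).
- apply (coef_unique (fun x => f (RtoQ x)) _ _ r); [lra | |].
  + intros t Ht. replace (RtoQ t) with (slice_pt I t 0) by (unfold slice_pt; qring).
    apply cauchy_series; try assumption.
    replace (slice_pt I t 0) with (RtoQ t) by (unfold slice_pt; qring). now rewrite qnorm_RtoQ.
  + intros t Ht. apply Ha, in_ball_RtoQ. lra.
Qed.

(** * The maximum principle *)

(** Constant factors disappear when n-th roots are taken. *)
Lemma pow_le_all x y K : 0 <= y -> (forall n, x ^ n <= K * y ^ n) -> x <= y.
Proof.
intros Hy H. destruct (Rle_lt_dec x y) as [L | L]; [exact L | exfalso].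
destruct Hy as [Hy | Hy].
- set (h := x / y - 1).
  assert (Hh : 0 < h).
  { unfold h. apply Rmult_lt_reg_r with y; [exact Hy |]. field_simplify; lra. }
  destruct (INR_unbounded (K / h)) as [n Hn].
  assert (P := poly n h Hh). specialize (H n).
  replace x with ((1 + h) * y) in H by (unfold h; field; lra).
  rewrite Rpow_mult_distr in H. apply Rmult_le_reg_r in H; [| now apply pow_lt].
  apply Rmult_gt_compat_r with (r := h) in Hn; [| exact Hh].
  replace (K / h * h) with K in Hn by (field; lra). lra.
- specialize (H 1%nat). rewrite <- Hy, !pow_1 in H. lra.
Qed.

(** The orthogonal projection of the quaternions onto C_I. *)
Definition slice_proj (I p : quat) : quat := (RtoQ (1 / 2) * (p - I * p * I))%Q.

Lemma linear_slice_proj I : is_linear (fun p : quatN => slice_proj I p : quatN).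
Proof.
apply linear_of_bound with (1 / 2 * (1 + qnorm I * qnorm I)).
- intros x y. unfold slice_proj.
  change (RtoQ (1/2) * ((x + y) - I * (x + y) * I) = RtoQ (1/2) * (x - I * x * I) + RtoQ (1/2) * (y - I * y * I))%Q.
  rewrite !qmul_addr, !qmul_addl. generalize (I * x * I)%Q (I * y * I)%Q. qring.
- intros k x. rewrite !scal_RtoQ. unfold slice_proj.
  replace (I * (RtoQ k * x) * I)%Q with (RtoQ k * (I * x * I))%Q
    by (rewrite !qmul_assoc; now rewrite (RtoQ_comm k I)).
  generalize (I * x * I)%Q. qring.
- intros x. rewrite !norm_qnorm. unfold slice_proj.
  rewrite qnorm_mul, qnorm_RtoQ, Rabs_pos_eq by lra.
  rewrite Rmult_assoc. apply Rmult_le_compat_l; [lra |].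
  eapply Rle_trans; [apply qnorm_sub_le |]. rewrite !qnorm_mul. lra.
Qed.

Lemma slice_proj_norm I p : imag_unit I -> qnorm (slice_proj I p) <= qnorm p.
Proof.
intros HI. unfold slice_proj. rewrite qnorm_mul, qnorm_RtoQ, Rabs_pos_eq by lra.
assert (N : qnorm I = 1).
{ assert (K := f_equal qnorm HI). rewrite qnorm_mul, qnorm_RtoQ in K.
  rewrite (Rabs_left (-1)) in K by lra. assert (P := qnorm_ge0 I). nra. }
assert (K := qnorm_sub_le p (I * p * I)%Q). rewrite !qnorm_mul, N in K. lra.
Qed.

Lemma comm_slice_pt I x y w : (I * w = w * I)%Q -> (slice_pt I x y * w = w * slice_pt I x y)%Q.
Proof.
intros H. unfold slice_pt. rewrite qmul_addl, qmul_addr, (RtoQ_comm x w). f_equal.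
now rewrite <- qmul_assoc, H, !qmul_assoc, RtoQ_comm.
Qed.

Lemma slice_proj_comm I p : imag_unit I -> (I * slice_proj I p = slice_proj I p * I)%Q.
Proof.
intros HI.
assert (mv : forall c u, (I * (RtoQ c * u) = RtoQ c * (I * u))%Q)
  by (intros c u; now rewrite !qmul_assoc, RtoQ_comm).
unfold slice_proj. rewrite mv, <- (qmul_assoc (RtoQ (1 / 2))). f_equal.
rewrite qmul_subr, qmul_subl.
replace (I * (I * p * I))%Q with (RtoQ (-1) * (p * I))%Q
  by (rewrite <- (imag_unit_mul I _ HI); now rewrite !qmul_assoc).
replace (I * p * I * I)%Q with (RtoQ (-1) * (I * p))%Q
  by (rewrite <- (qmul_assoc (I * p)%Q I I), HI; apply RtoQ_comm).
generalize (I * p)%Q (p * I)%Q. qring.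
Qed.

Lemma slice_proj_mul I x y p : (slice_proj I (slice_pt I x y * p) = slice_pt I x y * slice_proj I p)%Q.
Proof.
assert (C : (slice_pt I x y * I = I * slice_pt I x y)%Q) by (unfold slice_pt; qring).
unfold slice_proj. rewrite (qmul_assoc (slice_pt I x y)), <- (RtoQ_comm _ (slice_pt I x y)), <- (qmul_assoc (RtoQ (1 / 2))).
f_equal. rewrite qmul_subr. f_equal. now rewrite !qmul_assoc, C.
Qed.

Lemma slice_proj_RtoQ I x : imag_unit I -> slice_proj I (RtoQ x) = RtoQ x.
Proof.
intros HI. unfold slice_proj. rewrite <- (RtoQ_comm x I), <- qmul_assoc, HI.
apply quat_ext; qcoord; field.
Qed.

Lemma qpow_slice_proj_mul I x y m p :
  (slice_proj I (qpow (slice_pt I x y) m * p) = qpow (slice_pt I x y) m * slice_proj I p)%Q.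
Proof.
induction m as [| m IH]; simpl; [now rewrite !qmul_1l |].
now rewrite <- !qmul_assoc, slice_proj_mul, IH.
Qed.

Fixpoint star_pow (f : quat -> quat) (n : nat) : quat -> quat :=
  match n with O => cst 1%Q | S k => star f (star_pow f k) end.

Lemma regular_star_pow f n : regular f -> regular (star_pow f n).
Proof.
intros H. induction n as [| n IH]; [apply regular_cst | now apply regular_star].
Qed.

(** The tensor power trick. Let c = f(q). On the slice C_I through [q] the projection to
    C_I of f c^- is complex valued, so that its star powers are plain powers there, and
    at [q] it has the value |c|^2. The Cauchy estimates bound its n-th power at [q] up
    to a factor that does not depend on n. *)
Theorem max_modulus f r M : regular f -> 0 < r < 1 ->
  (forall q, qnorm q = r -> qnorm (f q) <= M) ->
  forall q, qnorm q < r -> qnorm (f q) <= M.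
Proof.
intros [a Ha] Hr HM q Hq.
assert (M0 : 0 <= M).
{ eapply Rle_trans; [apply qnorm_ge0 |]. apply (HM (RtoQ r)). rewrite qnorm_RtoQ. apply Rabs_pos_eq; lra. }
destruct (excluded_middle_informative (f q = 0%Q)) as [E | E]; [rewrite E, qnorm_0; exact M0 |].
assert (Hc := qnorm_pos _ E).
destruct (slice_pt_ex q) as (I & x & y & HI & Eq). set (c := f q) in *.
set (al := fun m => slice_proj I (a m * qconj c)).
assert (Ca : conv al).
{ apply conv_bound with a (qnorm c).
  - intros m. unfold al. eapply Rle_trans; [now apply slice_proj_norm |].
    rewrite qnorm_mul, qnorm_conj. lra.
  - apply qnorm_ge0.
  - exact (has_qpseries_conv _ _ Ha). }
set (G := qpseries al). assert (HG := has_qpseries_qpseries al Ca). fold G in HG.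
assert (RG : regular G) by now exists al.
assert (GE : forall x y, in_ball (slice_pt I x y) ->
  G (slice_pt I x y) = slice_proj I (f (slice_pt I x y) * qconj c)%Q).
{ intros x' y' Hb. apply (is_series_uniq _ _ _ (HG _ Hb)).
  assert (S := is_series_linear _ _ _ (linear_slice_proj I)
    (is_series_linear _ _ _ (linear_qmul_r (qconj c)) (Ha _ Hb))).
  eapply is_series_ext; [| exact S]. intros m. simpl. unfold al.
  now rewrite <- qmul_assoc, qpow_slice_proj_mul. }
assert (PE : forall n x y, in_ball (slice_pt I x y) ->
  star_pow G n (slice_pt I x y) = qpow (G (slice_pt I x y)) n).
{ intros n x' y' Hb. induction n as [| n IH]; [reflexivity |]. simpl.
  rewrite (star_at G (star_pow G n) _ (slice_pt I x' y')); try assumption.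
  - now rewrite IH.
  - now apply regular_star_pow.
  - apply comm_slice_pt. rewrite GE by exact Hb. now apply slice_proj_comm. }
assert (Hqb : in_ball (slice_pt I x y)) by (rewrite <- Eq; unfold in_ball; lra).
assert (Gq : G q = RtoQ (qnorm c ^ 2)).
{ rewrite Eq, GE, <- Eq by exact Hqb. fold c. rewrite qmul_conj_r. now apply slice_proj_RtoQ. }
set (t := qnorm q / r).
assert (Ht : 0 <= t < 1) by (apply ratio_lt_1; split; [apply qnorm_ge0 | exact Hq]).
assert (K : qnorm c ^ 2 <= M * qnorm c).
{ apply pow_le_all with (/ (1 - t)); [nra |]. intros n.
  destruct (regular_star_pow G n RG) as [b Hb].
  assert (CE : forall m, qnorm (b m) * r ^ m <= (M * qnorm c) ^ n).
  { intros m. apply (cauchy_estimate (star_pow G n) b I); try assumption.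
    intros x' y' Hxy. rewrite PE, qnorm_pow, GE by (unfold in_ball; lra).
    apply pow_incr. split; [apply qnorm_ge0 |].
    eapply Rle_trans; [now apply slice_proj_norm |]. rewrite qnorm_mul, qnorm_conj.
    apply Rmult_le_compat_r; [lra | now apply HM]. }
  assert (S := Hb _ Hqb). rewrite PE, <- Eq, Gq in S by exact Hqb.
  assert (Geo := is_series_scal_l (V := R_NormedModule) ((M * qnorm c) ^ n) _ _
    (is_series_geom t ltac:(rewrite Rabs_pos_eq; lra))).
  assert (B : forall m, qnorm (qpow q m * b m)%Q <= scal ((M * qnorm c) ^ n) (t ^ m)).
  { intros m. rewrite qnorm_mul, qnorm_pow.
    change (scal ((M * qnorm c) ^ n) (t ^ m)) with ((M * qnorm c) ^ n * t ^ m).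
    replace (qnorm q ^ m) with (r ^ m * t ^ m)
      by (unfold t; rewrite <- Rpow_mult_distr; f_equal; field; lra).
    replace (r ^ m * t ^ m * qnorm (b m)) with (qnorm (b m) * r ^ m * t ^ m) by ring.
    apply Rmult_le_compat_r; [apply pow_le; lra | apply CE]. }
  assert (N := is_series_norm_le _ _ _ _ B S Geo).
  rewrite qnorm_pow, qnorm_RtoQ, Rabs_pos_eq in N by nra.
  eapply Rle_trans; [exact N |]. right.
  change ((M * qnorm c) ^ n * / (1 - t) = / (1 - t) * (M * qnorm c) ^ n). ring. }
change (qnorm c <= M). nra.
Qed.

Lemma max_boundary f M : regular f ->
  (forall e, 0 < e -> exists r, r < 1 /\ forall q, in_ball q -> r < qnorm q -> qnorm (f q) <= M + e) ->
  forall q, in_ball q -> qnorm (f q) <= M.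
Proof.
intros Hf H q Hq. apply Rle_plus_epsilon. intros e He.
destruct (H e He) as (r & Hr & Hb).
assert (N := qnorm_ge0 q). unfold in_ball in Hq.
set (s := Rmax r (qnorm q)).
assert (S1 := Rmax_l r (qnorm q)). assert (S2 := Rmax_r r (qnorm q)). fold s in S1, S2.
assert (S3 : s < 1) by (unfold s; apply Rmax_lub_lt; lra).
apply (max_modulus f ((1 + s) / 2)); try assumption; try lra.
intros q' Hq'. apply Hb; unfold in_ball; lra.
Qed.

Lemma star_bound f g M N q : regular f -> regular g -> in_ball q -> 0 <= N ->
  qnorm (f q) <= M -> (forall s, same_sphere s q -> qnorm (g s) <= N) ->
  qnorm (star f g q) <= M * N.
Proof.
intros Hf Hg Hq HN HM HNg.
assert (M0 : 0 <= M) by (eapply Rle_trans; [apply qnorm_ge0 | exact HM]).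
destruct (excluded_middle_informative (f q = 0%Q)) as [E | E].
- rewrite star_zero by assumption. rewrite qnorm_0. now apply Rmult_le_pos.
- destruct (star_eval f g q Hf Hg Hq E) as (s & Hs & ->). rewrite qnorm_mul.
  apply Rmult_le_compat; try apply qnorm_ge0; [exact HM | now apply HNg].
Qed.

Lemma sum_n_ends (u : nat -> quatN) n : (forall k, (0 < k <= n)%nat -> u k = 0%Q) ->
  sum_n u (S n) = (u 0%nat + u (S n))%Q.
Proof.
intros H. rewrite sum_Sn.
replace (sum_n u n) with (u 0%nat); [reflexivity |].
induction n as [| n IH]; [now rewrite sum_O |].
rewrite sum_Sn, <- IH, (H (S n)) by (try lia; intros; apply H; lia).
symmetry. apply (plus_zero_r (G := quatN)).
Qed.

(** Equality at the origin. After right multiplication by the conjugate of f(0) one has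
    1 + q^m b + ..., whose n-th star power is 1 + q^m n b + ...; all these powers are
    bounded by one, hence so is n b up to a factor independent of n, and b = 0. *)
Lemma max_const f : regular f -> (forall q, in_ball q -> qnorm (f q) <= 1) ->
  qnorm (f 0%Q) = 1 -> forall q, in_ball q -> f q = f 0%Q.
Proof.
intros [a Ha] H1 H0.
assert (B0 := in_ball_0).
assert (A0 : f 0%Q = a 0%nat).
{ apply (is_series_uniq _ _ _ (Ha _ B0)).
  assert (F := is_series_fin (fun m => (qpow 0 m * a m)%Q) 0).
  rewrite sum_O in F. simpl in F. rewrite qmul_1l in F. apply F.
  intros [| k] Hk; [lia |]. simpl. now rewrite !qmul_0l. }
rewrite A0 in *. set (c := a 0%nat) in *.
assert (Cc : (c * qconj c = 1)%Q) by (rewrite qmul_conj_r, H0; f_equal; ring).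
set (g := fun q => (f q * qconj c)%Q). set (b := fun m => (a m * qconj c)%Q).
assert (Hg : has_qpseries g b).
{ intros q Hq. unfold g, b. eapply is_series_ext; [| exact (is_series_linear _ _ _ (linear_qmul_r (qconj c)) (Ha q Hq))].
  intros n. simpl. symmetry. apply qmul_assoc. }
assert (Rg : regular g) by now exists b.
assert (Hg1 : forall q, in_ball q -> qnorm (g q) <= 1).
{ intros q Hq. unfold g. rewrite qnorm_mul, qnorm_conj, H0, Rmult_1_r. now apply H1. }
assert (Hp1 : forall n q, in_ball q -> qnorm (star_pow g n q) <= 1).
{ intros n. induction n as [| n IH]; intros q Hq; [unfold star_pow, cst; rewrite qnorm_1; lra |].
  simpl. replace 1 with (1 * 1) by ring.
  apply star_bound; try assumption; [now apply regular_star_pow | lra | now apply Hg1 |].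
  intros s Hs. apply IH. now apply same_sphere_ball with q. }
assert (Z : forall m, b (S m) = 0%Q).
{ intros m. induction m as [m IHm] using (well_founded_induction Wf_nat.lt_wf).
  assert (W : forall n, exists e, has_qpseries (star_pow g n) e /\ e 0%nat = 1%Q /\
     (forall j, (j < m)%nat -> e (S j) = 0%Q) /\ e (S m) = (RtoQ (INR n) * b (S m))%Q).
  { intros n. induction n as [| n (e & He & E0 & Ej & Em)].
    - exists (fun m => match m with O => 1%Q | _ => 0%Q end). split; [| split; [reflexivity | split]].
      + intros q _.
        assert (F := is_series_fin (fun m => (qpow q m * match m with O => 1 | _ => 0 end)%Q) 0).
        rewrite sum_O in F. simpl in F. rewrite qmul_1l in F. apply F.
        intros [| k] Hk; [lia | apply qmul_0r].
      + reflexivity.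
      + simpl. symmetry. apply qmul_0l.
    - exists (cprod b e). split; [now apply has_qpseries_star |].
      assert (E : forall j, (j <= m)%nat -> cprod b e (S j) = (b (S j) + e (S j))%Q).
      { intros j Hj. unfold cprod. rewrite sum_n_ends.
        - rewrite Nat.sub_diag, E0, qmul_1r. unfold b at 2. fold c. now rewrite Cc, qmul_1l.
        - intros [| k] Hk; [lia |]. rewrite Ej by lia. apply qmul_0r. }
      split; [| split].
      + unfold cprod. rewrite sum_O, E0, qmul_1r. exact Cc.
      + intros j Hj. rewrite E, Ej, (IHm j) by lia. qring.
      + rewrite E, Em, S_INR by lia. generalize (b (S m)). qring. }
  apply qnorm_eq0. apply Rle_antisym; [| apply qnorm_ge0].
  destruct (Rle_lt_dec (qnorm (b (S m))) 0) as [L | L]; [exact L | exfalso].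
  destruct (INR_unbounded (2 ^ S m / qnorm (b (S m)))) as [n Hn].
  destruct (W n) as (e & He & _ & _ & Em).
  assert (HI : imag_unit qi) by (unfold imag_unit, qi; qring).
  assert (CE : qnorm (e (S m)) * (/ 2) ^ S m <= 1).
  { apply (cauchy_estimate (star_pow g n) e qi); try assumption; [lra |].
    intros x y Hxy. apply Hp1. unfold in_ball. lra. }
  rewrite Em, qnorm_mul, qnorm_RtoQ, Rabs_pos_eq in CE by apply pos_INR.
  rewrite pow_inv in CE.
  assert (P2 : 0 < 2 ^ S m) by (apply pow_lt; lra).
  apply Rmult_le_compat_r with (r := 2 ^ S m) in CE; [| lra].
  rewrite Rmult_assoc, Rinv_l, Rmult_1_r, Rmult_1_l in CE by lra.
  apply Rmult_gt_compat_r with (r := qnorm (b (S m))) in Hn; [| exact L].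
  replace (2 ^ S m / qnorm (b (S m)) * qnorm (b (S m))) with (2 ^ S m) in Hn by (field; lra).
  lra. }
intros q Hq. apply (is_series_uniq _ _ _ (Ha _ Hq)).
assert (F := is_series_fin (fun m => (qpow q m * a m)%Q) 0).
rewrite sum_O in F. simpl in F. rewrite qmul_1l in F. apply F.
intros [| k] Hk; [lia |].
assert (K := Z k). unfold b in K. apply qmul_eq0 in K. destruct K as [-> | K]; [apply qmul_0r |].
apply (f_equal qnorm) in K. rewrite qnorm_conj, H0, qnorm_0 in K. lra.
Qed.

(** * Inverses for the star product *)

Lemma symm_real f x : regular f -> Rabs x < 1 -> symm f (RtoQ x) = RtoQ (qnorm (f (RtoQ x)) ^ 2).
Proof.
intros Hf Hx. unfold symm. rewrite star_real, reg_conj_real by (try assumption; now apply regular_conj).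
apply qmul_conj_r.
Qed.

(** The symmetrization is real on the real axis, hence has real coefficients, hence
    maps every slice to itself. *)
Lemma symm_comm f I x y : regular f -> in_ball (slice_pt I x y) ->
  (I * symm f (slice_pt I x y) = symm f (slice_pt I x y) * I)%Q.
Proof.
intros Hf Hb. destruct (regular_symm f Hf) as [e He].
assert (Ee : (fun m => qconj (e m)) = e).
{ apply (qpseries_coef_unique _ _ _ _ 1 ltac:(lra) (has_qpseries_conj _ _ He) He).
  intros t Ht. rewrite reg_conj_real, symm_real by (try assumption; now exists e). apply qconj_RtoQ. }
apply (is_series_uniq _ _ _ (is_series_linear _ _ _ (linear_qmul_l I) (He _ Hb))).
eapply is_series_ext; [| exact (is_series_linear _ _ _ (linear_qmul_r I) (He _ Hb))].
intros m. simpl.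
assert (Em : e m = RtoQ (Q0 (e m))).
{ assert (K := f_equal (fun s => s m) Ee). cbv beta in K.
  assert (K1 := f_equal Q1 K). assert (K2 := f_equal Q2 K). assert (K3 := f_equal Q3 K).
  revert K1 K2 K3. generalize (e m). intros [[[e0 e1] e2] e3]. qcoord. intros.
  apply quat_ext; qcoord; lra. }
rewrite Em, qmul_assoc, (qpow_comm I), <- !qmul_assoc by (unfold slice_pt; qring).
f_equal. apply RtoQ_comm.
Qed.

Lemma qinv_comm p q : q <> 0%Q -> (p * q = q * p)%Q -> (p * qinv q = qinv q * p)%Q.
Proof.
intros Hq E. apply qmul_cancel_r with q; [exact Hq |].
rewrite <- !qmul_assoc, E, qinv_l, qmul_1r, qmul_assoc, qinv_l, qmul_1l by exact Hq. reflexivity.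
Qed.

Lemma continuous_qinv {U : UniformSpace} (u : U -> quatN) x :
  continuous u x -> u x <> 0%Q -> continuous (fun t => qinv (u t) : quatN) x.
Proof.
intros Hu Hx.
assert (N : continuous (fun t => / (norm (u t) * norm (u t))) x).
{ apply (continuous_comp (fun t => norm (u t) * norm (u t)) Rinv).
  - apply (continuous_mult (K := R_AbsRing)); apply (continuous_comp u norm); try exact Hu; apply filterlim_norm.
  - apply (ex_derive_continuous (V := R_NormedModule)). auto_derive.
    rewrite norm_qnorm. apply qnorm_pos in Hx. nra. }
eapply continuous_ext; [| exact (continuous_scal _ _ _ N (continuous_linear _ _ _ linear_qconj Hu))].
intros t. transitivity (RtoQ (/ (norm (u t) * norm (u t))) * qconj (u t))%Q; [apply scal_RtoQ |].
unfold qinv. rewrite norm_qnorm. do 3 f_equal. ring.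
Qed.

(** The symmetrization of a zero-free [f] has no zeros either, and since it maps each
    slice to itself its pointwise inverse is holomorphic in every slice. *)
Theorem star_inv_regular f : regular f -> (forall q, in_ball q -> f q <> 0%Q) ->
  regular (star_inv f) /\ forall x, Rabs x < 1 -> star_inv f (RtoQ x) = qinv (f (RtoQ x)).
Proof.
intros Hf Hz.
assert (Sz : forall q, in_ball q -> symm f q <> 0%Q).
{ intros q Hq. apply symm_neq0; try assumption. intros s Hs. apply Hz. now apply same_sphere_ball with q. }
assert (Rpsi : regular (fun q => qinv (symm f q))).
{ apply slice_regular_regular. intros I HI.
  destruct (regular_symm f Hf) as [e He].
  assert (C1 := conv_qderiv e (has_qpseries_conv _ _ He)).
  assert (C2 := conv_qderiv _ C1).
  assert (H1 := has_qpseries_qpseries _ C1). assert (H2 := has_qpseries_qpseries _ C2).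
  set (f1 := qpseries (qderiv e)) in *.
  set (fx := fun p : R * R => (- (qinv (symm f (slice_pt I (fst p) (snd p))) *
      f1 (slice_pt I (fst p) (snd p)) * qinv (symm f (slice_pt I (fst p) (snd p)))))%Q).
  exists fx, (fun p => (I * fx p)%Q). intros x y Hb.
  destruct (regular_derivatives (symm f) e f1 I x y He H1 HI Hb) as (D1 & D2 & D0).
  destruct (regular_derivatives f1 _ _ I x y H1 H2 HI Hb) as (_ & _ & D3).
  assert (Ci : continuous (fun p : R * R => qinv (symm f (slice_pt I (fst p) (snd p))) : quatN) (x, y)).
  { apply (continuous_qinv (fun p : R * R => symm f (slice_pt I (fst p) (snd p)))); [exact D0 |].
    now apply Sz. }
  assert (Cx : continuous (fx : R * R -> quatN) (x, y)).
  { apply (continuous_opp (V := quatN)). apply continuous_qmul; [| exact Ci].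
    apply continuous_qmul; [exact Ci | exact D3]. }
  split; [| split; [| split; [exact Cx | split]]].
  - exact (is_derive_qinv _ _ _ D1 (Sz _ Hb)).
  - eapply is_derive_eq; [exact (is_derive_qinv _ _ _ D2 (Sz _ Hb)) |].
    unfold fx; simpl.
    assert (K := qinv_comm I _ (Sz _ Hb) (symm_comm f I x y Hf Hb)).
    rewrite (qmul_assoc (qinv _) I), <- K.
    generalize (qinv (symm f (slice_pt I x y))) (f1 (slice_pt I x y)). intros u v.
    rewrite <- !qmul_assoc. generalize (u * (v * u))%Q. qring.
  - exact (continuous_linear _ _ _ (linear_qmul_l I) Cx).
  - rewrite imag_unit_mul by exact HI. generalize (fx (x, y)). qring. }
assert (Comm : forall q, in_ball q -> (q * qinv (symm f q) = qinv (symm f q) * q)%Q).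
{ intros q Hq. destruct (slice_pt_ex q) as (I & x & y & HI & ->).
  apply qinv_comm; [now apply Sz |]. apply comm_slice_pt. now apply symm_comm. }
split.
- apply regular_ext with (star (fun q => qinv (symm f q)) (reg_conj f)).
  + intros q Hq. rewrite (star_at _ _ q q); try assumption; [reflexivity | now apply regular_conj | now apply Comm].
  + apply regular_star; [exact Rpsi | now apply regular_conj].
- intros x Hx. unfold star_inv. rewrite symm_real, reg_conj_real by assumption.
  assert (N := Hz (RtoQ x) ltac:(now apply in_ball_RtoQ)).
  generalize dependent (f (RtoQ x)). intros w N.
  apply qmul_cancel_r with w; [exact N |]. rewrite qinv_l by exact N.
  rewrite <- qmul_assoc, qmul_conj_l. apply qinv_l. apply qnorm_pos in N.
  intros Z. apply (f_equal Q0) in Z. change (qnorm w ^ 2 = 0) in Z. nra.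
Qed.

(** * Moebius transformations of the quaternionic ball *)

Lemma one_sub_neq0 w : qnorm w < 1 -> (1 - w <> 0)%Q.
Proof. intros H E. apply qsub_eq0 in E. rewrite <- E, qnorm_1 in H. lra. Qed.

Lemma mul_conj_lt w c : qnorm w <= 1 -> qnorm c < 1 -> qnorm (w * qconj c)%Q < 1.
Proof.
intros Hw Hc. rewrite qnorm_mul, qnorm_conj. assert (N := qnorm_ge0 c). assert (N' := qnorm_ge0 w). nra.
Qed.

Lemma mob_norm w c : qnorm (1 - w * qconj c)%Q ^ 2 - qnorm (w - c)%Q ^ 2 =
  (1 - qnorm w ^ 2) * (1 - qnorm c ^ 2).
Proof. rewrite !qnorm_sqr. qcoord. ring. Qed.

Lemma mob_commute w c : ((1 - w * qconj c) * (w - c) = (w - c) * (1 - qconj c * w))%Q.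
Proof.
assert (E : (w * qconj c * c = c * qconj c * w)%Q).
{ now rewrite <- qmul_assoc, qmul_conj_l, qmul_conj_r, RtoQ_comm. }
rewrite !qmul_subl, !qmul_subr, !qmul_1l, !qmul_1r, !qmul_assoc, E.
generalize (w * qconj c * w)%Q (c * qconj c * w)%Q. qring.
Qed.

(** The inverse of w |-> (1 - w c^-)^-1 (w - c) has the same form, with - c for c. *)
Lemma mob_invert w c x : qnorm x <= 1 -> qnorm c < 1 ->
  ((1 - w * qconj c) * x = w - c)%Q -> ((1 - x * qconj (- c)) * w = x - - c)%Q.
Proof.
intros Hx Hc H.
assert (E : (x + c = w * (1 + qconj c * x))%Q).
{ rewrite qmul_subl, qmul_1l, <- qmul_assoc in H.
  rewrite qmul_addr, qmul_1r. revert H. generalize (w * (qconj c * x))%Q. intros v H.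
  replace (x + c)%Q with ((x - v) + (v + c))%Q by qring. rewrite H. qring. }
apply qmul_cancel_r with (1 + qconj c * x)%Q.
- replace (1 + qconj c * x)%Q with (1 - - (qconj c * x))%Q by (generalize (qconj c * x)%Q; qring).
  apply one_sub_neq0. rewrite qnorm_opp, qnorm_mul, qnorm_conj.
  assert (N := qnorm_ge0 c). assert (N' := qnorm_ge0 x). nra.
- rewrite <- qmul_assoc, <- E.
  replace (x - - c)%Q with (x + c)%Q by qring.
  replace (1 - x * qconj (- c))%Q with (1 + x * qconj c)%Q by qring.
  assert (E2 : (x * qconj c * c = c * qconj c * x)%Q).
  { now rewrite <- qmul_assoc, qmul_conj_l, qmul_conj_r, RtoQ_comm. }
  rewrite !qmul_addl, !qmul_addr, !qmul_1l, !qmul_1r, !qmul_assoc, E2.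
  generalize (x * qconj c * x)%Q (c * qconj c * x)%Q. qring.
Qed.

(** The polarized form of [mob_norm]: 1 - x x'^- is congruent to 1 - w w'^-. *)
Lemma mob_kernel w x w' x' c : qnorm w <= 1 -> qnorm w' <= 1 -> qnorm c < 1 ->
  ((1 - w * qconj c) * x = w - c)%Q -> ((1 - w' * qconj c) * x' = w' - c)%Q ->
  (1 - x * qconj x' = qinv (1 - w * qconj c) *
    (RtoQ (1 - qnorm c ^ 2) * (1 - w * qconj w')) * qconj (qinv (1 - w' * qconj c)))%Q.
Proof.
intros Hw Hw' Hc E E'.
assert (N := one_sub_neq0 _ (mul_conj_lt w c Hw Hc)).
assert (N' := one_sub_neq0 _ (mul_conj_lt w' c Hw' Hc)).
set (a := (1 - w * qconj c)%Q) in *. set (a' := (1 - w' * qconj c)%Q) in *.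
assert (K : (RtoQ (1 - qnorm c ^ 2) * (1 - w * qconj w') = a * (1 - x * qconj x') * qconj a')%Q).
{ transitivity (a * qconj a' - (a * x) * qconj (a' * x'))%Q.
  - rewrite E, E', qnorm_sqr. unfold a, a'.
    rewrite !qconj_sub, !qconj_mul, !qconj_conj, qconj_RtoQ, !qmul_subl, !qmul_subr, !qmul_1l, !qmul_1r, !qmul_assoc.
    replace (w * qconj c * c * qconj w')%Q with (RtoQ (qnorm c ^ 2) * (w * qconj w'))%Q
      by (rewrite <- (qmul_assoc w), qmul_conj_l, <- (RtoQ_comm _ w); now rewrite !qmul_assoc).
    rewrite qmul_conj_r, qnorm_sqr, <- (qmul_assoc (RtoQ _) w (qconj w')).
    generalize (w * qconj w')%Q (w * qconj c)%Q (c * qconj w')%Q. qring.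
  - rewrite qconj_mul, qmul_subr, qmul_subl, qmul_1r. now rewrite !qmul_assoc. }
rewrite K. rewrite <- !qmul_assoc, <- qconj_mul, qinv_l, qconj_RtoQ, qmul_1r by exact N'.
now rewrite qmul_assoc, qinv_l, qmul_1l.
Qed.

(** * Schur functions *)

Definition schur (f : quat -> quat) : Prop :=
  regular f /\ forall q, in_ball q -> qnorm (f q) <= 1.

(** For a Schur function: |f(q)| tends to 1, uniformly, as |q| tends to 1. Finite Blaschke
    products have this property, and it survives division by Moebius factors. *)
Definition bdry_unimodular (f : quat -> quat) : Prop :=
  forall e, 0 < e -> exists r, r < 1 /\
    forall q, in_ball q -> r < qnorm q -> 1 - e <= qnorm (f q).

(** Among regular functions this relation on the real axis says that [X] is the
    Moebius transform of [f]. Unlike [moebius_act] it can be inverted by pointwise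
    algebra. *)
Definition mob_rel (c : quat) (f X : quat -> quat) : Prop :=
  forall x, Rabs x < 1 ->
    ((1 - f (RtoQ x) * qconj c) * X (RtoQ x) = f (RtoQ x) - c)%Q.

Lemma regular_one_sub f c : regular f -> regular (fun q => 1 - f q * c)%Q.
Proof. intros H. apply regular_sub; [apply regular_cst | now apply regular_mul_r]. Qed.

Lemma mob_den_neq0 f c q : schur f -> in_ball c -> in_ball q -> (1 - f q * qconj c <> 0)%Q.
Proof. intros [_ H] Hc Hq. apply one_sub_neq0, mul_conj_lt; [now apply H | exact Hc]. Qed.

Lemma moebius_act_spec f c : schur f -> in_ball c ->
  regular (moebius_act c f) /\ mob_rel c f (moebius_act c f).
Proof.
intros Hf Hc.
destruct (star_inv_regular (fun q => 1 - f q * qconj c)%Q) as [R1 R2].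
- apply regular_one_sub, Hf.
- intros q Hq. now apply mob_den_neq0.
- assert (R3 : regular (fun q => f q - c)%Q) by (apply regular_sub; [apply Hf | apply regular_cst]).
  split; [exact (regular_star _ _ R1 R3) |].
  intros x Hx. unfold moebius_act. rewrite star_real, R2 by assumption.
  rewrite qmul_assoc, qinv_r, qmul_1l; [reflexivity |].
  apply mob_den_neq0; try assumption. now apply in_ball_RtoQ.
Qed.

Lemma mob_rel_invert c f X : in_ball c -> schur X -> mob_rel c f X -> mob_rel (- c)%Q X f.
Proof.
intros Hc [_ HX] H x Hx. apply mob_invert; [| exact Hc | now apply H].
now apply HX, in_ball_RtoQ.
Qed.

(** Off the real axis the relation holds between values at conjugate points, and by
    [conj_onto] every point occurs on the side of [X]. Norm estimates for [X] on
    spheres therefore follow from those for [f]. *)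
Lemma mob_eval c f X s : schur f -> in_ball c -> regular X -> mob_rel c f X -> in_ball s ->
  exists q, same_sphere q s /\ ((1 - f q * qconj c) * X s = f q - c)%Q.
Proof.
intros Hf Hc HX H Hs.
set (A := fun q => (1 - f q * qconj c)%Q).
assert (RA : regular A) by (apply regular_one_sub, Hf).
destruct (conj_onto A s RA Hs) as (q & Hq & E).
{ intros q Hq. apply mob_den_neq0; try assumption. now apply same_sphere_ball with s. }
exists q. split; [exact Hq |].
assert (Hqb := same_sphere_ball q s Hq Hs).
change ((A q * X s = f q - c)%Q). rewrite <- (star_at A X q s RA HX Hqb Hs E).
apply (regular_eq (star A X) (fun q => f q - c)%Q 1); try assumption; [lra | now apply regular_star | |].
- apply regular_sub; [apply Hf | apply regular_cst].
- intros x Hx. rewrite star_real by assumption. now apply H.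
Qed.

Lemma mob_eval_norm w c x : qnorm w <= 1 -> qnorm c < 1 -> ((1 - w * qconj c) * x = w - c)%Q ->
  (1 - qnorm x ^ 2) * qnorm (1 - w * qconj c)%Q ^ 2 = (1 - qnorm w ^ 2) * (1 - qnorm c ^ 2).
Proof.
intros Hw Hc H. rewrite <- mob_norm, <- H, qnorm_mul. ring.
Qed.

Lemma mob_den_pos w c : qnorm w <= 1 -> qnorm c < 1 ->
  0 < 1 - qnorm c /\ 1 - qnorm c <= qnorm (1 - w * qconj c)%Q.
Proof.
intros Hw Hc. split; [lra |].
assert (K := qnorm_sub_ge 1 (w * qconj c)%Q). rewrite qnorm_1, qnorm_mul, qnorm_conj in K.
assert (N := qnorm_ge0 c). nra.
Qed.

Lemma mob_schur c f X : schur f -> in_ball c -> regular X -> mob_rel c f X -> schur X.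
Proof.
intros Hf Hc HX H. split; [exact HX |]. intros s Hs.
destruct (mob_eval c f X s Hf Hc HX H Hs) as (q & Hq & E).
assert (Hw : qnorm (f q) <= 1) by (apply Hf; now apply same_sphere_ball with s).
assert (K := mob_eval_norm _ _ _ Hw Hc E).
destruct (mob_den_pos _ _ Hw Hc) as [D1 D2].
assert (N := qnorm_ge0 (X s)). assert (N1 := qnorm_ge0 (f q)). assert (N2 := qnorm_ge0 c).
assert (P : 0 <= (1 - qnorm (f q) ^ 2) * (1 - qnorm c ^ 2)) by (apply Rmult_le_pos; nra).
rewrite <- K in P.
destruct (Rle_lt_dec (qnorm (X s)) 1) as [L | L]; [exact L | exfalso].
assert (0 < (qnorm (X s) ^ 2 - 1) * qnorm (1 - f q * qconj c)%Q ^ 2) by (apply Rmult_lt_0_compat; nra).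
lra.
Qed.

Lemma mob_strict c f X : schur f -> (forall q, in_ball q -> qnorm (f q) < 1) ->
  in_ball c -> regular X -> mob_rel c f X -> forall s, in_ball s -> qnorm (X s) < 1.
Proof.
intros Hf H1 Hc HX H s Hs.
destruct (mob_eval c f X s Hf Hc HX H Hs) as (q & Hq & E).
assert (Hw : qnorm (f q) < 1) by (apply H1; now apply same_sphere_ball with s).
assert (K := mob_eval_norm _ _ _ (Rlt_le _ _ Hw) Hc E).
assert (N := qnorm_ge0 (X s)). assert (N1 := qnorm_ge0 (f q)). assert (N2 := qnorm_ge0 c).
unfold in_ball in Hc.
assert (P : 0 < (1 - qnorm (f q) ^ 2) * (1 - qnorm c ^ 2)) by (apply Rmult_lt_0_compat; nra).
rewrite <- K in P. assert (S := pow2_ge_0 (qnorm (1 - f q * qconj c)%Q)).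
destruct (Rlt_le_dec (qnorm (X s)) 1) as [L | L]; [exact L | exfalso].
assert (0 <= (qnorm (X s) ^ 2 - 1) * qnorm (1 - f q * qconj c)%Q ^ 2) by (apply Rmult_le_pos; nra).
lra.
Qed.

Lemma mob_bdry c f X : schur f -> in_ball c -> regular X -> mob_rel c f X ->
  bdry_unimodular f -> bdry_unimodular X.
Proof.
intros Hf Hc HX H HU e He.
assert (N2 := qnorm_ge0 c). assert (Hc' : qnorm c < 1) by exact Hc.
destruct (HU (e * (1 - qnorm c) ^ 2 / 2)) as (r & Hr & K0).
{ assert (0 < (1 - qnorm c) ^ 2) by nra. nra. }
exists r. split; [exact Hr |]. intros s Hs Hrs.
destruct (mob_eval c f X s Hf Hc HX H Hs) as (q & Hq & E).
assert (Hqb := same_sphere_ball q s Hq Hs).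
assert (Hw : qnorm (f q) <= 1) by now apply Hf.
assert (K := mob_eval_norm _ _ _ Hw Hc E).
destruct (mob_den_pos _ _ Hw Hc) as [D1 D2].
specialize (K0 q Hqb ltac:(rewrite (proj2 Hq); exact Hrs)).
assert (X1 := proj2 (mob_schur c f X Hf Hc HX H) s Hs).
assert (N := qnorm_ge0 (X s)). assert (N1 := qnorm_ge0 (f q)).
set (a := qnorm (X s)) in *. set (b := qnorm (f q)) in *. set (g := qnorm c) in *.
set (dd := qnorm (1 - f q * qconj c)%Q) in *.
assert (L1 : (1 - a ^ 2) * (1 - g) ^ 2 <= (1 - a ^ 2) * dd ^ 2) by (apply Rmult_le_compat_l; nra).
assert (L2 : (1 - b ^ 2) * (1 - g ^ 2) <= 2 * (1 - b)).
{ apply Rle_trans with ((1 - b ^ 2) * 1); [apply Rmult_le_compat_l |]; nra. }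
assert (L3 : (1 - a ^ 2) * (1 - g) ^ 2 <= e * (1 - g) ^ 2) by lra.
assert (L4 : 1 - a ^ 2 <= e) by (apply Rmult_le_reg_r with ((1 - g) ^ 2); [apply pow_lt; lra | exact L3]). nra.
Qed.

Lemma schur_id : schur (fun q => q).
Proof. split; [apply regular_id |]. intros q Hq. now left. Qed.

Lemma bdry_id : bdry_unimodular (fun q => q).
Proof. intros e He. exists (1 - e). split; [lra |]. intros q _ Hq. lra. Qed.

Lemma moebius_spec p : in_ball p ->
  schur (moebius p) /\ bdry_unimodular (moebius p) /\ mob_rel p (fun q => q) (moebius p).
Proof.
intros Hp. destruct (moebius_act_spec (fun q => q) p schur_id Hp) as [R1 R2].
change (moebius_act p (fun q => q)) with (moebius p) in *.
split; [| split; [| exact R2]].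
- exact (mob_schur p _ _ schur_id Hp R1 R2).
- exact (mob_bdry p _ _ schur_id Hp R1 R2 bdry_id).
Qed.

(** [mob_rel] has the factor on the left; on the real axis the two factors commute. *)
Lemma moebius_real p x : in_ball p -> Rabs x < 1 ->
  (moebius p (RtoQ x) * (1 - RtoQ x * qconj p) = RtoQ x - p)%Q.
Proof.
intros Hp Hx. destruct (moebius_spec p Hp) as (_ & _ & R2).
apply qmul_cancel_l with (1 - RtoQ x * qconj p)%Q.
- exact (mob_den_neq0 _ p _ schur_id Hp (proj2 (in_ball_RtoQ x) Hx)).
- rewrite qmul_assoc, (R2 x Hx), mob_commute. f_equal. now rewrite RtoQ_comm.
Qed.

Lemma moebius_zero p q : in_ball p -> in_ball q -> moebius p q = 0%Q -> q = p.
Proof.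
intros Hp Hq H. destruct (moebius_spec p Hp) as ([R1 _] & _ & _).
assert (R3 : regular (fun q => 1 - q * qconj p)%Q) by (apply regular_one_sub, regular_id).
apply qsub_eq0. rewrite <- (star_zero _ _ q R1 R3 Hq H). symmetry.
apply (regular_eq (star (moebius p) (fun q => 1 - q * qconj p)%Q) (fun q => q - p)%Q 1);
  try assumption; [lra | now apply regular_star | apply regular_id_sub |].
intros x Hx. rewrite star_real by assumption. now apply moebius_real.
Qed.

Lemma moebius_at p : in_ball p -> moebius p p = 0%Q.
Proof.
intros Hp. destruct (moebius_spec p Hp) as ([R1 _] & _ & R2).
assert (R3 : regular (fun q => 1 - q * qconj p)%Q) by (apply regular_one_sub, regular_id).
assert (E : star (fun q => 1 - q * qconj p)%Q (moebius p) p = (p - p)%Q).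
{ apply (regular_eq (star (fun q => 1 - q * qconj p)%Q (moebius p)) (fun q => q - p)%Q 1); try assumption; [lra | now apply regular_star | |].
  - apply regular_id_sub.
  - intros x Hx. rewrite star_real by assumption. now apply R2. }
rewrite (star_at _ _ p p R3 R1 Hp Hp), qsub_diag in E.
- apply qmul_eq0 in E. destruct E as [E | E]; [| exact E].
  exfalso. revert E. exact (mob_den_neq0 _ p p schur_id Hp Hp).
- rewrite qmul_conj_r. replace (1 - RtoQ (qnorm p ^ 2))%Q with (RtoQ (1 - qnorm p ^ 2)) by qring.
  now rewrite RtoQ_comm.
Qed.

Lemma small_half e : 0 < e -> exists d, 0 < d /\ d <= e / 2 /\ d <= / 2.
Proof.
intros He. exists (Rmin (e / 2) (/ 2)).
split; [apply Rmin_pos; lra | split; [apply Rmin_l | apply Rmin_r]].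
Qed.


Lemma bdry_star f g : regular f -> regular g -> bdry_unimodular f -> bdry_unimodular g ->
  bdry_unimodular (star f g).
Proof.
intros Rf Rg Hf Hg e He.
destruct (small_half e He) as (d & Hd & D1 & D2).
destruct (Hf d Hd) as (r & Hr & K). destruct (Hg d Hd) as (r' & Hr' & K').
exists (Rmax r r'). split; [now apply Rmax_lub_lt |]. intros q Hq Hrq.
assert (M1 := Rmax_l r r'). assert (M2 := Rmax_r r r').
assert (Kq := K q Hq ltac:(lra)).
assert (Nq : f q <> 0%Q) by (apply qnorm_neq0; lra).
destruct (star_eval f g q Rf Rg Hq Nq) as (s & Hs & ->). rewrite qnorm_mul.
assert (Ks := K' s (same_sphere_ball _ _ Hs Hq) ltac:(rewrite (proj2 Hs); lra)).
assert ((1 - d) * (1 - d) <= qnorm (f q) * qnorm (g s)) by (apply Rmult_le_compat; lra).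
nra.
Qed.

(** Near the unit sphere the Moebius factor has modulus close to one, so that [h] and
    [X] have nearly the same modulus at corresponding points; the bound for [h] then
    extends inwards by the maximum principle. *)
Lemma moebius_quotient p X h : in_ball p -> schur X -> regular h ->
  (forall q, in_ball q -> star (moebius p) h q = X q) ->
  schur h /\ (bdry_unimodular X -> bdry_unimodular h).
Proof.
intros Hp [RX HX] Rh E. destruct (moebius_spec p Hp) as ([Rm Hm] & Um & _).
assert (K : forall e, 0 < e < 1 -> exists r, r < 1 /\ forall s, in_ball s -> r < qnorm s ->
   exists q, same_sphere q s /\ 1 - e <= qnorm (moebius p q) <= 1 /\ X q = (moebius p q * h s)%Q).
{ intros e He. destruct (Um e (proj1 He)) as (r & Hr & K). exists r. split; [exact Hr |].
  intros s Hs Hrs.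
  destruct (conj_onto (moebius p) s Rm Hs) as (q & Hq & C).
  - intros q Hq. apply qnorm_neq0.
    specialize (K q (same_sphere_ball _ _ Hq Hs) ltac:(rewrite (proj2 Hq); lra)). lra.
  - exists q. assert (Hqb := same_sphere_ball _ _ Hq Hs).
    split; [exact Hq | split; [split |]].
    + apply K; [exact Hqb | rewrite (proj2 Hq); lra].
    + now apply Hm.
    + rewrite <- E by exact Hqb. now apply star_at. }
split.
- split; [exact Rh |]. apply max_boundary; [exact Rh |]. intros e He.
  destruct (small_half e He) as (d & Hd & D1 & D2).
  destruct (K d ltac:(lra)) as (r & Hr & K'). exists r. split; [exact Hr |].
  intros s Hs Hrs. destruct (K' s Hs Hrs) as (q & Hq & [B1 _] & Eq).
  assert (Xq := HX q (same_sphere_ball _ _ Hq Hs)). rewrite Eq, qnorm_mul in Xq.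
  assert (N := qnorm_ge0 (h s)). nra.
- intros UX e He. destruct (UX e He) as (r & Hr & KX).
  destruct (K (/ 2) ltac:(lra)) as (r' & Hr' & K'). exists (Rmax r r').
  split; [now apply Rmax_lub_lt |]. intros s Hs Hrs.
  assert (M1 := Rmax_l r r'). assert (M2 := Rmax_r r r').
  destruct (K' s Hs ltac:(lra)) as (q & Hq & [_ B2] & Eq).
  assert (Xq := KX q (same_sphere_ball _ _ Hq Hs) ltac:(rewrite (proj2 Hq); lra)).
  rewrite Eq, qnorm_mul in Xq. assert (N := qnorm_ge0 (h s)). nra.
Qed.

Lemma moebius_factor f s : regular f -> in_ball s -> f s = 0%Q ->
  exists h, regular h /\ forall q, in_ball q -> star (moebius s) h q = f q.
Proof.
intros Rf Hs Fs. destruct (regular_divide f s Rf Hs) as (r & Rr & Er). rewrite Fs in Er.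
assert (RA : regular (fun q => 1 - q * qconj s)%Q) by (apply regular_one_sub, regular_id).
assert (Rzs := regular_id_sub s). destruct (moebius_spec s Hs) as ([Rm _] & _).
exists (star (fun q => 1 - q * qconj s)%Q r). split; [now apply regular_star |].
apply (regular_eq _ _ 1); [lra | apply regular_star; [exact Rm | now apply regular_star] | exact Rf |].
intros x Hx. assert (Hxb := proj2 (in_ball_RtoQ x) Hx).
rewrite Er, qadd_0l, !star_real, qmul_assoc, moebius_real by (try assumption; now apply regular_star).
reflexivity.
Qed.

(** The strong maximum principle. If |f(0)| = 1 this is [max_const]. Otherwise the Moebius
    transform X of [f] with X(0) = 0 is q k(q) with |k| at most one, by the maximum
    principle; so |X| < 1 at every point, and inverting the transformation gives the
    same for [f]. *)
Lemma schur_dichotomy f : schur f ->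
  unimodular_constant f \/ forall q, in_ball q -> qnorm (f q) < 1.
Proof.
intros Hf.
assert (B0 := in_ball_0).
destruct (proj2 Hf _ B0) as [H0 | H0].
- right. set (c := f 0%Q) in *.
  destruct (moebius_act_spec f c Hf H0) as [RX HX]. set (X := moebius_act c f) in *.
  assert (SX := mob_schur c f X Hf H0 RX HX).
  assert (X0 : X 0%Q = 0%Q).
  { assert (K := HX 0 ltac:(rewrite Rabs_R0; lra)). fold c in K. rewrite qsub_diag in K.
    apply qmul_eq0 in K. destruct K as [K | K]; [exfalso | exact K].
    revert K. exact (mob_den_neq0 f c _ Hf H0 B0). }
  destruct (regular_divide X 0%Q RX B0) as (k & Rk & Ek). rewrite X0 in Ek.
  assert (Ek' : forall q, in_ball q -> X q = (q * k q)%Q).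
  { intros q Hq. rewrite Ek by exact Hq. rewrite qadd_0l.
    rewrite (star_at _ k q q); try assumption.
    - f_equal. qring.
    - apply regular_id_sub.
    - f_equal; qring. }
  assert (K1 : forall q, in_ball q -> qnorm (k q) <= 1).
  { apply max_boundary; [exact Rk |]. intros e He.
    destruct (small_half e He) as (d & Hd & D1 & D2).
    exists (1 - d). split; [lra |]. intros q Hq Hqd.
    assert (Xq := proj2 SX q Hq). rewrite Ek', qnorm_mul in Xq by exact Hq.
    assert (N := qnorm_ge0 (k q)). nra. }
  assert (X1 : forall q, in_ball q -> qnorm (X q) < 1).
  { intros q Hq. rewrite Ek', qnorm_mul by exact Hq. specialize (K1 q Hq).
    assert (N := qnorm_ge0 q). assert (N' := qnorm_ge0 (k q)). unfold in_ball in Hq. nra. }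
  assert (Hc' : in_ball (- c)%Q) by (unfold in_ball; now rewrite qnorm_opp).
  exact (mob_strict (- c)%Q X f SX X1 Hc' (proj1 Hf) (mob_rel_invert c f X H0 SX HX)).
- left. exists (f 0%Q). split; [exact H0 |]. exact (max_const f (proj1 Hf) (proj2 Hf) H0).
Qed.

(** The star inverse of [f] is regular with modulus close to one near the unit sphere;
    the maximum principle for it bounds |f| from below by one at the origin. *)
Lemma zero_free_constant f : schur f -> bdry_unimodular f ->
  (forall q, in_ball q -> f q <> 0%Q) -> unimodular_constant f.
Proof.
intros Hf HU Hz. destruct (star_inv_regular f (proj1 Hf) Hz) as [Rb Eb].
set (b := star_inv f) in *.
assert (B0 := in_ball_0).
assert (E : forall q, in_ball q -> star f b q = 1%Q).
{ apply (regular_eq (star f b) (fun _ => 1%Q) 1); [lra | exact (regular_star _ _ (proj1 Hf) Rb) | apply regular_cst |].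
  intros x Hx. rewrite star_real, Eb by (try assumption; apply Hf).
  apply qinv_r, Hz. now apply in_ball_RtoQ. }
assert (B1 : forall q, in_ball q -> qnorm (b q) <= 1).
{ apply max_boundary; [exact Rb |]. intros e He.
  destruct (small_half e He) as (d & Hd & D1 & D2).
  destruct (HU d Hd) as (r & Hr & K). exists r. split; [exact Hr |]. intros s Hs Hrs.
  destruct (conj_onto f s (proj1 Hf) Hs) as (q & Hq & C).
  - intros q Hq. apply Hz. now apply same_sphere_ball with s.
  - assert (Hqb := same_sphere_ball _ _ Hq Hs).
    assert (Kq := K q Hqb ltac:(rewrite (proj2 Hq); lra)).
    assert (P := f_equal qnorm (E q Hqb)).
    rewrite (star_at f b q s (proj1 Hf) Rb Hqb Hs C), qnorm_mul, qnorm_1 in P.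
    assert (N := qnorm_ge0 (b s)). nra. }
destruct (schur_dichotomy f Hf) as [U | U]; [exact U | exfalso].
assert (P := f_equal qnorm (E _ B0)).
rewrite star_real, qnorm_mul, qnorm_1 in P by (try assumption; try apply Hf; rewrite Rabs_R0; lra).
specialize (U _ B0). specialize (B1 _ B0).
assert (N := qnorm_ge0 (f 0%Q)). assert (N' := qnorm_ge0 (b 0%Q)). nra.
Qed.

(** * Hyperbolic difference quotients *)

Lemma diff_quot_spec f p : regular f -> in_ball p ->
  regular (diff_quot f p) /\
  forall q, in_ball q -> f q = (f p + star (fun z => z - p) (diff_quot f p) q)%Q.
Proof.
intros Hf Hp. destruct (regular_divide f p Hf Hp) as (r & Rr & Er).
assert (S : exists r, slice_regular r /\ forall q, in_ball q -> f q = (f p + star (fun z => z - p) r q)%Q).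
{ exists r. split; [now apply regular_slice_regular | exact Er]. }
destruct (epsilon_spec (inhabits (cst 0%Q)) _ S) as [S1 S2].
split; [now apply slice_regular_regular | exact S2].
Qed.

(** With c = f(p), the definition of the quotient divides by 1 - c^- f on the right,
    and [moebius_act] divides by 1 - f c^- on the left; by [mob_commute] both give the
    same result when applied to f - c. *)
Lemma hyp_quot_spec f p : regular f -> (forall q, in_ball q -> in_ball (f q)) -> in_ball p ->
  regular (hyp_quot f p) /\ forall q, in_ball q ->
    star (moebius p) (hyp_quot f p) q = moebius_act (f p) f q.
Proof.
intros Rf Hf Hp. destruct (diff_quot_spec f p Rf Hp) as [Rr Er].
set (r := diff_quot f p) in *. set (c := f p) in *.
assert (Hc : in_ball c) by now apply Hf.
assert (Sf : schur f) by (split; [exact Rf |]; intros q Hq; now left; apply Hf).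
set (A := fun q => (1 - q * qconj p)%Q).
assert (RA : regular A) by (apply regular_one_sub, regular_id).
set (B := fun q => (1 - star (cst (qconj c)) f q)%Q).
assert (RB : regular B).
{ apply regular_sub; [apply regular_cst |]. apply regular_star; [apply regular_cst | exact Rf]. }
assert (BZ : forall q, in_ball q -> B q <> 0%Q).
{ intros q Hq. apply one_sub_neq0. eapply Rle_lt_trans.
  - apply (star_bound _ _ (qnorm c) 1); try assumption; [apply regular_cst | lra | |].
    + unfold cst. rewrite qnorm_conj. lra.
    + intros s Hs. apply Sf. now apply same_sphere_ball with q.
  - unfold in_ball in Hc. lra. }
destruct (star_inv_regular B RB BZ) as [RBi EBi].
assert (RAr : regular (star A r)) by now apply regular_star.
assert (Rh : regular (hyp_quot f p)) by exact (regular_star _ _ RAr RBi).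
split; [exact Rh |].
destruct (moebius_spec p Hp) as ([Rm _] & _ & Em).
destruct (moebius_act_spec f c Sf Hc) as [RX EX].
apply (regular_eq _ _ 1); [lra | now apply regular_star | exact RX |].
intros x Hx. rewrite star_real by assumption.
assert (Hxb : in_ball (RtoQ x)) by now apply in_ball_RtoQ.
assert (Eh : hyp_quot f p (RtoQ x) = (A (RtoQ x) * r (RtoQ x) * qinv (B (RtoQ x)))%Q).
{ change (star (star A r) (star_inv B) (RtoQ x) = (A (RtoQ x) * r (RtoQ x) * qinv (B (RtoQ x)))%Q).
  now rewrite star_real, star_real, EBi by assumption. }
assert (EB : B (RtoQ x) = (1 - qconj c * f (RtoQ x))%Q).
{ unfold B. rewrite star_real by (try assumption; apply regular_cst). reflexivity. }
assert (Ef := Er _ Hxb).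
assert (Rzp := regular_id_sub p).
rewrite star_real in Ef by assumption.
assert (Ef' : (f (RtoQ x) - c = (RtoQ x - p) * r (RtoQ x))%Q).
{ rewrite Ef at 1. generalize ((RtoQ x - p) * r (RtoQ x))%Q. qring. }
specialize (Em x Hx). cbv beta in Em. specialize (EX x Hx).
assert (NA : A (RtoQ x) <> 0%Q) by exact (mob_den_neq0 _ p _ schur_id Hp Hxb).
assert (NF := mob_den_neq0 f c _ Sf Hc Hxb).
assert (NB := BZ _ Hxb).
(* both sides equal (f - c) (1 - c^- f)^-1 *)
transitivity ((f (RtoQ x) - c) * qinv (B (RtoQ x)))%Q.
- apply qmul_cancel_l with (A (RtoQ x)); [exact NA |].
  rewrite Eh, !qmul_assoc. change (A (RtoQ x)) with (1 - RtoQ x * qconj p)%Q at 1.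
  rewrite Em. f_equal. rewrite Ef', qmul_assoc. f_equal.
  unfold A. rewrite mob_commute. f_equal. now rewrite RtoQ_comm.
- symmetry. apply qmul_cancel_l with (1 - f (RtoQ x) * qconj c)%Q; [exact NF |].
  rewrite EX, qmul_assoc, mob_commute, <- EB, <- qmul_assoc, qinv_r, qmul_1r by exact NB.
  reflexivity.
Qed.

(** * Kernels of finite rank *)

(** A kernel of finite rank: the sum of u(q) v(w)^- over the pairs (u, v) of the list. *)
Definition ksum (l : list ((quat -> quat) * (quat -> quat))) (q w : quat) : quat :=
  List.fold_right (fun (uv : (quat -> quat) * (quat -> quat)) (acc : quat) =>
    (fst uv q * qconj (snd uv w) + acc)%Q) 0%Q l.

Definition regular_pairs (l : list ((quat -> quat) * (quat -> quat))) : Prop :=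
  List.Forall (fun uv => regular (fst uv) /\ regular (snd uv)) l.

(** A bound for the rank of (1 - f(x) f(y)^-) / (1 - x y), the de Branges-Rovnyak kernel of
    [f]. Real arguments suffice and make the division unambiguous. *)
Definition kernel_rank_le (k : nat) (f : quat -> quat) : Prop :=
  exists l, length l = k /\ regular_pairs l /\
    forall x y, Rabs x < 1 -> Rabs y < 1 ->
      (1 - f (RtoQ x) * qconj (f (RtoQ y)) = RtoQ (1 - x * y) * ksum l (RtoQ x) (RtoQ y))%Q.

Definition kswap (l : list ((quat -> quat) * (quat -> quat))) :=
  map (fun uv => (snd uv, fst uv)) l.

Lemma ksum_swap l q w : ksum (kswap l) q w = qconj (ksum l w q).
Proof.
induction l as [| [u v] l IH]; simpl; [symmetry; apply qconj_RtoQ |].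
now rewrite qconj_add, qconj_mul, qconj_conj, IH.
Qed.

Lemma regular_pairs_swap l : regular_pairs l -> regular_pairs (kswap l).
Proof. intros H. apply Forall_map. eapply Forall_impl; [| exact H]. simpl. tauto. Qed.

Lemma regular_ksum l w : regular_pairs l -> regular (fun q => ksum l q w).
Proof.
intros H. induction H as [| [u v] l [H1 H2] _ IH]; simpl; [apply regular_cst |].
apply regular_add; [now apply regular_mul_r | exact IH].
Qed.

Lemma ksum_app l1 l2 q w : ksum (l1 ++ l2) q w = (ksum l1 q w + ksum l2 q w)%Q.
Proof.
induction l1 as [| uv l1 IH]; simpl; [symmetry; apply qadd_0l |]. now rewrite IH, qadd_assoc.
Qed.

Lemma ksum_congr l A B : regular A -> regular B -> regular_pairs l ->
  exists l', length l' = length l /\ regular_pairs l' /\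
    forall x y, Rabs x < 1 -> Rabs y < 1 ->
      ksum l' (RtoQ x) (RtoQ y) = (A (RtoQ x) * ksum l (RtoQ x) (RtoQ y) * qconj (B (RtoQ y)))%Q.
Proof.
intros HA HB H. induction H as [| [u v] l [H1 H2] _ (l' & L & R & E)].
- exists nil. split; [reflexivity | split; [constructor |]]. intros x y _ _. simpl.
  now rewrite qmul_0r, qmul_0l.
- exists ((star A u, star B v) :: l'). split; [simpl; now rewrite L | split].
  + constructor; [simpl; split; now apply regular_star | exact R].
  + intros x y Hx Hy. simpl in *. rewrite E, !star_real by assumption.
    now rewrite qconj_mul, qmul_addr, qmul_addl, !qmul_assoc.
Qed.

Lemma RtoQ_mul_comm c u v : (u * (RtoQ c * v) = RtoQ c * (u * v))%Q.
Proof. now rewrite !qmul_assoc, RtoQ_comm. Qed.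

Lemma RtoQ_shuffle a b k c d :
  (a * (RtoQ c * (RtoQ d * k)) * b = RtoQ d * (a * RtoQ c * k * b))%Q.
Proof.
rewrite !qmul_assoc, (RtoQ_comm d a), <- !(qmul_assoc a), (RtoQ_comm d (RtoQ c)).
now rewrite !qmul_assoc.
Qed.

Lemma inv_one_sub f c : schur f -> in_ball c ->
  exists A, regular A /\ forall x, Rabs x < 1 -> A (RtoQ x) = qinv (1 - f (RtoQ x) * qconj c)%Q.
Proof.
intros Hf Hc. exists (star_inv (fun q => 1 - f q * qconj c)%Q).
apply star_inv_regular; [apply regular_one_sub, Hf |]. intros q Hq. now apply mob_den_neq0.
Qed.

(** Moebius transformations change the kernel by a congruence, see [mob_kernel]. *)
Lemma kernel_rank_mob k f X c : schur f -> in_ball c -> mob_rel c f X ->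
  kernel_rank_le k f -> kernel_rank_le k X.
Proof.
intros Hf Hc HX (l & L & R & E).
destruct (inv_one_sub f c Hf Hc) as (A & RA & EA).
destruct (ksum_congr l (fun q => A q * RtoQ (1 - qnorm c ^ 2))%Q A (regular_mul_r _ _ RA) RA R)
  as (l' & L' & R' & E').
exists l'. split; [congruence | split; [exact R' |]]. intros x y Hx Hy.
rewrite E', EA, EA by assumption.
rewrite (mob_kernel _ _ _ _ c (proj2 Hf _ (proj2 (in_ball_RtoQ x) Hx)) (proj2 Hf _ (proj2 (in_ball_RtoQ y) Hy)) Hc (HX x Hx) (HX y Hy)).
rewrite E by assumption. apply RtoQ_shuffle.
Qed.

(** This is [mob_kernel] for the identity function, whose kernel is constant. *)
Lemma moebius_kernel p e x y : in_ball p ->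
  (forall x, Rabs x < 1 -> e (RtoQ x) = qinv (1 - RtoQ x * qconj p)%Q) ->
  Rabs x < 1 -> Rabs y < 1 ->
  (1 - moebius p (RtoQ x) * qconj (moebius p (RtoQ y)) =
   RtoQ (1 - x * y) * (e (RtoQ x) * RtoQ (1 - qnorm p ^ 2) * qconj (e (RtoQ y))))%Q.
Proof.
intros Hp He Hx Hy. destruct (moebius_spec p Hp) as (_ & _ & Em).
rewrite (mob_kernel _ _ _ _ p (Rlt_le _ _ (proj2 (in_ball_RtoQ x) Hx)) (Rlt_le _ _ (proj2 (in_ball_RtoQ y) Hy)) Hp (Em x Hx) (Em y Hy)).
rewrite !He by assumption.
replace (1 - RtoQ x * qconj (RtoQ y))%Q with (RtoQ (1 - x * y)) by qring.
rewrite <- (qmul_1r (RtoQ (1 - x * y))) at 1. rewrite RtoQ_shuffle. now rewrite qmul_1r.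
Qed.

Lemma inv_id p : in_ball p ->
  exists e, regular e /\ forall x, Rabs x < 1 -> e (RtoQ x) = qinv (1 - RtoQ x * qconj p)%Q.
Proof. exact (inv_one_sub (fun q => q) p schur_id). Qed.

Lemma star_kernel m h x y : regular m -> regular h -> Rabs x < 1 -> Rabs y < 1 ->
  (1 - star m h (RtoQ x) * qconj (star m h (RtoQ y)) =
   (1 - m (RtoQ x) * qconj (m (RtoQ y))) +
   m (RtoQ x) * (1 - h (RtoQ x) * qconj (h (RtoQ y))) * qconj (m (RtoQ y)))%Q.
Proof.
intros Rm Rh Hx Hy. rewrite !star_real by assumption.
rewrite qconj_mul, qmul_subr, qmul_subl, qmul_1r, !qmul_assoc.
generalize (m (RtoQ x) * qconj (m (RtoQ y)))%Q.
generalize (m (RtoQ x) * h (RtoQ x) * qconj (h (RtoQ y)) * qconj (m (RtoQ y)))%Q. qring.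
Qed.

(** The kernel of M_p * h is the rank one kernel of M_p plus a congruence transform of the
    kernel of [h]. *)
Lemma kernel_rank_moebius_mul k p h : in_ball p -> regular h ->
  kernel_rank_le k h -> kernel_rank_le (S k) (star (moebius p) h).
Proof.
intros Hp Rh (l & L & R & E). destruct (moebius_spec p Hp) as ([Rm _] & _ & _).
destruct (inv_id p Hp) as (e & Re & Ee).
destruct (ksum_congr l (moebius p) (moebius p) Rm Rm R) as (l' & L' & R' & E').
exists (((fun q => e q * RtoQ (1 - qnorm p ^ 2))%Q, e) :: l').
split; [simpl; congruence | split].
- constructor; [simpl; split; [now apply regular_mul_r | exact Re] | exact R'].
- intros x y Hx Hy. rewrite star_kernel by assumption.
  rewrite (moebius_kernel p e x y Hp Ee Hx Hy), E by assumption.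
  simpl. rewrite E', qmul_addr by assumption. f_equal.
  now rewrite RtoQ_mul_comm, <- qmul_assoc.
Qed.

(** With the second argument [y] real and fixed, a kernel is regular in the first one,
    and its defining equation extends to the ball. *)
Lemma kernel_extend F G y : regular F -> regular G ->
  (forall x, Rabs x < 1 -> F (RtoQ x) = (RtoQ (1 - x * y) * G (RtoQ x))%Q) ->
  forall q, in_ball q -> F q = (G q - q * G q * RtoQ y)%Q.
Proof.
intros HF HG E. apply (regular_eq F _ 1); [lra | exact HF | |].
- apply regular_sub; [exact HG | apply regular_mul_r, regular_id_mul, HG].
- intros x Hx. rewrite E by exact Hx. generalize (G (RtoQ x)). qring.
Qed.

Lemma kernel_extend_zero F G y s : regular F -> regular G -> Rabs y < 1 -> in_ball s ->
  (forall x, Rabs x < 1 -> F (RtoQ x) = (RtoQ (1 - x * y) * G (RtoQ x))%Q) ->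
  F s = 0%Q -> G s = 0%Q.
Proof.
intros HF HG Hy Hs E F0. assert (K := kernel_extend F G y HF HG E s Hs). rewrite F0 in K.
symmetry in K. apply qsub_eq0 in K. apply (f_equal qnorm) in K.
rewrite !qnorm_mul, qnorm_RtoQ in K. apply qnorm_eq0.
assert (N := qnorm_ge0 (G s)). assert (N' := qnorm_ge0 s). assert (N2 := Rabs_pos y).
unfold in_ball in Hs.
destruct N as [N | N]; [exfalso | now symmetry].
assert (P : qnorm s * Rabs y < 1) by nra. nra.
Qed.

Lemma ksum_divide l s : in_ball s -> regular_pairs l -> List.Forall (fun uv => fst uv s = 0%Q /\ snd uv s = 0%Q) l ->
  exists l', length l' = length l /\ regular_pairs l' /\
    forall x y, Rabs x < 1 -> Rabs y < 1 ->
      ksum l (RtoQ x) (RtoQ y) =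
      (moebius s (RtoQ x) * ksum l' (RtoQ x) (RtoQ y) * qconj (moebius s (RtoQ y)))%Q.
Proof.
intros Hs HR HZ. destruct (moebius_spec s Hs) as ([Rm _] & _ & _).
assert (D : forall u, regular u -> u s = 0%Q -> exists u', regular u' /\
   forall x, Rabs x < 1 -> u (RtoQ x) = (moebius s (RtoQ x) * u' (RtoQ x))%Q).
{ intros u Ru Zu. destruct (moebius_factor u s Ru Hs Zu) as (r & Rr & Er).
  exists r. split; [exact Rr |]. intros x Hx.
  rewrite <- Er by now apply in_ball_RtoQ. now apply star_real. }
induction HR as [| [u v] l [Ru Rv] _ IH].
- exists nil. split; [reflexivity | split; [constructor |]]. intros x y _ _. simpl.
  now rewrite qmul_0r, qmul_0l.
- inversion HZ as [| a b [Zu Zv] HZ']; subst. destruct (IH HZ') as (l' & L' & R' & E').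
  simpl in *. destruct (D u Ru Zu) as (u' & Ru' & Eu). destruct (D v Rv Zv) as (v' & Rv' & Ev).
  exists ((u', v') :: l'). split; [simpl; congruence | split; [constructor; [now split | exact R'] |]].
  intros x y Hx Hy. simpl. rewrite E', Eu, Ev by assumption.
  now rewrite qconj_mul, qmul_addr, qmul_addl, !qmul_assoc.
Qed.

Lemma ksum_map_fst l u0 s c q w :
  ksum (map (fun uv => ((fun q => fst uv q - u0 q * (c * fst uv s))%Q, snd uv)) l) q w =
  (ksum l q w - u0 q * (c * ksum l s w))%Q.
Proof.
induction l as [| [u v] l IH]; simpl; [rewrite !qmul_0r; qring |].
rewrite IH, !qmul_addr, qmul_subl, !qmul_assoc.
generalize (u q * qconj (v w))%Q (u0 q * c * u s * qconj (v w))%Q (ksum l q w) (u0 q * c * ksum l s w)%Q.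
qring.
Qed.

Lemma ksum_map_snd l e s c q w :
  ksum (map (fun uv => (fst uv, (fun q => snd uv q - e q * (c * snd uv s))%Q)) l) q w =
  (ksum l q w - ksum l q s * (qconj c * qconj (e w)))%Q.
Proof.
induction l as [| [u v] l IH]; simpl; [rewrite !qmul_0l; qring |].
rewrite IH, !qmul_addl, qconj_sub, !qconj_mul, qmul_subr, !qmul_assoc.
generalize (u q * qconj (v w))%Q (u q * qconj (v s) * qconj c * qconj (e w))%Q (ksum l q w)
  (ksum l q s * qconj c * qconj (e w))%Q.
qring.
Qed.

Lemma ksum_zero l q w : (forall uv, In uv l -> fst uv q = 0%Q) -> ksum l q w = 0%Q.
Proof.
induction l as [| uv l IH]; intros H; simpl; [reflexivity |].
rewrite (H uv) by now left. rewrite IH by (intros; apply H; now right).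
rewrite qmul_0l. apply qadd_0l.
Qed.

(** Removing a zero lowers the rank. The kernel of [f] is E + M, with E the rank one kernel
    of the Moebius factor, a multiple of e(x) e(y)^- with e(q) = (1 - q s^-)^-*, and M the
    transformed kernel of [h], which vanishes at [s] in both arguments. So the value
    of the kernel of [f] at (s, y) is e(y)^-. As this is not zero, some pair (u0, v0)
    has u0(s) <> 0, and v0 can be expressed by e and the other v. This leaves k terms
    and one term zeta(x) e(y)^-, and zeta is determined by the condition that M
    vanishes at y = s. In the resulting expression of rank k for M all functions
    vanish at [s], and the Moebius factors can be cancelled. *)
Lemma kernel_rank_peel k f h s : in_ball s -> regular h ->
  (forall q, in_ball q -> star (moebius s) h q = f q) ->
  kernel_rank_le (S k) f -> kernel_rank_le k h.
Proof.
intros Hs Rh Ef (l & L & R & E). destruct (moebius_spec s Hs) as ([Rm _] & _ & Em).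
set (m := moebius s) in *.
destruct (inv_id s Hs) as (e & Re & Ee).
assert (Rf : regular f) by (apply regular_ext with (star m h); [exact Ef | now apply regular_star]).
assert (Z : forall g, regular g -> star m g s = 0%Q)
  by (intros g Rg; apply star_zero; try assumption; now apply moebius_at).
assert (Fs : f s = 0%Q) by (rewrite <- Ef by exact Hs; now apply Z).
assert (Rb := fun y (Hy : Rabs y < 1) => proj2 (in_ball_RtoQ y) Hy).
set (d := 1 - qnorm s ^ 2).
assert (Es : (RtoQ d * e s = 1)%Q).
{ assert (RA : regular (fun q => 1 - q * qconj s)%Q) by (apply regular_one_sub, regular_id).
  assert (K : star (fun q => 1 - q * qconj s)%Q e s = 1%Q).
  { apply (regular_eq _ (fun _ => 1%Q) 1); [lra | now apply regular_star | apply regular_cst | | exact Hs].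
    intros x Hx. rewrite star_real, Ee by assumption. apply qinv_r.
    exact (mob_den_neq0 _ s _ schur_id Hs (Rb x Hx)). }
  assert (D1 : (1 - s * qconj s = RtoQ d)%Q) by (rewrite qmul_conj_r; unfold d; qring).
  rewrite (star_at _ e s s RA Re Hs Hs) in K; cbv beta in K; rewrite D1 in *; [exact K |].
  now rewrite RtoQ_comm. }
assert (Ks : forall y, Rabs y < 1 -> ksum l s (RtoQ y) = qconj (e (RtoQ y))).
{ intros y Hy.
  assert (K := kernel_extend (fun q => 1 - f q * qconj (f (RtoQ y)))%Q (fun q => ksum l q (RtoQ y)) y
    (regular_one_sub f _ Rf) (regular_ksum l _ R) (fun x Hx => E x y Hx Hy) s Hs).
  cbv beta in K. rewrite Fs, qmul_0l in K. rewrite Ee by exact Hy.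
  set (kk := ksum l s (RtoQ y)) in *.
  assert (N := mob_den_neq0 _ s _ schur_id Hs (Rb y Hy)). cbv beta in N.
  set (a := (1 - RtoQ y * qconj s)%Q) in *.
  assert (Ka : (qconj a * kk = 1)%Q).
  { replace 1%Q with (1 - 0)%Q by qring. rewrite K. unfold a.
    rewrite <- qmul_assoc, <- RtoQ_comm. clearbody kk. clear. qring. }
  rewrite <- (qmul_1l kk), <- (qconj_RtoQ 1), <- (qinv_r a N), qconj_mul, <- qmul_assoc, Ka.
  apply qmul_1r. }
assert (P : exists l1 u0 v0 l2, l = l1 ++ (u0, v0) :: l2 /\ u0 s <> 0%Q).
{ destruct (excluded_middle_informative (exists uv, In uv l /\ fst uv s <> 0%Q)) as [(uv & Hin & Hu) | N].
  - destruct (in_split _ _ Hin) as (l1 & l2 & ->). destruct uv as [u0 v0]. now exists l1, u0, v0, l2.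
  - exfalso. assert (K := Ks 0 ltac:(rewrite Rabs_R0; lra)).
    rewrite ksum_zero in K.
    + rewrite Ee in K by (rewrite Rabs_R0; lra). apply (f_equal qnorm) in K.
      replace (1 - 0 * qconj s)%Q with 1%Q in K by qring.
      assert (N1 : (1 <> 0 :> quat)%Q) by (intros A; apply (f_equal Q0) in A; unfold Q0, RtoQ in A; simpl in A; lra).
      rewrite qnorm_conj, qnorm_inv, qnorm_1, qnorm_0 in K by exact N1. lra.
    + intros uv Hin. destruct (excluded_middle_informative (fst uv s = 0%Q)) as [A | A]; [exact A |].
      exfalso. apply N. now exists uv. }
destruct P as (l1 & u0 & v0 & l2 & El & Ht).
set (l' := l1 ++ l2).
assert (R0 : regular u0 /\ regular v0 /\ regular_pairs l').
{ unfold regular_pairs in *. rewrite El in R. apply Forall_app in R. destruct R as [R1 R2].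
  inversion R2 as [| a b [A B] R3]; subst. simpl in A, B. repeat split; try assumption.
  apply Forall_app. now split. }
destruct R0 as (Ru0 & Rv0 & R').
assert (L' : length l' = k).
{ unfold l'. rewrite El in L. rewrite length_app in L |- *. simpl in L. lia. }
assert (Kl : forall q w, ksum l q w = (ksum l' q w + u0 q * qconj (v0 w))%Q).
{ intros q w. unfold l'. rewrite El, !ksum_app. simpl.
  generalize (ksum l1 q w) (ksum l2 q w) (u0 q * qconj (v0 w))%Q. qring. }
set (c := qinv (u0 s)).
set (la := map (fun uv : (quat -> quat) * (quat -> quat) => ((fun q => fst uv q - u0 q * (c * fst uv s))%Q, snd uv)) l').
set (zeta := fun q => (u0 q * c - e q * RtoQ d)%Q).
assert (Ra : regular_pairs la).
{ apply Forall_map. eapply Forall_impl; [| exact R']. simpl. intros uv [A B]. split; [| exact B].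
  apply regular_sub; [exact A | now apply regular_mul_r]. }
assert (Kla : forall x y, Rabs x < 1 -> Rabs y < 1 ->
  ksum l (RtoQ x) (RtoQ y) = (ksum la (RtoQ x) (RtoQ y) + u0 (RtoQ x) * c * qconj (e (RtoQ y)))%Q).
{ intros x y Hx Hy. unfold la. rewrite ksum_map_fst, Kl, <- Ks, Kl by exact Hy.
  rewrite !qmul_addr.
  assert (Hcan : (u0 (RtoQ x) * c * (u0 s * qconj (v0 (RtoQ y))) = u0 (RtoQ x) * qconj (v0 (RtoQ y)))%Q).
  { rewrite <- (qmul_assoc (u0 (RtoQ x))), (qmul_assoc c). unfold c. rewrite qinv_l by exact Ht.
    now rewrite qmul_1l. }
  rewrite Hcan, !qmul_assoc.
  generalize (ksum l' (RtoQ x) (RtoQ y)) (u0 (RtoQ x) * qconj (v0 (RtoQ y)))%Q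
    (u0 (RtoQ x) * c * ksum l' s (RtoQ y))%Q. qring. }
assert (N1 : forall x y, Rabs x < 1 -> Rabs y < 1 ->
  (m (RtoQ x) * (1 - h (RtoQ x) * qconj (h (RtoQ y))) * qconj (m (RtoQ y)) =
   RtoQ (1 - x * y) * (ksum la (RtoQ x) (RtoQ y) + zeta (RtoQ x) * qconj (e (RtoQ y))))%Q).
{ intros x y Hx Hy. assert (K := star_kernel m h x y Rm Rh Hx Hy).
  rewrite !Ef, E, Kla in K by (try assumption; now apply Rb).
  assert (K2 := moebius_kernel s e x y Hs Ee Hx Hy). fold m d in K2. rewrite K2 in K.
  set (T := (m (RtoQ x) * (1 - h (RtoQ x) * qconj (h (RtoQ y))) * qconj (m (RtoQ y)))%Q) in *.
  unfold zeta. rewrite qmul_subl. revert K.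
  generalize (ksum la (RtoQ x) (RtoQ y)) (u0 (RtoQ x) * c * qconj (e (RtoQ y)))%Q
    (e (RtoQ x) * RtoQ d * qconj (e (RtoQ y)))%Q.
  clearbody T. clear. intros u v w K.
  replace T with ((RtoQ (1 - x * y) * w + T) - RtoQ (1 - x * y) * w)%Q by qring.
  rewrite <- K. qring. }
(* conjugation turns regularity in the second argument into that in the first *)
assert (Zeta : forall x, Rabs x < 1 -> zeta (RtoQ x) = (RtoQ (-1) * (ksum la (RtoQ x) s * RtoQ d))%Q).
{ intros x Hx.
  assert (Rg : regular (fun q => 1 - h q * qconj (h (RtoQ x)))%Q) by now apply regular_one_sub.
  assert (K : (ksum (kswap la) s (RtoQ x) + e s * qconj (zeta (RtoQ x)) = 0)%Q).
  { apply (kernel_extend_zero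
      (fun q => star m (fun q => 1 - h q * qconj (h (RtoQ x)))%Q q * qconj (m (RtoQ x)))%Q
      (fun q => ksum (kswap la) q (RtoQ x) + e q * qconj (zeta (RtoQ x)))%Q x s); try assumption.
    - apply regular_mul_r. now apply regular_star.
    - apply regular_add; [now apply regular_ksum, regular_pairs_swap | now apply regular_mul_r].
    - intros y Hy. rewrite star_real by assumption.
      assert (K := f_equal qconj (N1 x y Hx Hy)).
      rewrite !qconj_mul, qconj_sub, qconj_mul, !qconj_conj, qconj_add, qconj_mul, qconj_conj, !qconj_RtoQ, <- ksum_swap in K.
      rewrite <- qmul_assoc, K, <- RtoQ_comm. do 2 f_equal. ring.
    - rewrite Z by exact Rg. apply qmul_0l. }
  rewrite ksum_swap in K.
  assert (K2 := f_equal (fun q => RtoQ d * q)%Q K). cbv beta in K2.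
  rewrite qmul_addr, (qmul_assoc (RtoQ d) (e s)), Es, qmul_1l, qmul_0r in K2.
  apply (f_equal qconj) in K2. rewrite qconj_add, qconj_mul, !qconj_conj, !qconj_RtoQ in K2.
  revert K2. generalize (ksum la (RtoQ x) s * RtoQ d)%Q (zeta (RtoQ x)). intros u v K2.
  replace v with ((u + v) + RtoQ (-1) * u)%Q by qring. rewrite K2. apply qadd_0l. }
set (lb := map (fun uv : (quat -> quat) * (quat -> quat) => (fst uv, (fun q => snd uv q - e q * (RtoQ d * snd uv s))%Q)) la).
assert (Rbl : regular_pairs lb).
{ apply Forall_map. eapply Forall_impl; [| exact Ra]. simpl. intros uv [A B]. split; [exact A |].
  apply regular_sub; [exact B | now apply regular_mul_r]. }
assert (Zb : List.Forall (fun uv => fst uv s = 0%Q /\ snd uv s = 0%Q) lb).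
{ unfold lb, la. rewrite map_map. apply Forall_map. apply Forall_forall. intros [u v] _. simpl. split.
  - rewrite qmul_assoc. unfold c. rewrite qinv_r by exact Ht. rewrite qmul_1l. apply qsub_diag.
  - rewrite qmul_assoc, <- RtoQ_comm, Es, qmul_1l. apply qsub_diag. }
assert (N2 : forall x y, Rabs x < 1 -> Rabs y < 1 ->
  (m (RtoQ x) * (1 - h (RtoQ x) * qconj (h (RtoQ y))) * qconj (m (RtoQ y)) =
   RtoQ (1 - x * y) * ksum lb (RtoQ x) (RtoQ y))%Q).
{ intros x y Hx Hy. rewrite N1, Zeta by assumption. f_equal. unfold lb. rewrite ksum_map_snd, qconj_RtoQ.
  rewrite <- (qmul_assoc (RtoQ (-1))), <- (qmul_assoc (ksum la (RtoQ x) s)).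
  generalize (ksum la (RtoQ x) (RtoQ y)) (ksum la (RtoQ x) s * (RtoQ d * qconj (e (RtoQ y))))%Q. qring. }
destruct (ksum_divide lb s Hs Rbl Zb) as (lc & Lc & Rc & Ec).
exists lc. split; [| split; [exact Rc |]].
{ rewrite Lc. unfold lb, la. now rewrite !length_map. }
(* cancellation of the Moebius factors: they may vanish at a real [s], hence [star_cancel] *)
assert (N3 : forall x y, Rabs x < 1 -> Rabs y < 1 ->
  (m (RtoQ x) * (1 - h (RtoQ x) * qconj (h (RtoQ y)) - RtoQ (1 - x * y) * ksum lc (RtoQ x) (RtoQ y))
    * qconj (m (RtoQ y)) = 0)%Q).
{ intros x y Hx Hy. rewrite qmul_subr, qmul_subl, N2, Ec by assumption. fold m.
  rewrite RtoQ_mul_comm, <- (qmul_assoc (RtoQ (1 - x * y))). apply qsub_diag. }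
assert (MZ : forall g, regular g -> (forall x, Rabs x < 1 -> m (RtoQ x) * g (RtoQ x) = 0)%Q ->
  forall x, Rabs x < 1 -> g (RtoQ x) = 0%Q).
{ intros g Rg H x Hx. apply (star_cancel s g (fun _ => 0%Q)); [exact Rg | apply regular_cst | | now apply Rb].
  intros t Htt. rewrite <- (Em t Htt). fold m. cbv beta.
  now rewrite <- !qmul_assoc, H, !qmul_0r by exact Htt. }
assert (Creg : forall l0 x, regular_pairs l0 ->
  regular (fun q => 1 - h q * qconj (h (RtoQ x)) - (ksum l0 q (RtoQ x) - q * ksum l0 q (RtoQ x) * RtoQ x))%Q).
{ intros l0 x Rl0. apply regular_sub; [now apply regular_one_sub |].
  apply regular_sub; [now apply regular_ksum | apply regular_mul_r, regular_id_mul; now apply regular_ksum]. }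
assert (Cval : forall w x y, (w - RtoQ y * w * RtoQ x = RtoQ (1 - x * y) * w)%Q) by qring.
assert (N4 : forall x y, Rabs x < 1 -> Rabs y < 1 ->
  (m (RtoQ x) * (1 - h (RtoQ x) * qconj (h (RtoQ y)) - RtoQ (1 - x * y) * ksum lc (RtoQ x) (RtoQ y)) = 0)%Q).
{ intros x y Hx Hy.
  assert (K := MZ _ (regular_mul_r _ (qconj (m (RtoQ x))) (Creg (kswap lc) x (regular_pairs_swap _ Rc)))).
  cbv beta in K.
  assert (K2 : (forall y, Rabs y < 1 ->  m (RtoQ y) *
     ((1 - h (RtoQ y) * qconj (h (RtoQ x)) - (ksum (kswap lc) (RtoQ y) (RtoQ x)
       - RtoQ y * ksum (kswap lc) (RtoQ y) (RtoQ x) * RtoQ x)) * qconj (m (RtoQ x))) = 0)%Q).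
  { intros t Htt. rewrite Cval, ksum_swap. assert (K3 := f_equal qconj (N3 x t Hx Htt)).
    rewrite !qconj_mul, !qconj_sub, !qconj_mul, !qconj_conj, !qconj_RtoQ in K3.
    rewrite <- (RtoQ_comm (1 - x * t)) in K3. exact K3. }
  specialize (K K2 y Hy). rewrite Cval, ksum_swap in K.
  apply (f_equal qconj) in K.
  rewrite !qconj_mul, !qconj_sub, !qconj_mul, !qconj_conj, !qconj_RtoQ in K.
  rewrite <- (RtoQ_comm (1 - x * y)) in K. exact K. }
intros x y Hx Hy. apply qsub_eq0.
assert (K := MZ _ (Creg lc y Rc)). cbv beta in K.
rewrite <- (Rmult_comm y x), <- Cval. apply K; [| exact Hx].
intros t Htt. rewrite Cval, (Rmult_comm y t). now apply N4.
Qed.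

(** Splitting off one zero lowers the rank by one, so after at most [k] steps no zeros
    are left, and [zero_free_constant] applies. A kernel of rank zero means |f| = 1 on
    the real axis, so that there is no zero to begin with. *)
Lemma blaschke_of_rank k : forall f, schur f -> bdry_unimodular f -> kernel_rank_le k f ->
  exists s u, (length s <= k)%nat /\ List.Forall in_ball s /\ qnorm u = 1 /\
    forall q, in_ball q -> f q = blaschke_prod s u q.
Proof.
induction k as [| k IH]; intros f Hf HU HK;
destruct (excluded_middle_informative (exists s, in_ball s /\ f s = 0%Q)) as [(s & Hs & Fs) | N].
- exfalso. destruct HK as (l & L & _ & E). destruct l; [| discriminate L].
  assert (H0 : qnorm (f 0%Q) = 1).
  { assert (Z0 : Rabs 0 < 1) by (rewrite Rabs_R0; lra).
    assert (K := E 0 0 Z0 Z0). simpl in K. rewrite qmul_0r, qmul_conj_r in K.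
    apply qsub_eq0, (f_equal Q0) in K. change (1 = qnorm (f 0%Q) ^ 2) in K.
    assert (P := qnorm_ge0 (f 0%Q)). nra. }
  rewrite (max_const f (proj1 Hf) (proj2 Hf) H0 s Hs) in Fs. rewrite Fs, qnorm_0 in H0. lra.
- destruct (zero_free_constant f Hf HU) as (u & Hu & E).
  { intros q Hq Fq. apply N. now exists q. }
  exists nil, u. split; [simpl; lia | split; [constructor | split; [exact Hu | exact E]]].
- destruct (moebius_factor f s (proj1 Hf) Hs Fs) as (h & Rh & Ef).
  destruct (moebius_spec s Hs) as ([Rm _] & _ & _).
  destruct (moebius_quotient s f h Hs Hf Rh Ef) as [Sh Uh].
  destruct (IH h Sh (Uh HU) (kernel_rank_peel k f h s Hs Rh Ef HK)) as (ss & u & L & F & Hu & E).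
  exists (s :: ss), u. split; [simpl; lia | split; [now constructor | split; [exact Hu |]]].
  intros q Hq. simpl. rewrite <- Ef by exact Hq.
  now rewrite (star_ext (moebius s) (moebius s) h (blaschke_prod ss u) Rm Rh (fun _ _ => eq_refl) E).
- destruct (zero_free_constant f Hf HU) as (u & Hu & E).
  { intros q Hq Fq. apply N. now exists q. }
  exists nil, u. split; [simpl; lia | split; [constructor | split; [exact Hu | exact E]]].
Qed.

(** The invariant that is carried from the iterated quotients back to [f]. Unlike a
    factorization into Moebius factors it is visibly stable under Moebius
    transformations. *)
Definition rank_inner (k : nat) (f : quat -> quat) : Prop :=
  schur f /\ bdry_unimodular f /\ kernel_rank_le k f.

Lemma rank_inner_constant f : regular f -> unimodular_constant f -> rank_inner 0 f.
Proof.
intros Rf (u & Hu & E). split; [split | split].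
- exact Rf.
- intros q Hq. rewrite E by exact Hq. lra.
- intros e He. exists 0. split; [lra |]. intros q Hq _. rewrite E by exact Hq. lra.
- exists nil. split; [reflexivity | split; [constructor |]]. intros x y Hx Hy. simpl.
  rewrite !E by now apply in_ball_RtoQ. rewrite qmul_conj_r, Hu, qmul_0r. qring.
Qed.

Lemma hyp_quot_schur f p : regular f -> (forall q, in_ball q -> in_ball (f q)) -> in_ball p ->
  schur (hyp_quot f p).
Proof.
intros Rf Hf Hp. destruct (hyp_quot_spec f p Rf Hf Hp) as [Rh E].
assert (Sf : schur f) by (split; [exact Rf |]; intros q Hq; now left; apply Hf).
destruct (moebius_act_spec f (f p) Sf (Hf p Hp)) as [RX EX].
exact (proj1 (moebius_quotient p _ _ Hp (mob_schur _ _ _ Sf (Hf p Hp) RX EX) Rh E)).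
Qed.

(** [f] is recovered from its quotient by a multiplication by M_p, which costs one rank,
    and a Moebius transformation, which costs none. *)
Lemma rank_inner_hyp_quot k f p : regular f -> (forall q, in_ball q -> in_ball (f q)) -> in_ball p ->
  rank_inner k (hyp_quot f p) -> rank_inner (S k) f.
Proof.
intros Rf Hf Hp (Sh & Uh & Kh). destruct (hyp_quot_spec f p Rf Hf Hp) as [Rh E].
assert (Sf : schur f) by (split; [exact Rf |]; intros q Hq; now left; apply Hf).
assert (Hc := Hf p Hp).
destruct (moebius_act_spec f (f p) Sf Hc) as [RX EX].
set (X := moebius_act (f p) f) in *.
assert (SX := mob_schur _ _ _ Sf Hc RX EX).
destruct (moebius_spec p Hp) as ([Rm _] & Um & _).
assert (EX' := mob_rel_invert (f p) f X Hc SX EX).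
assert (Hc' : in_ball (- f p)%Q) by (unfold in_ball; now rewrite qnorm_opp).
split; [exact Sf | split].
- apply (mob_bdry (- f p)%Q X f SX Hc' Rf EX').
  intros e He. destruct (bdry_star _ _ Rm Rh Um Uh e He) as (r & Hr & K).
  exists r. split; [exact Hr |]. intros q Hq Hrq. rewrite <- E by exact Hq. now apply K.
- apply (kernel_rank_mob (S k) X f (- f p)%Q SX Hc' EX').
  destruct (kernel_rank_moebius_mul k p _ Hp Rh Kh) as (l & L & R & El).
  exists l. split; [exact L | split; [exact R |]]. intros x y Hx Hy.
  rewrite <- !E by now apply in_ball_RtoQ. now apply El.
Qed.

Lemma rank_inner_blaschke k f : rank_inner k f -> (forall q, in_ball q -> in_ball (f q)) ->
  exists j, (j <= k)%nat /\ is_blaschke j f.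
Proof.
intros (Sf & Uf & Kf) Hf. destruct (blaschke_of_rank k f Sf Uf Kf) as (s & u & L & F & Hu & E).
exists (length s). split; [exact L |]. split.
- destruct s as [| s0 s]; [exfalso | simpl; lia].
  assert (B0 := in_ball_0).
  assert (K := Hf _ B0). unfold in_ball in K. rewrite E in K by exact B0.
  simpl in K. unfold cst in K. lra.
- now exists s, u.
Qed.

Lemma iter_hyp_quot_S f ps m : ~ unimodular_constant (iter_hyp_quot f ps m) ->
  iter_hyp_quot f ps (S m) = hyp_quot (iter_hyp_quot f ps m) (ps (S m)).
Proof.
intros H. destruct m as [| m]; [reflexivity |].
transitivity (if excluded_middle_informative (unimodular_constant (iter_hyp_quot f ps (S m)))
  then iter_hyp_quot f ps (S m) else hyp_quot (iter_hyp_quot f ps (S m)) (ps (S (S m)))); [reflexivity |].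
now destruct (excluded_middle_informative (unimodular_constant (iter_hyp_quot f ps (S m)))).
Qed.

(** If the m-th quotient were the first unimodular constant, it would have rank zero, so
    that [f] would have rank at most m and be a Blaschke product of degree at most m. *)
Lemma iter_hyp_quot_self f ps n : regular f -> (forall q, in_ball q -> in_ball (f q)) ->
  (forall i, (1 <= i <= n)%nat -> in_ball (ps i)) ->
  ~ (exists k, (k <= n)%nat /\ is_blaschke k f) ->
  forall m, (m <= n)%nat ->
    regular (iter_hyp_quot f ps m) /\
    (forall q, in_ball q -> in_ball (iter_hyp_quot f ps m q)) /\
    (forall k, rank_inner k (iter_hyp_quot f ps m) -> rank_inner (k + m) f).
Proof.
intros Rf Hf Hps HB m. induction m as [| m IH]; intros Hm.
- split; [exact Rf | split; [exact Hf |]]. intros k. now rewrite Nat.add_0_r.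
- destruct (IH ltac:(lia)) as (Rg & Hg & Cg). set (g := iter_hyp_quot f ps m) in *.
  assert (B0 := in_ball_0).
  assert (NU : ~ unimodular_constant g).
  { intros (u & Hu & E). assert (K := Hg _ B0). unfold in_ball in K. rewrite E in K by exact B0. lra. }
  rewrite (iter_hyp_quot_S f ps m NU). fold g.
  assert (Hp := Hps (S m) ltac:(lia)).
  assert (Sh := hyp_quot_schur g _ Rg Hg Hp).
  assert (C : forall k, rank_inner k (hyp_quot g (ps (S m))) -> rank_inner (k + S m) f).
  { intros k Hk. rewrite <- Nat.add_succ_comm. apply Cg. now apply (rank_inner_hyp_quot k g (ps (S m))). }
  split; [apply Sh | split; [| exact C]].
  destruct (schur_dichotomy _ Sh) as [U | U]; [exfalso | exact U].
  apply HB. destruct (rank_inner_blaschke (S m) f) as (j & Hj & Bj).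
  + apply (C 0%nat), rank_inner_constant; [apply Sh | exact U].
  + exact Hf.
  + exists j. split; [lia | exact Bj].
Qed.

Theorem theorem4p3 :
  forall (f : quat -> quat),
  slice_regular f ->
  (forall q : quat, in_ball q -> in_ball (f q)) ->
  forall (n : nat), (0 < n)%nat ->
  forall (p : quat) (ps : nat -> quat),
  in_ball p ->
  (forall i : nat, (1 <= i <= n)%nat -> in_ball (ps i)) ->
  ~ (exists k : nat, (k <= n)%nat /\ is_blaschke k f) ->
  let g := iter_hyp_quot f ps n in
  (forall q : quat, in_ball q ->
     qnorm (moebius_act (g p) g q) <= qnorm (moebius p q)) /\
  (~ is_blaschke (n + 1) f ->
   forall q : quat, in_ball q -> q <> p ->
     qnorm (moebius_act (g p) g q) < qnorm (moebius p q)).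
Proof.
intros f Hf Hfb n Hn p ps Hp Hps HB g.
apply slice_regular_regular in Hf.
destruct (iter_hyp_quot_self f ps n Hf Hfb Hps HB n (Nat.le_refl n)) as (Rg & Hg & Cg).
fold g in Rg, Hg, Cg.
destruct (hyp_quot_spec g p Rg Hg Hp) as [Rh E].
assert (Sh := hyp_quot_schur g p Rg Hg Hp).
destruct (moebius_spec p Hp) as ([Rm _] & _ & _).
split.
- intros q Hq. rewrite <- E by exact Hq. rewrite <- (Rmult_1_r (qnorm (moebius p q))).
  apply star_bound; try assumption; [lra | lra |].
  intros s Hs. apply Sh. now apply same_sphere_ball with q.
- intros NB q Hq Hqp. rewrite <- E by exact Hq.
  assert (Nm : moebius p q <> 0%Q) by (intros Z; apply Hqp; now apply moebius_zero).
  destruct (star_eval (moebius p) (hyp_quot g p) q Rm Rh Hq Nm) as (s & Hs & ->).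
  rewrite qnorm_mul. apply qnorm_pos in Nm.
  destruct (schur_dichotomy _ Sh) as [U | U].
  + exfalso.
    destruct (rank_inner_blaschke (1 + n) f) as (j & Hj & Bj); [| exact Hfb |].
    * apply Cg, (rank_inner_hyp_quot 0 g p Rg Hg Hp), rank_inner_constant; assumption.
    * destruct (Nat.eq_dec j (n + 1)) as [-> | Nj]; [contradiction |].
      apply HB. exists j. split; [lia | exact Bj].
  + specialize (U s (same_sphere_ball _ _ Hs Hq)). nra.
Qed.
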